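(* Let $p\in[1,+\infty)$, $(\boldsymbol\mu_n)\subset\mathcal P_{\pi,p}(\Omega\times X)$ and $\boldsymbol\mu\in\mathcal P_{\pi,p}(\Omega\times X)$ be given, with disintegrations $\{\mu^n_\omega\}_{\omega\in\Omega}$ and $\{\mu_\omega\}_{\omega\in\Omega}$ against $\pi$. Then $W_{\pi,p}(\boldsymbol\mu_n,\boldsymbol\mu)\to0$ as $n\to+\infty$ if and only if, for every $\phi\in C^0_p(X,\mathbb R)$, the functions $\omega\mapsto\int_X\phi(x)\,d\mu^n_\omega(x)$ converge strongly in $L^1(\Omega,\mathbb R;\pi)$ to $\omega\mapsto\int_X\phi(x)\,d\mu_\omega(x)$ as $n\to+\infty$. Under the additional assumption that $\pi\in\mathcal P_p(\Omega)$, it also holds that $W_p(\boldsymbol\mu_n,\boldsymbol\mu)\to0$ as $n\to+\infty$ if and only if, for every $\phi\in C^0_p(X,\mathbb R)$, the functions $\omega\mapsto\int_X\phi(x)\,d\mu^n_\omega(x)$ converge weakly in $L^1(\Omega,\mathbb R;\pi)$ to $\omega\mapsto\int_X\phi(x)\,d\mu_\omega(x)$ as $n\to+\infty$.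
   Context: $(\Omega,\mathsf d_\Omega)$ is a Polish space, $\pi$ a probability measure on $\Omega$, and $(\Omega,\mathcal A,\pi)$ the corresponding complete probability space. $(X,\|\cdot\|_X)$ is a separable Banach space. $\mathcal P_p(\Omega)$ is the set of Borel probability measures on $\Omega$ with finite $p$-th moment with respect to $\mathsf d_\Omega$. $C^0_p(X,\mathbb R)$ is the set of continuous functions $\phi:X\to\mathbb R$ such that $|\phi(x)|\le\alpha_\phi(1+\|x-x_0\|_X^p)$ for all $x\in X$ and some $(\alpha_\phi,x_0)\in\mathbb R_+\times X$. $\mathcal P_\pi(\Omega\times X)$ is the set of Borel probability measures on $\Omega\times X$ with first marginal $\pi$. Each such $\boldsymbol\mu$ has a $\pi$-a.e. uniquely determined Borel disintegration $\{\mu_\omega\}_{\omega\in\Omega}\subset\mathcal P(X)$, written $\boldsymbol\mu=\int_\Omega\mu_\omega\,d\pi(\omega)$. $\mathcal P_{\pi,p}(\Omega\times X)$ is the subset of those with $\int_\Omega\int_X\|x\|_X^p\,d\mu_\omega(x)\,d\pi(\omega)<+\infty$. The fibred Wasserstein distance is $W_{\pi,p}(\boldsymbol\mu,\boldsymbol\nu):=\big(\int_\Omega W_p^p(\mu_\omega,\nu_\omega)\,d\pi(\omega)\big)^{1/p}$, where on the right $W_p$ is the classical Wasserstein distance over $\mathcal P_p(X)$. $W_p(\boldsymbol\mu,\boldsymbol\nu)$ is the classical Wasserstein distance between measures on $\Omega\times X$ endowed with the metric $\big(\mathsf d_\Omega^p(\omega,\theta)+\|x-y\|_X^p\big)^{1/p}$.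 *)

(* Defs.v *)
From HB Require Import structures.
From mathcomp Require Import all_boot all_order all_algebra.
From mathcomp Require Import all_classical all_reals all_analysis.

Set Implicit Arguments.
Unset Strict Implicit.
Unset Printing Implicit Defensive.

Import Order.TTheory GRing.Theory Num.Theory.
Import numFieldNormedType.Exports.

Local Open Scope classical_set_scope.
Local Open Scope ring_scope.

(* Pointedness is required by [g_sigma_algebraType]; it costs nothing for a
   space carrying a probability measure. *)
#[short(type="completePMetricType")]
HB.structure Definition CompletePMetric (R : numDomainType) :=
  { T of Metric R T & Complete T & isPointed T }.

Definition separable (T : topologicalType) : Prop :=
  exists2 D : set T, countable D & dense D.

(* The measurable space of [borel S * borel T] carries the product
   sigma-algebra, which is the Borel sigma-algebra of the product topology when
   [S] and [T] are separable metric spaces. *)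
Notation borel T := (g_sigma_algebraType (@open T)).

Section wasserstein.
Context d (T : measurableType d) (R : realType).
Implicit Types (mu nu : {measure set T -> \bar R}) (dist : T -> T -> R).
Local Open Scope ereal_scope.

Definition couplings mu nu : set (probability (T * T)%type R) :=
  [set g | forall A, measurable A ->
    pushforward g fst A = mu A /\ pushforward g snd A = nu A].

Definition wasserstein dist (p : R) mu nu : \bar R :=
  (ereal_inf [set \int[g]_z (dist z.1 z.2 `^ p)%:E | g in couplings mu nu])
    `^ p^-1.

Definition finite_moment dist (p : R) : set (probability T R) :=
  [set P | exists x0, \int[P]_x (dist x x0 `^ p)%:E < +oo].

End wasserstein.

Section distances.
Context (R : realType) (Omega : completePMetricType R)
  (X : completeNormedModType R).

Definition normdist (x y : borel X) : R := `|(x : X) - (y : X)|.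

Definition basedist (x y : borel Omega) : R := mdist (x : Omega) (y : Omega).

Definition proddist (p : R) (z w : borel Omega * borel X) : R :=
  (basedist z.1 w.1 `^ p + normdist z.2 w.2 `^ p) `^ p^-1.

End distances.

Section fibred.
Context (R : realType) (Omega : completePMetricType R)
  (X : completeNormedModType R) (pi : probability (borel Omega) R).
Local Open Scope ereal_scope.

Definition fst_marginal : set (probability (borel Omega * borel X)%type R) :=
  [set mu | forall A, measurable A -> pushforward mu fst A = pi A].

Definition disintegration (mu : probability (borel Omega * borel X)%type R)
    (k : R.-pker borel Omega ~> borel X) : Prop :=
  forall E, measurable E -> mu E = \int[pi]_w k w (xsection E w).

Definition fst_marginal_moment (p : R) :
    set (probability (borel Omega * borel X)%type R) :=
  fst_marginal `&`
  [set mu | exists2 k, disintegration mu k &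
    \int[pi]_w \int[k w]_x (`|(x : X)| `^ p)%:E < +oo].

(* The fibred distance between two measures, computed on (pi-a.e. unique)
   disintegrations [k] and [l] of them. *)
Definition fibred_wasserstein (p : R) (k l : R.-pker borel Omega ~> borel X)
    : \bar R :=
  (\int[pi]_w (wasserstein (@normdist R X) p (k w) (l w) `^ p)) `^ p^-1.

End fibred.

Definition C0p (R : realType) (X : normedModType R) (p : R) : set (X -> R) :=
  [set phi | continuous phi /\ exists (alpha : R) (x0 : X),
    0 <= alpha /\ forall x, `|phi x| <= alpha * (1 + `|x - x0| `^ p)].

Section L1_convergence.
Context d (T : measurableType d) (R : realType).
Variable mu : {measure set T -> \bar R}.

Definition strong_cvg_L1 (f_ : nat -> T -> R) (f : T -> R) : Prop :=
  [/\ forall n, f_ n \in Lfun mu 1, f \in Lfun mu 1 &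
      ('N[mu]_1[EFin \o (f_ n \- f)%R])%E @[n --> \oo] --> 0%E].

(* Weak topology sigma(L^1, L^oo): for a finite measure the dual of L^1 is
   L^oo.  Working with [mu] on its sigma-algebra rather than on the completion
   gives the same classes in L^1 and L^oo. *)
Definition weak_cvg_L1 (f_ : nat -> T -> R) (f : T -> R) : Prop :=
  [/\ forall n, f_ n \in Lfun mu 1, f \in Lfun mu 1 &
      forall g, g \in Lfun mu +oo ->
        \int[mu]_x (f_ n x * g x) @[n --> \oo] --> \int[mu]_x (f x * g x)].

End L1_convergence.

Section fibre_integral.
Context (R : realType) (Omega : completePMetricType R)
  (X : completeNormedModType R).

(* Real-valued version of the integral: the value where [phi] is not
   [k w]-integrable is irrelevant, for [phi] in [C0p] such [w] being negligible
   by the moment condition. *)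
Definition fibre_int (phi : X -> R) (k : R.-pker borel Omega ~> borel X)
    (w : borel Omega) : R := \int[k w]_x phi x.

End fibre_integral.

(* Main.v *)
Require Import Defs.
From HB Require Import structures.
From mathcomp Require Import all_boot all_order all_algebra.
From mathcomp Require Import finmap.
From mathcomp Require Import all_classical all_reals all_analysis.
From mathcomp Require Import measurable_realfun ess_sup_inf.
From mathcomp Require Import ring lra.
Set Implicit Arguments.
Unset Strict Implicit.
Unset Printing Implicit Defensive.
Import Order.TTheory GRing.Theory Num.Theory.
Import numFieldNormedType.Exports.
Local Open Scope classical_set_scope.
Local Open Scope ring_scope.

(** Everything rests on two estimates for the transport cost [W = W_p^p].

    Upper bound: if nonnegative functions [psi_i] of sum at most 1 are supported
    in small bounded cells, coupling the common mass [min(a_i, b_i)] of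
    [psi_i mu] and [psi_i nu] inside each cell, and the remainders
    independently, gives
    [W <= eps + K (H sum_i |a_i - b_i| + int (1 - sum_i psi_i) h d(mu + nu))]
    where [h] is the [p]-th power of the distance to a base point.  With
    continuous cells on [X], applied fibrewise, the right-hand side is
    controlled by test functions of growth [p]; with products of cells on
    [Omega] and on [X] it is controlled by products of bounded and [C0p]
    functions.  No measurable selection of optimal plans is needed.

    Lower bound: if [|f x - f y| <= e (1 + h y) + C c (x, y)] then
    [|int f dmu - int f dnu| <= e (1 + int h dnu) + C W].  Lipschitz functions
    and [h] itself have this property, and any function of growth [p] is
    squeezed between sums of such functions by Lipschitz regularization, which
    gives the converse implications.  For weak convergence, bounded measurable
    functions on [Omega] are reached from Lipschitz ones by density in [L^1(pi)],
    the first marginal being fixed. *)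

(** * Integration preliminaries *)

(** The fibrewise cost is, for each [w], an infimum over all couplings of [k_ n w] and [k w], and
    its measurability in [w] is never established. Its integral over [pi] is therefore handled
    through monotonicity only. For upper bounds the cost lies below a measurable function. For lower
    bounds the inequality is rearranged so that a measurable excess lies below a multiple of the
    cost.

    A second principle is common to all the implications: the parameters (number of cells, level of
    regularization, height of clipping) are chosen by dominated convergence under the limit measure
    [mu] alone, before [n] varies. What is lost under [mu_ n] is then controlled because the tail or
    gap has convergent integrals too, or because it occurs under [mu] only. This takes the place of
    any tightness or uniform integrability argument along the sequence. *)

Section integral_preliminaries.
Context d (T : measurableType d) (R : realType).
Local Open Scope ereal_scope.
Implicit Types (m : {measure set T -> \bar R}) (f g : T -> \bar R).

(** The integral of a nonnegative function is a supremum over the simple functions below it, so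
    monotonicity requires no measurability. *)
Lemma le_ge0_integral_nonmeasurable m f g :
  (forall x, 0 <= f x) -> (forall x, f x <= g x) ->
  \int[m]_x f x <= \int[m]_x g x.
Proof.
move=> f0 fg; rewrite !ge0_integralTE//; last by move=> x; exact: le_trans (fg x).
apply: le_ereal_sup => _ [h hf <-]; exists h => // x.
exact: le_trans (hf x) (fg x).
Qed.

Lemma integral_le_add_nonmeasurable m (u : T -> R) (v c : T -> \bar R) (C : R) :
  (0 < C)%R -> (forall x, 0 <= u x)%R -> measurable_fun setT u ->
  (forall x, 0 <= v x) -> measurable_fun setT v -> (forall x, 0 <= c x) ->
  (forall x, (u x)%:E <= v x + C%:E * c x) ->
  \int[m]_x (u x)%:E <= \int[m]_x v x + C%:E * \int[m]_x c x.
Proof.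
move=> C0 u0 mu v0 mv c0 uvc.
pose g x := maxe ((u x)%:E - v x) 0.
have g0 x : 0 <= g x by rewrite le_max lexx orbT.
have mg : measurable_fun setT g.
  apply: measurable_maxe; last exact: measurable_cst.
  by apply: emeasurable_funB => //; exact/measurable_EFinP.
have gc x : (C^-1)%:E * g x <= c x.
  rewrite muleC lee_pdivrMr// muleC ge_max mule_ge0 ?lee_fin ?(ltW C0)// andbT.
  case: (v x) (v0 x) (uvc x) => [r||//] _ h.
    by rewrite leeBlDl.
  by rewrite addeNy leNye.
have uvg x : (u x)%:E <= v x + g x.
  rewrite /g; case: (v x) (v0 x) => [r||//] _; last by rewrite addye ?leey// gt_eqF// (lt_le_trans (ltNye 0))// le_max lexx orbT.
  rewrite maxEle; case: ifPn; rewrite -?ltNge.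
    by rewrite sube_le0 adde0.
  by move=> _; rewrite addeC subeK.
apply: (@le_trans _ _ (\int[m]_x (v x + g x))).
  by apply: le_ge0_integral_nonmeasurable => // x; rewrite lee_fin.
rewrite ge0_integralD// leeD2l// -[leLHS]mul1e -(divff (lt0r_neq0 C0)) EFinM -muleA.
rewrite lee_wpmul2l ?lee_fin ?(ltW C0)//.
rewrite -ge0_integralZl_EFin ?invr_ge0 ?(ltW C0)//.
apply: le_ge0_integral_nonmeasurable => // x.
by rewrite mule_ge0// lee_fin invr_ge0 ltW.
Qed.

Import HBNNSimple.

(** The standard machine: indicators, simple functions, monotone limits. It serves for densities and
    for disintegrations. *)
Lemma integral_monotone_functional m (J : (T -> \bar R) -> \bar R) :
  (forall A, measurable A -> J (EFin \o \1_A) = m A) ->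
  (forall (r : R) f, (0 <= r)%R -> measurable_fun setT f ->
    (forall x, 0 <= f x) -> J (fun x => r%:E * f x) = r%:E * J f) ->
  (forall f g, measurable_fun setT f -> (forall x, 0 <= f x) ->
    measurable_fun setT g -> (forall x, 0 <= g x) ->
    J (fun x => f x + g x) = J f + J g) ->
  (forall f_ : (T -> \bar R)^nat, (forall n, measurable_fun setT (f_ n)) ->
    (forall n x, 0 <= f_ n x) ->
    (forall x, {homo f_^~ x : a b / (a <= b)%N >-> a <= b}) ->
    J (fun x => limn (f_^~ x)) = limn (fun n => J (f_ n))) ->
  forall f, measurable_fun setT f -> (forall x, 0 <= f x) ->
  \int[m]_x f x = J f.
Proof.
move=> J1 JZ JD Jlim f mf f0.
pose f_ := nnsfun_approx measurableT mf.
have f_lim : f = fun x => limn (fun n => (f_ n x)%:E).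
  by apply/funext => x; apply/esym/cvg_lim => //; exact: cvg_nnsfun_approx.
rewrite [in RHS]f_lim Jlim; last 3 first.
- by move=> n; exact/measurable_EFinP.
- by move=> n x; rewrite lee_fin.
- by move=> x a b ab; rewrite lee_fin; exact/lefP/nd_nnsfun_approx.
transitivity (\int[m]_x (limn (fun n => (f_ n x)%:E))).
  by apply: eq_integral => x _; rewrite [in LHS]f_lim.
rewrite monotone_convergence//; last 3 first.
- by move=> n; exact/measurable_EFinP.
- by move=> n x _; rewrite lee_fin.
- by move=> x _ a b ab; rewrite lee_fin; exact/lefP/nd_nnsfun_approx.
congr (limn _); apply/funext => n.
have J0 : J (fun=> 0) = 0.
  transitivity (J (EFin \o \1_set0)); last by rewrite J1// measure0.
  by congr J; apply/funext => x; rewrite /= indicE in_set0.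
have gE : (fun x => (f_ n x)%:E) = fun x =>
    \sum_(r <- fset_set (range (f_ n))) (r%:E * (\1_(f_ n @^-1` [set r]) x)%:E).
  by apply/funext => x; rewrite fimfunE -fsumEFin// fsbig_finite //.
rewrite gE.
have rpos (r : R) : r \in enum_fset (fset_set (range (f_ n))) -> (0 <= r)%R.
  rewrite -[_ \in _]/(r \in fset_set (range (f_ n))) in_fset_set//.
  by rewrite inE => -[y _ <-].
have F0 (r : R) x : r \in enum_fset (fset_set (range (f_ n))) ->
    0 <= r%:E * (\1_(f_ n @^-1` [set r]) x)%:E.
  move=> /rpos r0.
  by rewrite -EFinM lee_fin mulr_ge0.
have mF (r : R) : measurable_fun setT (fun x => r%:E * (\1_(f_ n @^-1` [set r]) x)%:E).
  by apply: measurable_funeM; apply/measurable_EFinP; exact: measurable_indic.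
(* Induction on the list of values. Only nonnegativity of the terms is carried along, since a sum
   over some of the values is no longer [f_ n]. *)
elim: (enum_fset _) rpos F0 => [|r s IH] rpos F0.
  under eq_integral do rewrite big_nil.
  by under [in RHS]eq_fun do rewrite big_nil; rewrite integral0 J0.
have s0 x : 0 <= \sum_(i <- s) (i%:E * (\1_(f_ n @^-1` [set i]) x)%:E).
  rewrite big_seq sume_ge0// => i si.
  by rewrite F0// inE si orbT.
have ms : measurable_fun setT
    (fun x => \sum_(i <- s) (i%:E * (\1_(f_ n @^-1` [set i]) x)%:E)).
  exact: emeasurable_sum.
have r0 : (0 <= r)%R by rewrite rpos// inE eqxx.
under eq_integral do rewrite big_cons.
under [in RHS]eq_fun do rewrite big_cons.
rewrite JD//; last by move=> x; rewrite F0// inE eqxx.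
rewrite ge0_integralD//; last by move=> x _; rewrite F0// inE eqxx.
rewrite IH; last 2 first.
- by move=> t ts; rewrite rpos// inE ts orbT.
- by move=> t x ts; rewrite F0// inE ts orbT.
congr (_ + _); rewrite JZ//; last exact/measurable_EFinP/measurable_indic.
rewrite ge0_integralZl//; last exact/measurable_EFinP/measurable_indic.
by rewrite integral_indic// setIT -J1.
Qed.

End integral_preliminaries.

(** * Probability measures given by a density *)

Section density.
Context d (T : measurableType d) (R : realType) (m : {measure set T -> \bar R}).
Variable th : T -> R.
Hypotheses (th0 : forall x, 0 <= th x) (mth : measurable_fun setT th).
Local Open Scope ereal_scope.

Definition density_measure (A : set T) : \bar R := \int[m]_(x in A) (th x)%:E.

Let density_measure0 : density_measure set0 = 0.
Proof. by rewrite /density_measure integral_set0. Qed.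

Let density_measure_ge0 A : 0 <= density_measure A.
Proof. by apply: integral_ge0 => x _; rewrite lee_fin. Qed.

Let density_measure_sigma_additive : semi_sigma_additive density_measure.
Proof.
by apply: semi_sigma_additive_nng_induced => [|x]; [exact/measurable_EFinP|rewrite lee_fin].
Qed.

HB.instance Definition _ := isMeasure.Build _ _ _ density_measure
  density_measure0 density_measure_ge0 density_measure_sigma_additive.

Lemma ge0_integral_density (f : T -> \bar R) : measurable_fun setT f ->
  (forall x, 0 <= f x) ->
  \int[density_measure]_x f x = \int[m]_x (f x * (th x)%:E).
Proof.
have mthE : measurable_fun setT (EFin \o th) by exact/measurable_EFinP.
move: f; apply: (@integral_monotone_functional _ _ _ density_measure
  (fun f => \int[m]_x (f x * (th x)%:E))).
- move=> A mA; rewrite [RHS]integral_mkcond epatch_indic.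
  by apply: eq_integral => x _ /=; rewrite muleC.
- move=> r f r0 mf f0; rewrite -ge0_integralZl//.
  + by apply: eq_integral => x _; rewrite muleA.
  + exact: emeasurable_funM.
  + by move=> x _; rewrite mule_ge0// lee_fin.
- move=> f g mf f0 mg g0; rewrite -ge0_integralD//.
  + by apply: eq_integral => x _; rewrite ge0_muleDl.
  + by move=> x _; rewrite mule_ge0// lee_fin.
  + exact: emeasurable_funM.
  + by move=> x _; rewrite mule_ge0// lee_fin.
  + exact: emeasurable_funM.
- move=> f_ mf_ f_0 ndf_; rewrite -monotone_convergence//.
  + apply: eq_integral => x _; apply/esym/cvg_lim => //.
    by apply: cvgeZr => //; apply: ereal_nondecreasing_is_cvgn => a b; exact: ndf_.
  + by move=> n; exact: emeasurable_funM.
  + by move=> n x _; rewrite mule_ge0// lee_fin.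
  + by move=> x _ a b ab; rewrite lee_wpmul2r ?lee_fin// ndf_.
Qed.

(** Turns an explicit density with respect to a product measure into a candidate coupling. *)
Lemma density_probability : \int[m]_x (th x)%:E = 1 ->
  exists P : probability T R,
    (forall A, measurable A -> P A = \int[m]_x ((\1_A x)%:E * (th x)%:E)) /\
    forall f, measurable_fun setT f -> (forall x, 0 <= f x) ->
      \int[P]_x f x = \int[m]_x (f x * (th x)%:E).
Proof.
move=> th1; pose B := @Measure_isProbability.Build _ _ _ density_measure th1.
pose P : probability T R := HB.pack density_measure B.
exists P; split; last exact: ge0_integral_density.
move=> A mA; rewrite -[LHS]/(\int[m]_(x in A) (th x)%:E) integral_mkcond epatch_indic.
by apply: eq_integral => x _ /=; rewrite muleC.
Qed.

End density.

(** The values of a probability kernel are typed only as measures, whereas the transport estimates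
    are stated for the type [probability]. The bridge is that a measure of mass 1 is its own
    normalization. *)
Lemma probability_of_measure d (T : measurableType d) (R : realType)
    (m : {measure set T -> \bar R}) : m setT = 1%E ->
  exists P : probability T R, m = P.
Proof.
move=> m1; exists (mnormalize m (dirac point : probability T R)); apply: eq_measure.
apply/funext => A.
rewrite /= /mnormalize m1 onee_eq0 /=. by rewrite invr1 mule1.
Qed.

(** * Integration against a disintegration *)

Section disintegration_integral.
Context (R : realType) (Omega : completePMetricType R)
  (X : completeNormedModType R) (pi : probability (borel Omega) R)
  (mu : probability (borel Omega * borel X)%type R)
  (k : R.-pker borel Omega ~> borel X).
Hypothesis hk : disintegration pi mu k.
Local Open Scope ereal_scope.

Lemma ge0_integral_disintegration (f : borel Omega * borel X -> \bar R) :
  measurable_fun setT f -> (forall z, 0 <= f z) ->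
  \int[mu]_z f z = \int[pi]_w \int[k w]_x f (w, x).
Proof.
have mk (g : borel Omega * borel X -> \bar R) : measurable_fun setT g -> (forall z, 0 <= g z) ->
    measurable_fun setT (fun w : borel Omega => \int[k w]_x g (w, x)).
  by move=> mg g0; exact: measurable_fun_integral_finite_kernel.
have mpair (g : borel Omega * borel X -> \bar R) (w : borel Omega) : measurable_fun setT g ->
    measurable_fun setT (fun x : borel X => g (w, x) : \bar R).
  by move=> mg; exact: (measurableT_comp mg).
move: f; apply: (@integral_monotone_functional _ _ _ mu
  (fun f => \int[pi]_w \int[k w]_x f (w, x))).
- move=> A mA; apply: etrans (esym (hk mA)).
  apply: eq_integral => w _; rewrite -(setIT (xsection A w)).
  rewrite -integral_indic//; last exact: measurable_xsection.
  by apply: eq_integral => x _ /=; rewrite !indicE mem_xsection.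
- move=> r f r0 mf f0; rewrite -ge0_integralZl//; last 2 first.
  + exact: mk.
  + by move=> w _; exact: integral_ge0.
  by apply: eq_integral => w _; rewrite ge0_integralZl//; exact: mpair.
- move=> f g mf f0 mg g0; rewrite -ge0_integralD//; last 4 first.
  + by move=> w _; exact: integral_ge0.
  + exact: mk.
  + by move=> w _; exact: integral_ge0.
  + exact: mk.
  by apply: eq_integral => w _; rewrite ge0_integralD//; exact: mpair.
- move=> f_ mf_ f_0 ndf_; rewrite -monotone_convergence//.
  + apply: eq_integral => w _; rewrite -monotone_convergence//.
    * by move=> n; exact: mpair (mf_ n).
  + by move=> n; apply: mk => // z; exact: f_0.
  + by move=> n w _; exact: integral_ge0.
  + move=> w _ a b ab; apply: ge0_le_integral => //.
    * exact: mpair (mf_ a).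
    * exact: mpair (mf_ b).
    * by move=> x _; exact: ndf_.
Qed.

End disintegration_integral.

(** * Upper bound for the transport cost *)

Section real_integral.
Context d (T : measurableType d) (R : realType) (P : probability T R).

Lemma bounded_integrable (f : T -> R) (M : R) : measurable_fun setT f ->
  (forall x, `|f x| <= M) -> P.-integrable setT (EFin \o f).
Proof.
move=> mf fM; apply: (@le_integrable _ _ _ P _ measurableT _ (EFin \o cst M)).
- exact/measurable_EFinP.
- by move=> x _ /=; rewrite lee_fin (le_trans (fM x))// ler_norm.
- exact: finite_measure_integrable_cst.
Qed.

Lemma integral_EFin_Rintegral (f : T -> R) : P.-integrable setT (EFin \o f) ->
  (\int[P]_x (f x)%:E = (\int[P]_x f x)%:E)%E.
Proof. by move=> If; rewrite /Rintegral fineK//; exact: integrable_fin_num. Qed.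

Lemma Rintegral_sum (I : finType) (f : I -> T -> R) :
  (forall i, P.-integrable setT (EFin \o f i)) ->
  \int[P]_x (\sum_i f i x) = \sum_i \int[P]_x f i x.
Proof.
move=> If; rewrite {1}/Rintegral; under eq_integral do rewrite -sumEFin.
rewrite (@integral_sum _ _ _ P setT measurableT)//.
under eq_bigr do rewrite integral_EFin_Rintegral//.
by rewrite sumEFin.
Qed.

Lemma integrable_Rsum (I : finType) (f : I -> T -> R) :
  (forall i, P.-integrable setT (EFin \o f i)) ->
  P.-integrable setT (EFin \o (fun x => \sum_i f i x)).
Proof.
move=> If; rewrite (_ : _ \o _ = fun x => (\sum_i (EFin \o f i) x)%E); last first.
  by apply/funext => x /=; rewrite sumEFin.
exact: integrable_sum.
Qed.

Lemma integrable_Rscale (c : R) (f : T -> R) :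
  P.-integrable setT (EFin \o f) ->
  P.-integrable setT (EFin \o (fun x => c * f x)).
Proof. by move=> /(@integrableZl _ _ _ P _ measurableT c). Qed.

Lemma Rintegral_probability_cst (c : R) : \int[P]_x c = c.
Proof. by rewrite Rintegral_cst//= probability_setT/= mulr1. Qed.

Lemma integrable_probability_cst (c : R) : P.-integrable setT (EFin \o fun=> c).
Proof. by apply: (@bounded_integrable _ `|c|). Qed.

Lemma integrable_RB (f g : T -> R) :
  P.-integrable setT (EFin \o f) -> P.-integrable setT (EFin \o g) ->
  P.-integrable setT (EFin \o (fun x => f x - g x)).
Proof. by move=> If Ig; have := integrableB measurableT If Ig. Qed.

Lemma integrable_RD (f g : T -> R) :
  P.-integrable setT (EFin \o f) -> P.-integrable setT (EFin \o g) ->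
  P.-integrable setT (EFin \o (fun x => f x + g x)).
Proof. by move=> If Ig; have := integrableD measurableT If Ig. Qed.

End real_integral.

(** * Mass left over after matching inside cells *)

Section remainder.
Context d (T : measurableType d) (R : realType) (P : probability T R).
Context (I : finType) (psi : I -> T -> R).
Hypotheses (psi0 : forall i x, 0 <= psi i x)
  (mpsi : forall i, measurable_fun setT (psi i))
  (psi1 : forall x, \sum_i psi i x <= 1).
Variable t : I -> R.
Hypotheses (t0 : forall i, 0 <= t i) (tP : forall i, t i <= \int[P]_x psi i x).

Lemma cell_le1 i x : psi i x <= 1.
Proof.
by apply: le_trans (psi1 x); rewrite (bigD1 i)//= lerDl sumr_ge0.
Qed.

Lemma integrable_cell i : P.-integrable setT (EFin \o psi i).
Proof.
by apply: (@bounded_integrable _ _ _ _ _ 1) => // x; rewrite ger0_norm ?cell_le1.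
Qed.

(** The fraction of the mass of cell [i] that gets matched. On a cell of mass 0 the quotient is 0,
    in agreement with [t i = 0] there. *)
Definition matched_weight i : R := t i / \int[P]_x psi i x.

(** Density with respect to [P] of the unmatched part of [P]. *)
Definition remainder x : R := 1 - \sum_i matched_weight i * psi i x.

Lemma matched_weight_ge0 i : 0 <= matched_weight i.
Proof. by rewrite divr_ge0// (le_trans (t0 i)). Qed.

Lemma matched_weight_le1 i : matched_weight i <= 1.
Proof.
rewrite /matched_weight; have [->|p0] := eqVneq (\int[P]_x psi i x) 0.
  by rewrite invr0 mulr0.
by rewrite ler_pdivrMr ?mul1r// lt_neqAle eq_sym p0 (le_trans (t0 i)).
Qed.

Lemma matched_weightM i : matched_weight i * \int[P]_x psi i x = t i.
Proof.
rewrite /matched_weight; have [p0|p0] := eqVneq (\int[P]_x psi i x) 0.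
  by apply/eqP; rewrite p0 mulr0 eq_le t0 -p0 tP.
by rewrite divfK.
Qed.

Lemma remainder_ge0 x : 0 <= remainder x.
Proof.
rewrite subr_ge0; apply: le_trans (psi1 x).
by apply: ler_sum => i _; rewrite ler_piMl// matched_weight_le1.
Qed.

Lemma remainder_le1 x : remainder x <= 1.
Proof.
by rewrite gerBl sumr_ge0// => i _; rewrite mulr_ge0// matched_weight_ge0.
Qed.

Lemma measurable_remainder : measurable_fun setT remainder.
Proof.
apply: measurable_funB => //; apply: measurable_sum => i.
exact: measurable_funM.
Qed.

Lemma Rintegral_remainder : \int[P]_x remainder x = 1 - \sum_i t i.
Proof.
have If i : P.-integrable setT (EFin \o (fun x => matched_weight i * psi i x)).
  exact/integrable_Rscale/integrable_cell.
rewrite RintegralB//; last 2 first.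
- exact: integrable_probability_cst.
- exact: integrable_Rsum.
rewrite Rintegral_probability_cst Rintegral_sum//; congr (_ - _).
apply: eq_bigr => i _; rewrite RintegralZl//; last exact: integrable_cell.
exact: matched_weightM.
Qed.

Lemma integrable_remainder : P.-integrable setT (EFin \o remainder).
Proof.
apply: (@bounded_integrable _ _ _ _ _ 1); first exact: measurable_remainder.
by move=> x; rewrite ger0_norm ?remainder_le1// remainder_ge0.
Qed.

(** The remainder splits into the terms [(1 - matched_weight i) * psi i], of mass [\int psi i - t i]
    and living where [h <= H], and the part [1 - \sum_i psi i] that the cells do not cover. *)
Lemma integral_remainder_moment (h : T -> R) (H : R) :
  (forall x, 0 <= h x) -> measurable_fun setT h -> 0 <= H ->
  (forall i x, 0 < psi i x -> h x <= H) ->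
  (\int[P]_x (h x * remainder x)%:E <=
   (H * \sum_i (\int[P]_x psi i x - t i))%:E +
   \int[P]_x ((1 - \sum_i psi i x) * h x)%:E)%E.
Proof.
move=> h0 mh H0 hH.
pose u x := \sum_i H * (1 - matched_weight i) * psi i x.
have If i : P.-integrable setT
    (EFin \o (fun x => H * (1 - matched_weight i) * psi i x)).
  exact/integrable_Rscale/integrable_cell.
have Iu : P.-integrable setT (EFin \o u) by exact: integrable_Rsum.
have u0 x : 0 <= u x.
  by rewrite sumr_ge0// => i _; rewrite !mulr_ge0// subr_ge0 matched_weight_le1.
have mu : measurable_fun setT u by apply/measurable_EFinP; exact: measurable_int Iu.
have -> : (H * \sum_i (\int[P]_x psi i x - t i))%:E = (\int[P]_x (u x)%:E)%E.
  rewrite integral_EFin_Rintegral// Rintegral_sum//; congr EFin.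
  rewrite mulr_sumr; apply: eq_bigr => i _; rewrite RintegralZl//.
    by rewrite -mulrA mulrBl mul1r matched_weightM.
  exact: integrable_cell.
have mr : measurable_fun setT (fun x => (1 - \sum_i psi i x) * h x).
  apply: measurable_funM => //; apply: measurable_funB => //.
  exact: measurable_sum.
rewrite -ge0_integralD//; last 4 first.
- by move=> x _; rewrite lee_fin.
- exact/measurable_EFinP.
- by move=> x _; rewrite lee_fin mulr_ge0// subr_ge0.
- exact/measurable_EFinP.
apply: le_ge0_integral_nonmeasurable => x.
  by rewrite lee_fin mulr_ge0// remainder_ge0.
rewrite -EFinD lee_fin /remainder /u.
have -> : h x * (1 - \sum_i matched_weight i * psi i x) =
    \sum_i h x * (1 - matched_weight i) * psi i x + (1 - \sum_i psi i x) * h x.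
  under [in RHS]eq_bigr do rewrite -mulrA mulrBl mul1r.
  by rewrite -mulr_sumr sumrB; ring.
rewrite lerD2r; apply: ler_sum => i _.
have := psi0 i x; rewrite le_eqVlt => /predU1P[<-|p0]; first by rewrite !mulr0.
by rewrite ler_wpM2r// ler_wpM2r ?subr_ge0 ?matched_weight_le1//; exact: hH p0.
Qed.

(** The factor [r / r] appears when the product of the two remainders, divided by [r], is integrated
    in one variable. It is 0 rather than 1 when [r = 0], but then the remainder, nonnegative with
    integral 0, vanishes almost everywhere. *)
Lemma integral_matched_remainder A : measurable A ->
  let r := 1 - \sum_i t i in
  (\int[P]_x ((\1_A x)%:E *
    (\sum_i matched_weight i * psi i x + remainder x * (r / r))%:E) = P A)%E.
Proof.
move=> mA r; rewrite -[in RHS](setIT A) -integral_indic//.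
have [r0|r0] := eqVneq r 0; last first.
  by apply: eq_integral => x _; rewrite divff// mulr1 addrC subrK mule1.
rewrite r0 mul0r.
under [LHS]eq_integral do rewrite mulr0 addr0.
have rem0 : ae_eq P setT (EFin \o remainder) (cst 0%E).
  apply/ae_eq_integral_abs => //.
    exact/measurable_EFinP/measurable_remainder.
  under eq_integral do rewrite /= ger0_norm ?remainder_ge0//.
  by rewrite integral_EFin_Rintegral ?Rintegral_remainder -/r ?r0//; exact: integrable_remainder.
apply: ge0_ae_eq_integral => //.
- apply: emeasurable_funM; apply/measurable_EFinP; first exact: measurable_indic.
  by apply: measurable_sum => i; exact: measurable_funM.
- exact/measurable_EFinP/measurable_indic.
- move=> x _; rewrite mule_ge0// lee_fin//.
  by rewrite sumr_ge0// => i _; rewrite mulr_ge0// matched_weight_ge0.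
apply: filterS rem0 => x /(_ Logic.I)/= [rx0] _.
rewrite (_ : \sum_i _ = 1) ?mule1//.
by apply/esym/eqP; rewrite -subr_eq0 -/(remainder x) rx0.
Qed.

End remainder.

(** This is [W_p^p] when [c] is the [p]-th power of a distance. Without the root the estimates are
    linear in it, and a general [c] serves [X] and [Omega * X] alike. *)
Definition transport_cost d (T : measurableType d) (R : realType)
    (c : T * T -> R) (mu nu : {measure set T -> \bar R}) : \bar R :=
  ereal_inf [set (\int[g]_z (c z)%:E)%E | g in couplings mu nu].

Lemma transport_cost_ge0 d (T : measurableType d) (R : realType)
    (c : T * T -> R) (mu nu : {measure set T -> \bar R}) :
  (forall z, 0 <= c z) -> (0 <= transport_cost c mu nu)%E.
Proof.
move=> c0; apply: le_ereal_inf_tmp => _ [g _ <-].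
by apply: integral_ge0 => z _; rewrite lee_fin.
Qed.

(** * The coupling built from cells *)

Section coupling.
Context d (T : measurableType d) (R : realType) (mu nu : probability T R).
Context (I : finType) (psi : I -> T -> R).
Hypotheses (psi0 : forall i x, 0 <= psi i x)
  (mpsi : forall i, measurable_fun setT (psi i))
  (psi1 : forall x, \sum_i psi i x <= 1).

Let a i := \int[mu]_x psi i x.
Let b i := \int[nu]_x psi i x.
Let t i := Num.min (a i) (b i).
Let r := 1 - \sum_i t i.

Let a0 i : 0 <= a i. Proof. exact: Rintegral_ge0. Qed.
Let b0 i : 0 <= b i. Proof. exact: Rintegral_ge0. Qed.
Let t0 i : 0 <= t i. Proof. by rewrite le_min a0 b0. Qed.
Let ta i : t i <= a i. Proof. by rewrite ge_min lexx. Qed.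
Let tb i : t i <= b i. Proof. by rewrite ge_min lexx orbT. Qed.

Let rho := remainder mu psi t.
Let sig := remainder nu psi t.
(** Gives the tensor square of [psi i] the mass [t i] under the product measure. *)
Let al i := t i / (a i * b i).

Let al0 i : 0 <= al i. Proof. by rewrite divr_ge0// mulr_ge0. Qed.

Let rho0 x : 0 <= rho x. Proof. exact: remainder_ge0. Qed.
Let sig0 x : 0 <= sig x. Proof. exact: remainder_ge0. Qed.
Let mrho : measurable_fun setT rho. Proof. exact: measurable_remainder. Qed.
Let msig : measurable_fun setT sig. Proof. exact: measurable_remainder. Qed.

Let r_ge0 : 0 <= r.
Proof.
by rewrite /r -(Rintegral_remainder psi0 mpsi psi1 t0 ta) Rintegral_ge0.
Qed.

Let rr_le1 : r / r <= 1.
Proof.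
by have [->|r0] := eqVneq r 0; [rewrite mul0r|rewrite divff].
Qed.

Let alb i : al i * b i = matched_weight mu psi t i.
Proof.
rewrite /al /matched_weight -/(a i); have [b00|bn0] := eqVneq (b i) 0.
  have -> : t i = 0 by apply/eqP; rewrite eq_le t0 -b00 tb.
  by rewrite !mul0r.
by rewrite invfM mulrA divfK.
Qed.

Let ala i : al i * a i = matched_weight nu psi t i.
Proof.
rewrite /al /matched_weight -/(b i); have [a00|an0] := eqVneq (a i) 0.
  have -> : t i = 0 by apply/eqP; rewrite eq_le t0 -a00 ta.
  by rewrite !mul0r.
by rewrite [a i * _]mulrC invfM mulrA divfK.
Qed.

(* The matched part couples, cell by cell, the smaller of the two masses; the
   remainders are coupled independently. *)
Let th (z : T * T) : R :=
  \sum_i al i * psi i z.1 * psi i z.2 + rho z.1 * sig z.2 / r.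

Let matched0 (z : T * T) : 0 <= \sum_i al i * psi i z.1 * psi i z.2.
Proof. by rewrite sumr_ge0// => i _; apply: mulr_ge0 => //; exact: mulr_ge0. Qed.

Let th0 z : 0 <= th z.
Proof. by rewrite addr_ge0// divr_ge0// mulr_ge0. Qed.

Let mth : measurable_fun setT th.
Proof.
apply: measurable_funD.
  apply: measurable_sum => i; apply: measurable_funM.
    apply: measurable_funM => //.
    exact: (measurableT_comp (mpsi i) measurable_fst).
  exact: (measurableT_comp (mpsi i) measurable_snd).
apply: measurable_funM => //; apply: measurable_funM.
  exact: (measurableT_comp mrho measurable_fst).
exact: (measurableT_comp msig measurable_snd).
Qed.

Let inner1 x : (\int[nu]_y (th (x, y))%:E =
  (\sum_i matched_weight mu psi t i * psi i x + rho x * (r / r))%:E)%E.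
Proof.
have I1 i : nu.-integrable setT (EFin \o (fun y => al i * psi i x * psi i y)).
  exact/integrable_Rscale/integrable_cell.
have I2 : nu.-integrable setT (EFin \o (fun y => rho x / r * sig y)).
  exact/integrable_Rscale/integrable_remainder.
rewrite (_ : (fun y => _) = EFin \o (fun y =>
    \sum_i al i * psi i x * psi i y + rho x / r * sig y)); last first.
  by apply/funext => y /=; rewrite /th/= [rho x * _ * _]mulrAC.
rewrite integral_EFin_Rintegral; last by apply: integrable_RD => //; exact: integrable_Rsum.
congr EFin; rewrite RintegralD//; last exact: integrable_Rsum.
rewrite Rintegral_sum// RintegralZl//; last exact: integrable_remainder.
rewrite /sig (Rintegral_remainder psi0 mpsi psi1 t0 tb) -/r mulrAC mulrA.
congr (_ + _); apply: eq_bigr => i _; rewrite RintegralZl//; last exact: integrable_cell.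
by rewrite -/(b i) mulrAC alb.
Qed.

Let inner2 y : (\int[mu]_x (th (x, y))%:E =
  (\sum_i matched_weight nu psi t i * psi i y + sig y * (r / r))%:E)%E.
Proof.
have I1 i : mu.-integrable setT (EFin \o (fun x => al i * psi i y * psi i x)).
  exact/integrable_Rscale/integrable_cell.
have I2 : mu.-integrable setT (EFin \o (fun x => sig y / r * rho x)).
  exact/integrable_Rscale/integrable_remainder.
rewrite (_ : (fun x => _) = EFin \o (fun x =>
    \sum_i al i * psi i y * psi i x + sig y / r * rho x)); last first.
  apply/funext => x /=; rewrite /th/= [rho x * _]mulrC [sig y * _ * _]mulrAC.
  by congr (_ + _)%:E; apply: eq_bigr => i _; rewrite mulrAC.
rewrite integral_EFin_Rintegral; last by apply: integrable_RD => //; exact: integrable_Rsum.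
congr EFin; rewrite RintegralD//; last exact: integrable_Rsum.
rewrite Rintegral_sum// RintegralZl//; last exact: integrable_remainder.
rewrite /rho (Rintegral_remainder psi0 mpsi psi1 t0 ta) -/r mulrAC mulrA.
congr (_ + _); apply: eq_bigr => i _; rewrite RintegralZl//; last exact: integrable_cell.
by rewrite -/(a i) mulrAC ala.
Qed.

Let marginal1 A : measurable A ->
  (\int[mu \x nu]_z ((\1_A z.1)%:E * (th z)%:E) = mu A)%E.
Proof.
move=> mA; rewrite fubini_tonelli1; last 2 first.
- apply: emeasurable_funM; apply/measurable_EFinP => //.
  by apply: measurableT_comp => //; exact: measurable_indic.
- by move=> z; rewrite mule_ge0 ?lee_fin.
rewrite -(integral_matched_remainder psi0 mpsi psi1 t0 ta mA).
apply: eq_integral => x _; rewrite /fubini_F -inner1 -ge0_integralZl//.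
- by apply/measurable_EFinP; apply: (measurableT_comp mth).
- by move=> y _; rewrite lee_fin.
Qed.

Let marginal2 A : measurable A ->
  (\int[mu \x nu]_z ((\1_A z.2)%:E * (th z)%:E) = nu A)%E.
Proof.
move=> mA; rewrite fubini_tonelli2; last 2 first.
- apply: emeasurable_funM; apply/measurable_EFinP => //.
  by apply: measurableT_comp => //; exact: measurable_indic.
- by move=> z; rewrite mule_ge0 ?lee_fin.
rewrite -(integral_matched_remainder psi0 mpsi psi1 t0 tb mA).
apply: eq_integral => y _; rewrite /fubini_G -inner2 -ge0_integralZl//.
- by apply/measurable_EFinP; apply: (measurableT_comp mth).
- by move=> x _; rewrite lee_fin.
Qed.

Let th_mass : (\int[mu \x nu]_z (th z)%:E = 1)%E.
Proof.
rewrite -(probability_setT mu) -marginal1//.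
by apply: eq_integral => z _; rewrite indicT mul1e.
Qed.

Variables (c : T * T -> R) (h : T -> R) (eps H K : R).
Hypotheses (c0 : forall z, 0 <= c z) (mc : measurable_fun setT c).
Hypotheses (h0 : forall x, 0 <= h x) (mh : measurable_fun setT h).
Hypotheses (eps0 : 0 <= eps) (H0 : 0 <= H) (K0 : 0 <= K).
Hypothesis c_eps : forall i x y, 0 < psi i x -> 0 < psi i y -> c (x, y) <= eps.
Hypothesis h_H : forall i x, 0 < psi i x -> h x <= H.
Hypothesis c_K : forall x y, c (x, y) <= K * (h x + h y).

(** Both points of a matched pair lie in a common cell, whence [eps]; for the independent remainders
    only the growth bound [c_K] is available. *)
Let cost_split z :
  c z * th z <= eps * th z + (K / r * (h z.1 * rho z.1) * sig z.2 +
    K / r * rho z.1 * (h z.2 * sig z.2)).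
Proof.
case: z => x y /=; rewrite /th/=.
have hA : c (x, y) * \sum_i al i * psi i x * psi i y <=
    eps * \sum_i al i * psi i x * psi i y.
  rewrite !mulr_sumr; apply: ler_sum => i _.
  have := psi0 i x; rewrite le_eqVlt => /predU1P[<-|px]; first by rewrite !(mulr0,mul0r).
  have := psi0 i y; rewrite le_eqVlt => /predU1P[<-|py]; first by rewrite !(mulr0,mul0r).
  rewrite ler_wpM2r ?(c_eps px py)//.
  by apply: mulr_ge0 => //; exact: mulr_ge0.
have B0 : 0 <= rho x * sig y / r by rewrite divr_ge0// mulr_ge0.
have -> : K / r * (h x * rho x) * sig y + K / r * rho x * (h y * sig y) =
    K * (h x + h y) * (rho x * sig y / r) by ring.
rewrite [leLHS]mulrDr; apply: (le_trans (lerD hA (ler_wpM2r B0 (c_K x y)))).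
by rewrite [eps * (_ + _)]mulrDr -[leRHS]addrA lerD2l lerDr mulr_ge0.
Qed.

(** Integrating out [z.2] turns [sig / r] into [r / r], which is at most 1, so no inverse power of
    [r] survives. *)
Let cross1 : (\int[mu \x nu]_z (K / r * (h z.1 * rho z.1) * sig z.2)%:E <=
  K%:E * \int[mu]_x (h x * rho x)%:E)%E.
Proof.
have hr0 x : 0 <= h x * rho x by rewrite mulr_ge0.
have mhr : measurable_fun setT (fun x => h x * rho x) by exact: measurable_funM.
rewrite fubini_tonelli1; last 2 first.
- apply/measurable_EFinP; apply: measurable_funM; last first.
    exact: (measurableT_comp msig measurable_snd).
  by apply: measurable_funM => //; exact: (measurableT_comp mhr measurable_fst).
- by move=> z; rewrite lee_fin mulr_ge0// mulr_ge0// divr_ge0.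
rewrite -ge0_integralZl//; last 2 first.
- exact/measurable_EFinP.
- by move=> x _; rewrite lee_fin.
apply: le_ge0_integral_nonmeasurable => x.
  by apply: integral_ge0 => y _; rewrite lee_fin mulr_ge0// mulr_ge0// divr_ge0.
rewrite /fubini_F (_ : (fun y => _) = EFin \o (fun y => K / r * (h x * rho x) * sig y))//.
rewrite integral_EFin_Rintegral; last exact/integrable_Rscale/integrable_remainder.
rewrite RintegralZl//; last exact: integrable_remainder.
rewrite /sig (Rintegral_remainder psi0 mpsi psi1 t0 tb) -/r -EFinM lee_fin.
have -> : K / r * (h x * rho x) * r = K * (h x * rho x) * (r / r) by ring.
by rewrite ler_piMr// mulr_ge0.
Qed.

Let cross2 : (\int[mu \x nu]_z (K / r * rho z.1 * (h z.2 * sig z.2))%:E <=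
  K%:E * \int[nu]_x (h x * sig x)%:E)%E.
Proof.
have hr0 x : 0 <= h x * sig x by rewrite mulr_ge0.
have mhr : measurable_fun setT (fun x => h x * sig x) by exact: measurable_funM.
rewrite fubini_tonelli2; last 2 first.
- apply/measurable_EFinP; apply: measurable_funM.
    by apply: measurable_funM => //; exact: (measurableT_comp mrho measurable_fst).
  exact: (measurableT_comp mhr measurable_snd).
- by move=> z; rewrite lee_fin mulr_ge0// mulr_ge0// divr_ge0.
rewrite -ge0_integralZl//; last 2 first.
- exact/measurable_EFinP.
- by move=> x _; rewrite lee_fin.
apply: le_ge0_integral_nonmeasurable => y.
  by apply: integral_ge0 => x _; rewrite lee_fin mulr_ge0// mulr_ge0// divr_ge0.
rewrite /fubini_G (_ : (fun x => _) = EFin \o (fun x => K / r * (h y * sig y) * rho x)); last first.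
  by apply/funext => x /=; rewrite mulrAC.
rewrite integral_EFin_Rintegral; last exact/integrable_Rscale/integrable_remainder.
rewrite RintegralZl//; last exact: integrable_remainder.
rewrite /rho (Rintegral_remainder psi0 mpsi psi1 t0 ta) -/r -EFinM lee_fin.
have -> : K / r * (h y * sig y) * r = K * (h y * sig y) * (r / r) by ring.
by rewrite ler_piMr// mulr_ge0.
Qed.

Lemma transport_cost_le_cells :
  (transport_cost c mu nu <=
    (eps + K * (H * \sum_i `|\int[mu]_x psi i x - \int[nu]_x psi i x|))%:E +
    K%:E * (\int[mu]_x ((1 - \sum_i psi i x) * h x)%:E +
            \int[nu]_x ((1 - \sum_i psi i x) * h x)%:E))%E.
Proof.
have [g [gA gf]] := density_probability th0 mth th_mass.
have mE : measurable_fun setT (EFin \o c) by exact/measurable_EFinP.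
apply: (@le_trans _ _ (\int[g]_z (c z)%:E)%E).
  apply: ereal_inf_lbound; exists g => // A mA; split.
    rewrite /pushforward gA; last by rewrite -[X in measurable X]setTI; exact: measurable_fst.
    by apply: etrans (marginal1 mA); apply: eq_integral => z _; rewrite !indicE.
  rewrite /pushforward gA; last by rewrite -[X in measurable X]setTI; exact: measurable_snd.
  by apply: etrans (marginal2 mA); apply: eq_integral => z _; rewrite !indicE.
rewrite gf//.
pose f1 z := K / r * (h z.1 * rho z.1) * sig z.2.
pose f2 z := K / r * rho z.1 * (h z.2 * sig z.2).
have f10 z : 0 <= f1 z by rewrite !mulr_ge0// invr_ge0.
have f20 z : 0 <= f2 z by rewrite !mulr_ge0// invr_ge0.
have mfst (f : T -> R) : measurable_fun setT f -> measurable_fun setT (fun z : T * T => f z.1).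
  by move=> mf; exact: (measurableT_comp mf measurable_fst).
have msnd (f : T -> R) : measurable_fun setT f -> measurable_fun setT (fun z : T * T => f z.2).
  by move=> mf; exact: (measurableT_comp mf measurable_snd).
have mf1 : measurable_fun setT f1.
  apply: measurable_funM; last exact: msnd.
  apply: measurable_funM => //.
  by apply: (mfst (fun x => h x * rho x)); exact: measurable_funM.
have mf2 : measurable_fun setT f2.
  apply: measurable_funM.
    by apply: measurable_funM => //; exact: mfst.
  by apply: (msnd (fun x => h x * sig x)); exact: measurable_funM.
apply: (@le_trans _ _ (\int[mu \x nu]_z (eps%:E * (th z)%:E + ((f1 z)%:E + (f2 z)%:E)))%E).
  apply: le_ge0_integral_nonmeasurable => z; first by rewrite mule_ge0 ?lee_fin.
  by rewrite -!EFinM -!EFinD lee_fin; exact: cost_split.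
rewrite ge0_integralD//; last 4 first.
- by move=> z _; rewrite mule_ge0 ?lee_fin.
- by apply: measurable_funeM; exact/measurable_EFinP.
- by move=> z _; rewrite adde_ge0 ?lee_fin.
- by apply: emeasurable_funD; exact/measurable_EFinP.
rewrite ge0_integralD//; last 4 first.
- by move=> z _; rewrite lee_fin.
- exact/measurable_EFinP.
- by move=> z _; rewrite lee_fin.
- exact/measurable_EFinP.
rewrite ge0_integralZl//; last 2 first.
- exact/measurable_EFinP.
- by move=> z _; rewrite lee_fin.
rewrite th_mass mule1 EFinD -[leRHS]addeA leeD2l//.
pose Em := (\int[mu]_x ((1 - \sum_i psi i x) * h x)%:E)%E.
pose En := (\int[nu]_x ((1 - \sum_i psi i x) * h x)%:E)%E.
have Em0 : (0 <= Em)%E by apply: integral_ge0 => x _; rewrite lee_fin mulr_ge0// subr_ge0.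
have En0 : (0 <= En)%E by apply: integral_ge0 => x _; rewrite lee_fin mulr_ge0// subr_ge0.
apply: (le_trans (leeD cross1 cross2)).
rewrite -ge0_muleDr; last 2 first.
- by apply: integral_ge0 => x _; rewrite lee_fin mulr_ge0.
- by apply: integral_ge0 => x _; rewrite lee_fin mulr_ge0.
rewrite EFinM -ge0_muleDr; last 2 first.
- by rewrite lee_fin mulr_ge0// sumr_ge0.
- exact: adde_ge0.
apply: lee_wpmul2l; first by rewrite lee_fin.
apply: (le_trans (leeD (integral_remainder_moment psi0 mpsi psi1 t0 ta h0 mh H0 h_H)
   (integral_remainder_moment psi0 mpsi psi1 t0 tb h0 mh H0 h_H))).
rewrite addeACA -EFinD leeD2r// lee_fin -mulrDr ler_wpM2l// -big_split/=.
(* As [t i] is the smaller of [a i] and [b i], the unmatched masses [a i - t i] and [b i - t i] add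
   up to [|a i - b i|]. *)
apply: ler_sum => i _; rewrite -/(a i) -/(b i) /t.
by have [ab|ab] := leP (a i) (b i);
  [rewrite ler0_norm ?subr_le0//|rewrite gtr0_norm ?subr_gt0//]; lra.
Qed.

End coupling.

(** * Lower bound for the transport cost *)

Section coupling_marginals.
Context d (T : measurableType d) (R : realType)
  (mu nu : {measure set T -> \bar R}) (g : probability (T * T)%type R).
Hypothesis gP : couplings mu nu g.
Local Open Scope ereal_scope.

Lemma ge0_integral_coupling1 (f : T -> \bar R) : measurable_fun setT f ->
  (forall x, 0 <= f x) -> \int[g]_z f z.1 = \int[mu]_x f x.
Proof.
move=> mf f0; rewrite [RHS](eq_measure_integral (pushforward g fst)).
  by rewrite ge0_integral_pushforward.
by move=> A mA _; have [] := gP mA.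
Qed.

Lemma ge0_integral_coupling2 (f : T -> \bar R) : measurable_fun setT f ->
  (forall x, 0 <= f x) -> \int[g]_z f z.2 = \int[nu]_x f x.
Proof.
move=> mf f0; rewrite [RHS](eq_measure_integral (pushforward g snd)).
  by rewrite ge0_integral_pushforward.
by move=> A mA _; have [] := gP mA.
Qed.

Lemma integral_coupling1 (f : T -> \bar R) : measurable_fun setT f ->
  \int[g]_z f z.1 = \int[mu]_x f x.
Proof.
move=> mf; rewrite [LHS]integralE [RHS]integralE.
rewrite -(ge0_integral_coupling1 (measurable_funepos mf))//.
rewrite -(ge0_integral_coupling1 (measurable_funeneg mf))//.
by congr (_ - _); apply: eq_integral => z _; rewrite ?funeposE ?funenegE.
Qed.

Lemma integral_coupling2 (f : T -> \bar R) : measurable_fun setT f ->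
  \int[g]_z f z.2 = \int[nu]_x f x.
Proof.
move=> mf; rewrite [LHS]integralE [RHS]integralE.
rewrite -(ge0_integral_coupling2 (measurable_funepos mf))//.
rewrite -(ge0_integral_coupling2 (measurable_funeneg mf))//.
by congr (_ - _); apply: eq_integral => z _; rewrite ?funeposE ?funenegE.
Qed.

End coupling_marginals.

(* Uniform continuity in terms of the transport cost, up to a small multiple of
   the growth function [h]. *)
Definition cost_continuous (T : Type) (R : realType) (c : T * T -> R)
    (h f : T -> R) : Prop :=
  forall e : R, 0 < e -> exists2 C : R, 0 < C &
    forall x y, `|f x - f y| <= e * (1 + h y) + C * c (x, y).

Lemma growth_integrable d (T : measurableType d) (R : realType)
    (P : probability T R) (h f : T -> R) (b : R) :
  measurable_fun setT h -> (forall x, 0 <= h x) ->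
  (\int[P]_x (h x)%:E < +oo)%E ->
  measurable_fun setT f -> (forall x, `|f x| <= b * (1 + h x)) ->
  P.-integrable setT (EFin \o f).
Proof.
move=> mh h0 Ph mf fb.
have Ih : P.-integrable setT (EFin \o h).
  apply/integrableP; split; first exact/measurable_EFinP.
  by under eq_integral do rewrite /= ger0_norm//.
apply: (@le_integrable _ _ _ P _ measurableT _
    (EFin \o (fun x => b * (1 + h x)))).
- exact/measurable_EFinP.
- move=> x _ /=; rewrite lee_fin (le_trans (fb x))// ler_norm//.
- by apply/integrable_Rscale/integrable_RD => //; exact: integrable_probability_cst.
Qed.

Section transport_lower_bound.
Context d (T : measurableType d) (R : realType) (mu nu : probability T R).
Variables (c : T * T -> R) (h f : T -> R) (b : R).
Hypotheses (c0 : forall z, 0 <= c z) (mc : measurable_fun setT c).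
Hypotheses (h0 : forall x, 0 <= h x) (mh : measurable_fun setT h).
Hypotheses (mf : measurable_fun setT f) (fb : forall x, `|f x| <= b * (1 + h x)).

(** The difference of the integrals is estimated along each coupling, and the infimum is taken
    afterwards, so no duality is involved. When the moment of [nu] or the cost is infinite, so is
    the right-hand side. *)
Lemma Rintegral_diff_le_transport_cost (e C : R) : 0 < e -> 0 < C ->
  (forall x y, `|f x - f y| <= e * (1 + h y) + C * c (x, y)) ->
  ((`|\int[mu]_x f x - \int[nu]_x f x|)%:E <=
    e%:E * (1 + \int[nu]_x (h x)%:E) + C%:E * transport_cost c mu nu)%E.
Proof.
move=> e0 C0 fec.
have t0 : (0 <= transport_cost c mu nu)%E by exact: transport_cost_ge0.
have Ct0 : (0 <= C%:E * transport_cost c mu nu)%E by rewrite mule_ge0// lee_fin ltW.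
have [hy|hfin] := eqVneq (\int[nu]_x (h x)%:E)%E +oo%E.
  by rewrite hy addey// gt0_muley ?lte_fin// addye ?leey// gt_eqF// (lt_le_trans ltNy0).
have h_ge0 : (0 <= \int[nu]_x (h x)%:E)%E by apply: integral_ge0 => x _; rewrite lee_fin.
have hlty : (\int[nu]_x (h x)%:E < +oo)%E by rewrite lt_neqAle hfin leey.
pose m := \int[nu]_x h x.
have Inh : nu.-integrable setT (EFin \o h).
  apply/integrableP; split; first exact/measurable_EFinP.
  by under eq_integral do rewrite /= ger0_norm//.
have Inf : nu.-integrable setT (EFin \o f) by exact: growth_integrable fb.
rewrite integral_EFin_Rintegral// -EFinD -EFinM -/m.
(* Solved for the transport cost, the estimate becomes a lower bound to be checked on every
   coupling. *)
have key : ((C^-1 * (`|\int[mu]_x f x - \int[nu]_x f x| - e * (1 + m)))%:E <=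
    transport_cost c mu nu)%E.
  apply: le_ereal_inf_tmp => _ [g gP <-].
  have [gy|gfin] := eqVneq (\int[g]_z (c z)%:E)%E +oo%E; first by rewrite gy leey.
  have glty : (\int[g]_z (c z)%:E < +oo)%E by rewrite lt_neqAle gfin leey.
  have Igc : g.-integrable setT (EFin \o c).
    apply/integrableP; split; first exact/measurable_EFinP.
    by under eq_integral do rewrite /= ger0_norm//.
  have msnd (u : T -> R) : measurable_fun setT u ->
      measurable_fun setT (fun z : T * T => u z.2).
    by move=> mu_; exact: (measurableT_comp mu_ measurable_snd).
  have mfst (u : T -> R) : measurable_fun setT u ->
      measurable_fun setT (fun z : T * T => u z.1).
    by move=> mu_; exact: (measurableT_comp mu_ measurable_fst).
  have Ig2 (u : T -> R) : nu.-integrable setT (EFin \o u) ->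
      g.-integrable setT (EFin \o (fun z : T * T => u z.2)).
    move=> /integrableP[/measurable_EFinP mu_ iu]; apply/integrableP; split.
      by apply/measurable_EFinP; exact: msnd mu_.
    have mu' : measurable_fun setT (fun x => `|(u x)%:E|%E).
      by apply: measurableT_comp => //; exact/measurable_EFinP.
    by rewrite (ge0_integral_coupling2 gP mu').
  have Igf2 := Ig2 _ Inf.
  have Igh2 := Ig2 _ Inh.
  have Igb : g.-integrable setT (EFin \o (fun z => e * (1 + h z.2) + C * c z)).
    apply: integrable_RD; last exact: integrable_Rscale.
    by apply/integrable_Rscale/integrable_RD => //; exact: integrable_probability_cst.
  have Igd : g.-integrable setT (EFin \o (fun z => f z.1 - f z.2)).
    apply: (@le_integrable _ _ _ g _ measurableT _ _ _ _ Igb).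
      by apply/measurable_EFinP/measurable_funB; [exact: mfst|exact: msnd].
    by move=> [x y] _ /=; rewrite lee_fin (le_trans (fec x y))// ler_norm.
  (* Integrability under the first marginal comes from writing [f z.1] as [f z.1 - f z.2], which is
     dominated through the cost, plus [f z.2]. *)
  have Igf1 : g.-integrable setT (EFin \o (fun z => f z.1)).
    have := integrable_RD Igd Igf2; congr (integrable _ _ _).
    by apply/funext => z /=; rewrite subrK.
  have -> : \int[mu]_x f x = \int[g]_z f z.1.
    by congr fine; rewrite -(integral_coupling1 gP)//; exact/measurable_EFinP.
  have -> : \int[nu]_x f x = \int[g]_z f z.2.
    by congr fine; rewrite -(integral_coupling2 gP)//; exact/measurable_EFinP.
  have mE : m = \int[g]_z h z.2.
    by congr fine; rewrite -(integral_coupling2 gP)//; exact/measurable_EFinP.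
  rewrite integral_EFin_Rintegral// lee_fin ler_pdivrMl// lerBlDl.
  rewrite -RintegralB//; apply: (le_trans (le_normr_Rintegral measurableT Igd)).
  apply: (@le_trans _ _ (\int[g]_z (e * (1 + h z.2) + C * c z))).
    apply: le_Rintegral => //; first exact: integrable_norm.
    by move=> [x y] _ /=; exact: fec.
  have I1h : g.-integrable setT (EFin \o (fun z => 1 + h z.2)).
    by apply/integrable_RD => //; exact: integrable_probability_cst.
  rewrite RintegralD//; last 2 first.
  - exact: integrable_Rscale.
  - exact: integrable_Rscale.
  rewrite !RintegralZl// RintegralD//; last exact: integrable_probability_cst.
  by rewrite Rintegral_probability_cst -mE.
case: (transport_cost c mu nu) key t0 => [t| |]//.
  rewrite !lee_fin => key _.
  by move: key; rewrite ler_pdivrMl// lerBlDl.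
by move=> _ _; rewrite gt0_muley ?lte_fin// addey// leey.
Qed.

End transport_lower_bound.

(** * Cells and measurability on separable spaces *)

Lemma continuous_borel_measurable (R : realType) (T : ptopologicalType)
    (f : T -> R) : continuous f ->
  measurable_fun setT (f : borel T -> R).
Proof.
move=> /continuousP cf; apply: (measurability _ (RGenOpens.measurableE R)).
move=> _ [_ [a [b ->] <-]]; rewrite setTI.
by apply: sub_sigma_algebra; exact/cf/interval_open.
Qed.

Lemma open_borel_measurable (T : ptopologicalType) (U : set T) :
  open U -> measurable (U : set (borel T)).
Proof. by move=> oU; exact: sub_sigma_algebra. Qed.

Lemma separable_dense_sequence (R : realType) (T : pseudoPMetricType R) :
  separable T ->
  exists s : nat -> T, forall (x : T) (e : R), 0 < e -> exists i, ball x e (s i).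
Proof.
move=> [D /pfcard_geP[D0|[s]] dD].
  have [x [_]] := dD setT (ex_intro _ point Logic.I) openT.
  by rewrite D0.
exists s => x e e0.
have [|y [yb Dy]] := dD (interior (ball x e)) _ (open_interior _).
  exists x; apply: nbhsx_ballx; exact: e0.
have [i _ si] : (s @` setT) y by exact: (@surj _ _ _ _ s) Dy.
by exists i; rewrite si; exact: interior_subset yb.
Qed.

Section cells.
Context (T : Type) (R : realType) (dist : T -> T -> R) (s : nat -> T) (eta : R).

(** Tent profile: 1 up to distance [eta] from [s i], 0 from distance [2 * eta] on. *)
Definition bump (i : nat) (x : T) : R :=
  Num.max 0 (Num.min 1 (2 - dist x (s i) / eta)).

Fixpoint bump_cover (J : nat) (x : T) : R :=
  if J is J'.+1 then Num.max (bump_cover J' x) (bump J' x) else 0.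

(** Increments of a running maximum telescope, so finite sums of cells are at most 1 without any
    normalization, and each cell lives on the support of its bump. *)
Definition cell (i : nat) (x : T) : R := bump_cover i.+1 x - bump_cover i x.

Lemma bump_cover_le J K x : (J <= K)%N -> bump_cover J x <= bump_cover K x.
Proof.
move=> /subnK <-; elim: (K - J)%N => [//|n IH].
by rewrite addSn/= le_max IH.
Qed.

Lemma bump_cover_ge0 J x : 0 <= bump_cover J x.
Proof. exact: (@bump_cover_le 0 J). Qed.

Lemma bump_cover_le1 J x : bump_cover J x <= 1.
Proof.
elim: J => [|J IH] /=; first exact: ler01.
by rewrite ge_max IH /bump ge_max ler01 ge_min lexx.
Qed.

Lemma cell_ge0 i x : 0 <= cell i x.
Proof. by rewrite subr_ge0 bump_cover_le. Qed.

Lemma sum_cell J x : \sum_(i < J) cell i x = bump_cover J x.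
Proof.
elim: J => [|J IH]; first by rewrite big_ord0.
by rewrite big_ord_recr/= IH addrC subrK.
Qed.

Hypothesis eta0 : 0 < eta.

(** Where the running maximum increases, the new bump exceeds a nonnegative number. *)
Lemma cell_gt0 i x : 0 < cell i x -> dist x (s i) < 2 * eta.
Proof.
rewrite subr_gt0 /= lt_max ltxx/= => /(le_lt_trans (bump_cover_ge0 _ _)).
by rewrite /bump lt_max ltxx/= lt_min ltr01/= subr_gt0 ltr_pdivrMr.
Qed.

Lemma bump_cover_eq1 i J x : (i < J)%N -> dist x (s i) <= eta ->
  bump_cover J x = 1.
Proof.
move=> iJ dx; apply/eqP; rewrite eq_le bump_cover_le1/=.
apply: le_trans (bump_cover_le x iJ); rewrite /= le_max; apply/orP; right.
rewrite /bump le_max; apply/orP; right; rewrite le_min lexx/=.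
suff : dist x (s i) / eta <= 1 by lra.
by rewrite ler_pdivrMr// mul1r.
Qed.

End cells.

Lemma measurable_bump_cover d (T : measurableType d) (R : realType)
    (dist : T -> T -> R) (s : nat -> T) (eta : R) J :
  (forall i, measurable_fun setT (fun x => dist x (s i))) ->
  measurable_fun setT (bump_cover dist s eta J).
Proof.
move=> md; elim: J => [|J IH] /=; first exact: measurable_cst.
apply: measurable_maxr => //; apply: measurable_maxr => //.
apply: measurable_minr => //; apply: measurable_funB => //.
exact: measurable_funM.
Qed.

Lemma measurable_cell d (T : measurableType d) (R : realType)
    (dist : T -> T -> R) (s : nat -> T) (eta : R) i :
  (forall i, measurable_fun setT (fun x => dist x (s i))) ->
  measurable_fun setT (cell dist s eta i).
Proof. by move=> md; apply: measurable_funB; exact: measurable_bump_cover. Qed.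

Lemma continuous_bump_cover (T : topologicalType) (R : realType)
    (dist : T -> T -> R) (s : nat -> T) (eta : R) J :
  (forall i, continuous (fun x => dist x (s i))) ->
  continuous (bump_cover dist s eta J).
Proof.
move=> cd; elim: J => [|J IH] /= x; first exact: cst_continuous.
apply: (@continuous_max R T); first exact: IH.
apply: (@continuous_max R T); first exact: cst_continuous.
apply: (@continuous_min R T); first exact: cst_continuous.
apply: (@continuousB R R^o T); first exact: cst_continuous.
by apply: (@continuousM R T); [exact: cd|exact: cst_continuous].
Qed.

Lemma continuous_cell (T : topologicalType) (R : realType)
    (dist : T -> T -> R) (s : nat -> T) (eta : R) i :
  (forall i, continuous (fun x => dist x (s i))) ->
  continuous (cell dist s eta i).
Proof.
move=> cd x; apply: (@continuousB R R^o T); exact: continuous_bump_cover.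
Qed.

(* Separability makes the metric measurable for the product sigma-algebra:
   [{dist < r}] is a countable union of sets described through the dense
   sequence [s]. *)
Lemma measurable_dist d (T : measurableType d) (R : realType)
    (dist : T -> T -> R) (s : nat -> T) :
  (forall x y, dist x y = dist y x) ->
  (forall x y z, dist x z <= dist x y + dist y z) ->
  (forall x e, 0 < e -> exists i, dist x (s i) < e) ->
  (forall i, measurable_fun setT (fun x => dist x (s i))) ->
  measurable_fun setT (fun z : T * T => dist z.1 z.2).
Proof.
move=> dC dT ds md; apply: (measurability _ (RGenInftyO.measurableE R)).
move=> _ [_ [r ->] <-]; rewrite setTI.
have -> : (fun z : T * T => dist z.1 z.2) @^-1` `]-oo, r[%classic =
    \bigcup_i ((fun z : T * T => dist z.1 (s i) + dist z.2 (s i)) @^-1` `]-oo, r[%classic).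
  apply/seteqP; split => [[x y]/= |[x y] [i _]] /=; rewrite !in_itv/= => xyr.
    (* Since [dist y (s i)] is at most [dist x y + dist x (s i)], an [s i] within half of the slack
       [r - dist x y] suffices. *)
    have [i xi] := ds x ((r - dist x y) / 2) ltac:(by rewrite divr_gt0// subr_gt0).
    exists i => //=; rewrite in_itv/=.
    by have := dT y x (s i); rewrite (dC y x); lra.
  by apply: le_lt_trans xyr; rewrite (dC y); exact: dT.
apply: bigcup_measurable => i _; rewrite -[X in measurable X]setTI.
apply: measurable_funD; [| |exact: measurableT|exact: measurable_itv].
- exact: (measurableT_comp (md i) measurable_fst).
- exact: (measurableT_comp (md i) measurable_snd).
Qed.

(** * Functions of growth p *)

Section power_inequalities.
Context (R : realType) (p : R).
Hypothesis p1 : 1 <= p.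

Let p0 : 0 < p. Proof. by rewrite (lt_le_trans ltr01). Qed.

(** Comparison with twice the larger term gives the constant [2^p] without convexity. *)
Lemma powR_add_le (a b : R) : 0 <= a -> 0 <= b ->
  (a + b) `^ p <= 2 `^ p * (a `^ p + b `^ p).
Proof.
wlog ab : a b / a <= b.
  move=> hw a0 b0; have [ab|/ltW ba] := leP a b; first exact: hw.
  by rewrite addrC [a `^ p + _]addrC hw.
move=> a0 b0; apply: (@le_trans _ _ ((2 * b) `^ p)).
  by rewrite ge0_ler_powR ?nnegrE ?(ltW p0)// ?addr_ge0 ?mulr_ge0//; lra.
by rewrite powRM// ler_wpM2l ?powR_ge0// lerDr powR_ge0.
Qed.

(** For [t <= e] the first term suffices; for [t > e] the ratio [t / e] exceeds 1 and is below its
    [p]-th power, which dictates [C]. *)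
Lemma le_eps_powR (e : R) : 0 < e ->
  exists2 C : R, 0 < C & forall t, 0 <= t -> t <= e + C * t `^ p.
Proof.
move=> e0; exists (e / e `^ p) => [|t t0]; first by rewrite divr_gt0// powR_gt0.
have [te|et] := leP t e.
  by rewrite (le_trans te)// lerDl mulr_ge0 ?powR_ge0// divr_ge0 ?powR_ge0 ?ltW.
apply: (@le_trans _ _ (e * (t / e) `^ p)); last first.
  rewrite powRM ?invr_ge0 ?(ltW e0)// -powR_inv1 ?(ltW e0)// -powRrM mulN1r powRN.
  by rewrite [_ / _ * _]mulrAC -mulrA lerDr ltW.
have te1 : 1 <= t / e by rewrite ler_pdivlMr// mul1r ltW.
rewrite -[leLHS](divfK (lt0r_neq0 e0)) mulrC ler_wpM2l ?(ltW e0)//.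
by rewrite -[leLHS]powRr1 ?(le_trans ler01 te1)// ler_powR.
Qed.

Lemma powR_near1 (e : R) : 0 < e -> exists2 n : R, 0 < n < 1 &
  (1 + n) `^ p <= 1 + e /\ 1 - e <= (1 - n) `^ p.
Proof.
move=> e0; have : {for (1 : R), continuous (fun x : R => x `^ p)}.
  apply: differentiable_continuous; apply/derivable1_diffP.
  by apply: derivable_powR; rewrite in_itv/= ltr01.
move=> /cvgrPdist_le /(_ _ e0); rewrite powR1 => /nbhs_ballP[r/= r0 hr].
pose n := Num.min (r / 2) (1 / 2).
have n0 : 0 < n by rewrite lt_min !divr_gt0.
have nr : n < r by rewrite gt_min; apply/orP; left; lra.
have n1 : n < 1 by rewrite gt_min; apply/orP; right; lra.
exists n; first by rewrite n0 n1.
have := hr (1 + n); rewrite /ball/= opprD addrA subrr sub0r normrN gtr0_norm// => /(_ nr).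
have := hr (1 - n); rewrite /ball/= opprB addrCA subrr addr0 gtr0_norm// => /(_ nr).
rewrite !ler_norml => /andP[h1 h2] /andP[h3 h4].
by split; lra.
Qed.

(** Two regimes. If [|a - b| <= n * b], then [a] lies between [(1 - n) * b] and [(1 + n) * b], and
    continuity of the power at 1 gives the first term. Otherwise [a] and [b] are both at most
    [(1/n + 1) * |a - b|], hence the value of [C]. *)
Lemma powR_diff_le (e : R) : 0 < e -> exists2 C : R, 0 < C &
  forall a b, 0 <= a -> 0 <= b ->
    `|a `^ p - b `^ p| <= e * b `^ p + C * `|a - b| `^ p.
Proof.
move=> e0; have [n /andP[n0 n1] [he1 he2]] := powR_near1 e0.
exists ((n^-1 + 1) `^ p) => [|a b a0 b0].
  by rewrite powR_gt0// addr_gt0// invr_gt0.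
have bp0 := powR_ge0 b p; have ap0 := powR_ge0 a p.
have tp0 := powR_ge0 `|a - b| p; have cp0 := powR_ge0 (n^-1 + 1) p.
have pmono x y : 0 <= x -> x <= y -> x `^ p <= y `^ p.
  move=> x0 xy; rewrite ge0_ler_powR ?nnegrE ?(ltW p0)//; exact: le_trans xy.
have [tb|bt] := leP `|a - b| (n * b).
  apply: (@le_trans _ _ (e * b `^ p)); last by rewrite lerDl mulr_ge0.
  move: tb; rewrite ler_distl => /andP[ab1 ab2].
  have h1 : a `^ p <= (1 + n) `^ p * b `^ p.
    by rewrite -powRM ?addr_ge0 ?(ltW n0)//; apply: pmono => //; lra.
  have h2 : (1 - n) `^ p * b `^ p <= a `^ p.
    rewrite -powRM ?subr_ge0 ?(ltW n1)//; apply: pmono; last by lra.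
    by rewrite mulr_ge0// subr_ge0 ltW.
  have h3 := ler_wpM2r bp0 he1; have h4 := ler_wpM2r bp0 he2.
  by rewrite ler_norml; apply/andP; split; lra.
apply: (@le_trans _ _ ((n^-1 + 1) `^ p * `|a - b| `^ p)); last first.
  by rewrite lerDr mulr_ge0// ltW.
have bt' : b <= n^-1 * `|a - b| by rewrite ler_pdivlMl// ltW.
have ab' : a <= b + `|a - b| by rewrite -lerBlDl ler_norm.
have hb : b `^ p <= (n^-1 + 1) `^ p * `|a - b| `^ p.
  rewrite -powRM ?addr_ge0 ?invr_ge0 ?(ltW n0)//; apply: pmono => //.
  by rewrite mulrDl mul1r (le_trans bt')// lerDl.
have ha : a `^ p <= (n^-1 + 1) `^ p * `|a - b| `^ p.
  rewrite -powRM ?addr_ge0 ?invr_ge0 ?(ltW n0)//; apply: pmono => //.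
  by rewrite mulrDl mul1r (le_trans ab')// lerD2r.
by rewrite ler_norml; apply/andP; split; lra.
Qed.

End power_inequalities.

Section normed_power.
Context (R : realType) (X : normedModType R) (p : R).
Hypothesis p1 : 1 <= p.

Let p0 : 0 < p. Proof. by rewrite (lt_le_trans ltr01). Qed.

Lemma normB_powR_le (x y : X) :
  `|x - y| `^ p <= 2 `^ p * (`|x| `^ p + `|y| `^ p).
Proof.
apply: le_trans (powR_add_le p1 (normr_ge0 x) (normr_ge0 y)).
by rewrite ge0_ler_powR ?nnegrE ?(ltW p0)// ?addr_ge0// ler_normB.
Qed.

Lemma norm_powR_diff_le (e : R) : 0 < e -> exists2 C : R, 0 < C &
  forall x y : X, `| `|x| `^ p - `|y| `^ p| <= e * `|y| `^ p + C * `|x - y| `^ p.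
Proof.
move=> /(powR_diff_le p1)[C C0 hC]; exists C => // x y.
apply: (le_trans (hC _ _ (normr_ge0 x) (normr_ge0 y))).
rewrite lerD2l ler_wpM2l ?(ltW C0)// ge0_ler_powR ?nnegrE ?(ltW p0)//.
exact: ler_dist_dist.
Qed.

Lemma continuous_norm_powR : continuous (fun x : X => `|x| `^ p).
Proof.
move=> x; apply/cvgrPdist_le => e e0.
(* This share of [e] leaves at most [e / 2] after multiplication by [|x|^p]; the bound 1 on [r]
   below gives [|x - y|^p <= |x - y|]. *)
have [C C0 hC] := norm_powR_diff_le (e := e / (2 * (1 + `|x| `^ p)))
  ltac:(by rewrite divr_gt0// mulr_gt0// ltr_pwDl// powR_ge0).
pose r := Num.min 1 (e / (2 * C)).
have r0 : 0 < r by rewrite lt_min ltr01 divr_gt0// mulr_gt0.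
have cx : y @[y --> x] --> x by [].
move/cvgrPdist_le : cx => /(_ _ r0); apply: filterS => y xy.
rewrite distrC; apply: (le_trans (hC y x)); rewrite distrC.
have h1 : e / (2 * (1 + `|x| `^ p)) * `|x| `^ p <= e / 2.
  have xp := powR_ge0 `|x| p.
  rewrite invfM mulrA -[leRHS]mulr1 -mulrA ler_wpM2l//; first by rewrite divr_ge0// ltW.
  by rewrite mulrC ler_pdivrMr ?mul1r ?ltr_pwDl// lerDr.
have h2 : C * `|x - y| `^ p <= e / 2.
  apply: (@le_trans _ _ (C * `|x - y|)).
    rewrite ler_wpM2l ?(ltW C0)//.
    have [->|xy0] := eqVneq `|x - y| 0; first by rewrite powR0 ?gt_eqF.
    rewrite ge1r_powR// lt_neqAle eq_sym xy0 normr_ge0/=.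
    by rewrite (le_trans xy)// ge_min lexx.
  apply: (@le_trans _ _ (C * r)); first by rewrite ler_wpM2l ?(ltW C0).
  apply: (@le_trans _ _ (C * (e / (2 * C)))).
    by rewrite ler_wpM2l ?(ltW C0)// ge_min lexx orbT.
  by rewrite (_ : C * (e / (2 * C)) = e / 2)//; field; rewrite gt_eqF.
by rewrite [leRHS]splitr lerD.
Qed.

(** Moves the base point of the growth condition to 0, so that a single moment function serves all
    test functions. *)
Lemma C0p_growth (phi : X -> R) : C0p p phi ->
  exists2 b : R, 0 <= b & forall x, `|phi x| <= b * (1 + `|x| `^ p).
Proof.
move=> [_ [al [x0 [al0 hphi]]]].
pose K := 2 `^ p * (1 + `|x0| `^ p).
have a1 : (1 : R) <= 2 `^ p by apply: le_trans (le1r_powR _ p1); rewrite ?ler1n.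
exists (al * K).
  by rewrite !mulr_ge0// ?addr_ge0 ?powR_ge0.
move=> x; apply: (le_trans (hphi x)); rewrite -mulrA ler_wpM2l//.
have h := normB_powR_le x x0.
have u0 := powR_ge0 `|x| p; have v0 := powR_ge0 `|x0| p.
have : 0 <= 2 `^ p * `|x0| `^ p * `|x| `^ p by rewrite !mulr_ge0// powR_ge0.
rewrite /K; move: h a1 u0 v0.
set a := 2 `^ p; set u := `|x| `^ p; set v := `|x0| `^ p.
rewrite !mulrDr !mulrDl !mulr1 => h a1 u0 v0 avu.
by lra.
Qed.

End normed_power.

Section cost_continuous_theory.
Context (T : Type) (R : realType) (c : T * T -> R) (h : T -> R).
Hypotheses (c0 : forall z, 0 <= c z) (h0 : forall x, 0 <= h x).

Lemma cost_continuous_cst (a : R) : cost_continuous c h (fun=> a).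
Proof.
move=> e e0; exists 1 => // x y; rewrite subrr normr0 mul1r addr_ge0//.
by rewrite mulr_ge0 ?(ltW e0)// addr_ge0.
Qed.

Lemma cost_continuousD (f g : T -> R) : cost_continuous c h f ->
  cost_continuous c h g -> cost_continuous c h (fun x => f x + g x).
Proof.
move=> hf hg e e0.
have [C C0 fC] := hf _ (divr_gt0 e0 (ltr0n R 2)).
have [D D0 gD] := hg _ (divr_gt0 e0 (ltr0n R 2)).
exists (C + D) => [|x y]; first exact: addr_gt0.
have := fC x y; have := gD x y.
have : `|f x + g x - (f y + g y)| <= `|f x - f y| + `|g x - g y|.
  by apply: le_trans (ler_normD _ _); rewrite opprD addrACA.
by rewrite mulrDl; lra.
Qed.

Lemma cost_continuousZ (a : R) (f : T -> R) : cost_continuous c h f ->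
  cost_continuous c h (fun x => a * f x).
Proof.
move=> hf e e0; have a1 : 0 < `|a| + 1 by rewrite ltr_wpDl.
have [C C0 fC] := hf _ (divr_gt0 e0 a1).
exists ((`|a| + 1) * C) => [|x y]; first exact: mulr_gt0.
rewrite -mulrBr normrM.
apply: (@le_trans _ _ ((`|a| + 1) * `|f x - f y|)).
  by rewrite ler_wpM2r// lerDl.
apply: le_trans (ler_wpM2l (ltW a1) (fC x y)) _.
by rewrite le_eqVlt; apply/orP; left; apply/eqP; field; rewrite gt_eqF.
Qed.

Lemma cost_continuous_contraction (k : R -> R) (f : T -> R) :
  (forall a b, `|k a - k b| <= `|a - b|) -> cost_continuous c h f ->
  cost_continuous c h (fun x => k (f x)).
Proof.
by move=> hk hf e /hf[C C0 fC]; exists C => // x y; exact: le_trans (hk _ _) _.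
Qed.

(** By [le_eps_powR], a distance is at most a small constant plus a multiple of its [p]-th power.
    Asking only for [dist^p <= c] lets [dist] be one component of a product distance. *)
Lemma lipschitz_cost_continuous (dist : T -> T -> R) (p L : R) (f : T -> R) :
  1 <= p -> (forall x y, 0 <= dist x y) ->
  (forall x y, dist x y `^ p <= c (x, y)) ->
  (forall x y, `|f x - f y| <= L * dist x y) -> cost_continuous c h f.
Proof.
move=> p1 d0 dc fL e e0.
have L1 : 0 < `|L| + 1 by rewrite ltr_wpDl.
have [C C0 hC] := le_eps_powR p1 (divr_gt0 e0 L1).
exists ((`|L| + 1) * C) => [|x y]; first exact: mulr_gt0.
apply: (le_trans (fL x y)); apply: (@le_trans _ _ ((`|L| + 1) * dist x y)).
  by rewrite ler_wpM2r//; have := ler_norm L; lra.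
apply: (le_trans (ler_wpM2l (ltW L1) (hC _ (d0 x y)))).
rewrite mulrDr [_ * (e / _)]mulrC divfK ?gt_eqF// lerD//.
  by rewrite ler_peMr ?(ltW e0)// lerDl.
by rewrite -mulrA ler_wpM2l ?(ltW L1)// ler_wpM2l ?(ltW C0).
Qed.

End cost_continuous_theory.

(** * Approximation from below by Lipschitz functions *)

Section lipschitz_regularization.
Context (R : realType) (T : Type) (dist : T -> T -> R).
Hypotheses (dist0 : forall x y, 0 <= dist x y) (distxx : forall x, dist x x = 0)
  (distC : forall x y, dist x y = dist y x)
  (distT : forall x y z, dist x z <= dist x y + dist y z).
Variable F : T -> R.
Hypothesis F0 : forall x, 0 <= F x.

(** The Pasch-Hausdorff envelope: inf-convolution with [m * dist] of [F] truncated at height [m]. *)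
Definition lipschitz_reg (m : nat) (x : T) : R :=
  inf [set Num.min (F y) m%:R + m%:R * dist x y | y in setT].

Let lb m x : lbound [set Num.min (F y) m%:R + m%:R * dist x y | y in setT] (0 : R).
Proof. by move=> _ [y _ <-]; rewrite addr_ge0 ?mulr_ge0// le_min F0 ler0n. Qed.

Lemma lipschitz_reg_ge0 m x : 0 <= lipschitz_reg m x.
Proof. by apply: lb_le_inf => //; exists (Num.min (F x) m%:R + m%:R * dist x x); exists x. Qed.

Lemma lipschitz_reg_le_point m x y :
  lipschitz_reg m x <= Num.min (F y) m%:R + m%:R * dist x y.
Proof. by apply: ge_inf; [exists 0; exact: lb|exists y]. Qed.

Lemma lipschitz_reg_le m x : lipschitz_reg m x <= F x.
Proof.
apply: (le_trans (lipschitz_reg_le_point m x x)).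
by rewrite distxx mulr0 addr0 ge_min lexx.
Qed.

Lemma lipschitz_reg_lipschitz m x y :
  `|lipschitz_reg m x - lipschitz_reg m y| <= m%:R * dist x y.
Proof.
have H u v : lipschitz_reg m u - lipschitz_reg m v <= m%:R * dist u v.
  rewrite lerBlDr -lerBlDl; apply: lb_le_inf.
    by exists (Num.min (F v) m%:R + m%:R * dist v v); exists v.
  move=> _ [y' _ <-]; rewrite lerBlDl.
  apply: (le_trans (lipschitz_reg_le_point m u y')).
  by rewrite addrCA lerD2l -mulrDr ler_wpM2l.
by rewrite ler_norml lerNl opprB H andbT distC H.
Qed.

(** The hypothesis is lower semicontinuity of [F] at [x], which covers both continuous functions and
    indicators of open sets. *)
Lemma cvg_lipschitz_reg x :
  (forall e, 0 < e -> exists2 r, 0 < r & forall y, dist x y < r -> F x - e <= F y) ->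
  lipschitz_reg m x @[m --> \oo] --> F x.
Proof.
move=> cF; apply/cvgrPdist_le => e e0.
have [r r0 hr] := cF _ e0.
near=> m.
have mF : F x <= m%:R.
  near: m; exact: nbhs_infty_ger.
have mr : F x <= m%:R * r.
  rewrite -ler_pdivrMr//; near: m; exact: nbhs_infty_ger.
rewrite ger0_norm ?subr_ge0 ?lipschitz_reg_le// lerBlDr addrC -lerBlDr.
apply: lb_le_inf; first by exists (Num.min (F x) m%:R + m%:R * dist x x); exists x.
move=> _ [y _ <-].
(* Near [x], semicontinuity bounds [F y] from below; at distance [r] or more, the penalty is already
   at least [F x]. *)
have [xy|xy] := ltP (dist x y) r.
  have h1 := hr _ xy.
  apply: (@le_trans _ _ (Num.min (F y) m%:R)); last by rewrite lerDl mulr_ge0.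
  by rewrite le_min; apply/andP; split; lra.
apply: (@le_trans _ _ (m%:R * dist x y)).
  apply: (@le_trans _ _ (F x)); first by lra.
  by apply: (le_trans mr); rewrite ler_wpM2l.
by rewrite lerDr le_min F0 ler0n.
Unshelve. all: by end_near. Qed.

End lipschitz_regularization.

Lemma lipschitz_continuous (R : realType) (X : normedModType R) (f : X -> R) (L : R) :
  (forall x y, `|f x - f y| <= L * `|x - y|) -> continuous f.
Proof.
move=> fL x; apply/cvgrPdist_le => e e0.
have L1 : 0 < `|L| + 1 by rewrite ltr_wpDl.
have cx : y @[y --> x] --> x by [].
move/cvgrPdist_le : cx => /(_ _ (divr_gt0 e0 L1)); apply: filterS => y xy.
apply: (le_trans (fL x y)); apply: (@le_trans _ _ ((`|L| + 1) * `|x - y|)).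
  by rewrite ler_wpM2r//; have := ler_norm L; lra.
by rewrite mulrC -ler_pdivlMr.
Qed.

(* A function of growth [p] is squeezed between two sequences of
   cost-continuous functions: after adding or subtracting a multiple of
   [1 + |x|^p] it becomes nonnegative, hence an increasing limit of Lipschitz
   functions. *)
Lemma C0p_bracket (R : realType) (X : normedModType R) (p : R) (phi : X -> R) :
  1 <= p -> C0p p phi ->
  let c (z : X * X) := `|z.1 - z.2| `^ p in let h (x : X) := `|x| `^ p in
  exists (b : R) (l u : nat -> X -> R),
    [/\ forall m, [/\ continuous (l m), cost_continuous c h (l m) &
                      forall x, `|l m x| <= b * (1 + h x)],
        forall m, [/\ continuous (u m), cost_continuous c h (u m) &
                      forall x, `|u m x| <= b * (1 + h x)],
        forall m x, l m x <= phi x <= u m x &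
        forall x, u m x - l m x @[m --> \oo] --> (0 : R)].
Proof.
move=> p1 Cphi c h.
have [b b0 hb] := C0p_growth p1 Cphi; have [cphi _] := Cphi.
have c0 z : 0 <= c z by exact: powR_ge0.
have h0 x : 0 <= h x by exact: powR_ge0.
pose w x := b * (1 + h x).
have w0 x : 0 <= w x by rewrite mulr_ge0// addr_ge0.
have hw x : `|phi x| <= w x by exact: hb.
have cw : continuous w.
  move=> x; apply: (@continuousM R X); first exact: cst_continuous.
  by apply: (@continuousD R R^o X); [exact: cst_continuous|exact: continuous_norm_powR].
have ccw : cost_continuous c h w.
  apply: cost_continuousZ; apply: cost_continuousD; first exact: cost_continuous_cst.
  move=> e e0; have [C C0 hC] := norm_powR_diff_le X p1 e0; exists C => // x y.
  by rewrite (le_trans (hC x y))// lerD2r ler_wpM2l ?(ltW e0)// lerDr.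
pose F x := phi x + w x; pose G x := w x - phi x.
have F0 x : 0 <= F x by have := hw x; rewrite ler_norml /F => /andP[]; lra.
have G0 x : 0 <= G x by have := hw x; rewrite ler_norml /G => /andP[]; lra.
pose dist (x y : X) := `|x - y|.
have dist0 x y : 0 <= dist x y by exact: normr_ge0.
have distxx x : dist x x = 0 by rewrite /dist subrr normr0.
have distC x y : dist x y = dist y x by exact: distrC.
have distT x y z : dist x z <= dist x y + dist y z.
  by rewrite /dist (le_trans _ (ler_normD _ _))// addrA subrK.
pose reg H := lipschitz_reg dist H.
have cF : continuous F by move=> x; apply: (@continuousD R R^o X); [exact: cphi|exact: cw].
have cG : continuous G by move=> x; apply: (@continuousB R R^o X); [exact: cw|exact: cphi].
have regcc (H : X -> R) m : (forall x, 0 <= H x) -> cost_continuous c h (reg H m).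
  move=> H0; apply: (lipschitz_cost_continuous h0 (dist := dist) (p := p) (L := m%:R)) => //.
  exact: lipschitz_reg_lipschitz.
have regc (H : X -> R) m : (forall x, 0 <= H x) -> continuous (reg H m).
  by move=> H0; apply: lipschitz_continuous; exact: lipschitz_reg_lipschitz.
have cvgreg (H : X -> R) : (forall x, 0 <= H x) -> continuous H -> forall x,
    reg H m x @[m --> \oo] --> H x.
  move=> H0 cH x; apply: (cvg_lipschitz_reg dist0 distxx H0) => e e0.
  have /cvgrPdist_le /(_ _ e0) /nbhs_ballP[r /= r0 hr] := cH x.
  exists r => // y xy; have := hr y; rewrite -ball_normE /= => /(_ xy).
  by rewrite ler_norml => /andP[_]; lra.
have ccN f : cost_continuous c h f -> cost_continuous c h (fun x => - f x).
  by move=> /(cost_continuousZ (-1)); congr cost_continuous; apply/funext => x; rewrite mulN1r.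
(* The gap [u m - l m] is [(F - reg F m) + (G - reg G m)], and [0 <= reg F m <= F <= 2 * w] keeps
   the growth constant [b]; likewise for [G]. *)
exists b, (fun m x => reg F m x - w x), (fun m x => w x - reg G m x).
split.
- move=> m; split.
  + by move=> x; apply: (@continuousB R R^o X); [exact: regc|exact: cw].
  + by apply: cost_continuousD; [exact: regcc|exact: ccN].
  + move=> x; have := lipschitz_reg_le dist0 distxx F0 m x; have := lipschitz_reg_ge0 dist0 F0 m x.
    rewrite -/(w x); have := hw x; rewrite !ler_norml /F => /andP[]; move=> h1 h2 h3 h4.
    by apply/andP; split; lra.
- move=> m; split.
  + by move=> x; apply: (@continuousB R R^o X); [exact: cw|exact: regc].
  + by apply: cost_continuousD => //; apply: ccN; exact: regcc.
  + move=> x; have := lipschitz_reg_le dist0 distxx G0 m x; have := lipschitz_reg_ge0 dist0 G0 m x.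
    rewrite -/(w x); have := hw x; rewrite !ler_norml /G => /andP[]; move=> h1 h2 h3 h4.
    by apply/andP; split; lra.
- move=> m x; have := lipschitz_reg_le dist0 distxx F0 m x; have := lipschitz_reg_le dist0 distxx G0 m x.
  by rewrite /F /G => h1 h2; apply/andP; split; lra.
- move=> x.
  rewrite (_ : (fun m => _) = fun m => (2 * w x - reg G m x) - reg F m x); last first.
    by apply/funext => m; ring.
  rewrite [X in _ --> X](_ : 0 = (2 * w x - G x) - F x); last by rewrite /F /G; ring.
  apply: cvgB; last exact: (cvgreg F F0 cF x).
  by apply: cvgB; [exact: cvg_cst|exact: (cvgreg G G0 cG x)].
Qed.

(** * Fibre integrals and strong convergence *)

Section ereal_convergence.
Context (R : realType).
Local Open Scope ereal_scope.
Implicit Type u : nat -> \bar R.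

(** An eventual real bound covers finiteness and smallness together, so infinite values are
    tolerated for finitely many [n]. *)
Lemma ge0_cvge0P u : (forall n, 0 <= u n) ->
  u n @[n --> \oo] --> 0 <->
  forall e : R, (0 < e)%R -> \forall n \near \oo, u n <= e%:E.
Proof.
move=> u0; split => [/fine_cvgP[uf /cvgrPdist_le uc] e e0|H].
  have := uc _ e0; apply: filter_app; move: uf; apply: filterS => n un.
  rewrite sub0r normrN /= => h; rewrite -(fineK un) lee_fin.
  by rewrite (le_trans _ h)// ler_norm.
apply/fine_cvgP; split.
  by apply: filterS (H _ ltr01) => n un; rewrite ge0_fin_numE// (le_lt_trans un)// ltry.
apply/cvgrPdist_le => e e0; apply: filterS (H _ e0) => n un.
rewrite sub0r normrN /= ger0_norm ?fine_ge0//.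
by rewrite -lee_fin fineK// ge0_fin_numE// (le_lt_trans un)// ltry.
Qed.

Lemma poweR_le_EFin (x : \bar R) (q e : R) : 0 <= x -> (0 < q)%R -> (0 < e)%R ->
  (x `^ q <= e%:E) = (x <= (e `^ q^-1)%:E).
Proof.
move=> + q0 e0; case: x => [r| |]//.
  rewrite lee_fin => r0; rewrite poweR_EFin !lee_fin; apply/idP/idP => h.
    have := ge0_ler_powR (r := q^-1) ltac:(by rewrite invr_ge0 ltW) _ _ h.
    rewrite -powRrM divff ?gt_eqF// powRr1//; apply; rewrite nnegrE ?powR_ge0//.
    exact: ltW.
  have := ge0_ler_powR (r := q) (ltW q0) _ _ h.
  rewrite -powRrM mulVf ?gt_eqF// powRr1 ?(ltW e0)//; apply; rewrite nnegrE//.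
  exact: powR_ge0.
by rewrite poweRyr ?gt_eqF.
Qed.

Lemma poweR_cvge0P u (q : R) : (0 < q)%R -> (forall n, 0 <= u n) ->
  u n `^ q @[n --> \oo] --> 0 <-> u n @[n --> \oo] --> 0.
Proof.
move=> q0 u0; have uq0 n : 0 <= u n `^ q by exact: poweR_ge0.
rewrite (ge0_cvge0P uq0) (ge0_cvge0P u0); split => H e e0.
  have eq0 : (0 < e `^ q)%R by exact: powR_gt0.
  apply: filterS (H _ eq0) => n; rewrite poweR_le_EFin// -powRrM divff ?gt_eqF//.
  by rewrite powRr1// ltW.
apply: filterS (H _ (powR_gt0 q^-1 e0)) => n.
by rewrite poweR_le_EFin.
Qed.

Lemma wasserstein_poweR d (T : measurableType d) (dist : T -> T -> R) (p : R)
    (mu nu : {measure set T -> \bar R}) : p != 0%R ->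
  wasserstein dist p mu nu `^ p =
  transport_cost (fun z => dist z.1 z.2 `^ p)%R mu nu.
Proof.
move=> p0; rewrite /wasserstein -poweRrM mulVf// poweRe1//.
by apply: transport_cost_ge0 => z; exact: powR_ge0.
Qed.

Lemma wasserstein_cvge0P d (T : measurableType d) (dist : T -> T -> R) (p : R)
    (mu_ : nat -> probability T R) (mu : probability T R) : (0 < p)%R ->
  wasserstein dist p (mu_ n) mu @[n --> \oo] --> 0 <->
  transport_cost (fun z => dist z.1 z.2 `^ p)%R (mu_ n) mu @[n --> \oo] --> 0.
Proof.
move=> p0; apply: poweR_cvge0P; first by rewrite invr_gt0.
by move=> n; apply: transport_cost_ge0 => z; exact: powR_ge0.
Qed.

Lemma fibred_wasserstein_cvge0P (Omega : completePMetricType R)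
    (X : completeNormedModType R) (pi : probability (borel Omega) R) (p : R)
    (k_ : nat -> R.-pker borel Omega ~> borel X)
    (k : R.-pker borel Omega ~> borel X) : (0 < p)%R ->
  fibred_wasserstein pi p (k_ n) k @[n --> \oo] --> 0 <->
  \int[pi]_w transport_cost (fun z => @normdist R X z.1 z.2 `^ p)%R (k_ n w) (k w)
    @[n --> \oo] --> 0.
Proof.
move=> p0.
have -> : (fun n => fibred_wasserstein pi p (k_ n) k) = fun n =>
    (\int[pi]_w transport_cost (fun z => @normdist R X z.1 z.2 `^ p)%R
      (k_ n w) (k w)) `^ p^-1.
  apply/funext => n; rewrite /fibred_wasserstein; congr (_ `^ _).
  by apply: eq_integral => w _; rewrite wasserstein_poweR// gt_eqF.
apply: poweR_cvge0P; first by rewrite invr_gt0.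
move=> n; apply: integral_ge0 => w _.
by apply: transport_cost_ge0 => z; exact: powR_ge0.
Qed.

End ereal_convergence.

(** * Fubini for disintegrations and fibre integrals *)

Section fibre_integrals.
Context (R : realType) (Omega : completePMetricType R)
  (X : completeNormedModType R) (pi : probability (borel Omega) R)
  (mu : probability (borel Omega * borel X)%type R)
  (k : R.-pker borel Omega ~> borel X).

Lemma measurable_kernel_integral (f : borel X -> \bar R) :
  measurable_fun setT f -> (forall x, (0 <= f x)%E) ->
  measurable_fun setT (fun w : borel Omega => (\int[k w]_x f x)%E).
Proof.
move=> mf f0; apply: measurable_fun_integral_kernel => // U mU.
exact: measurable_kernel.
Qed.

Lemma measurable_fibre_int (phi : X -> R) :
  measurable_fun setT (phi : borel X -> R) ->
  measurable_fun setT (fibre_int phi k).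
Proof.
move=> mphi; have mE : measurable_fun setT (EFin \o (phi : borel X -> R)).
  exact/measurable_EFinP.
apply: (measurableT_comp (f := fine)) => //.
rewrite (_ : (fun w => _) = fun w : borel Omega =>
   (\int[k w]_x ((EFin \o (phi : borel X -> R))^\+ x) -
    \int[k w]_x ((EFin \o (phi : borel X -> R))^\- x))%E); last first.
  by apply/funext => w; rewrite integralE.
apply: emeasurable_funB; apply: measurable_kernel_integral => //.
  exact: measurable_funepos.
exact: measurable_funeneg.
Qed.

Hypothesis hk : disintegration pi mu k.

Lemma integrable_disintegration (F : borel Omega * borel X -> \bar R) :
  mu.-integrable setT F ->
  pi.-integrable setT (fun w => \int[k w]_x F (w, x))%E /\
  (\int[pi]_w \int[k w]_x F (w, x) = \int[mu]_z F z)%E.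
Proof.
move=> IF; have mF := measurable_int _ IF.
pose Ap w := (\int[k w]_x F^\+ (w, x))%E.
pose Am w := (\int[k w]_x F^\- (w, x))%E.
have mp := measurable_funepos mF; have mm := measurable_funeneg mF.
have mAp : measurable_fun setT Ap.
  by apply: (measurable_fun_integral_finite_kernel F^\+%E).
have mAm : measurable_fun setT Am.
  by apply: (measurable_fun_integral_finite_kernel F^\-%E).
have Ap0 w : (0 <= Ap w)%E by exact: integral_ge0.
have Am0 w : (0 <= Am w)%E by exact: integral_ge0.
have EAp : (\int[pi]_w Ap w = \int[mu]_z F^\+ z)%E.
  by rewrite (ge0_integral_disintegration hk).
have EAm : (\int[pi]_w Am w = \int[mu]_z F^\- z)%E.
  by rewrite (ge0_integral_disintegration hk).
have IAp : pi.-integrable setT Ap.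
  apply/integrableP; split => //; under eq_integral do rewrite gee0_abs//.
  by rewrite EAp; exact: integral_funepos_lt_pinfty.
have IAm : pi.-integrable setT Am.
  apply/integrableP; split => //; under eq_integral do rewrite gee0_abs//.
  by rewrite EAm; exact: integral_funeneg_lt_pinfty.
have E w : (\int[k w]_x F (w, x) = Ap w - Am w)%E.
  rewrite integralE /Ap /Am; congr (_ - _)%E; apply: eq_integral => x _.
    by rewrite !funeposE.
  by rewrite !funenegE.
rewrite (_ : (fun w => _) = (fun w => Ap w - Am w)%E); last by apply/funext.
split; first exact: integrableB.
by rewrite integralB// EAp EAm [RHS]integralE.
Qed.

Variable h : borel X -> R.
Hypotheses (h0 : forall x, 0 <= h x) (mh : measurable_fun setT h).
Hypothesis muh : (\int[mu]_z (h z.2)%:E < +oo)%E.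

Let msnd (f : borel X -> R) : measurable_fun setT f ->
  measurable_fun setT (fun z : borel Omega * borel X => f z.2).
Proof. by move=> mf; exact: (measurableT_comp mf measurable_snd). Qed.

Let mfst (f : borel Omega -> R) : measurable_fun setT f ->
  measurable_fun setT (fun z : borel Omega * borel X => f z.1).
Proof. by move=> mf; exact: (measurableT_comp mf measurable_fst). Qed.

Lemma fibre_moment_lty : {ae pi, forall w, (\int[k w]_x (h x)%:E < +oo)%E}.
Proof.
have IH : mu.-integrable setT (fun z => (h z.2)%:E).
  apply/integrableP; split; first by apply/measurable_EFinP; exact: msnd mh.
  by under eq_integral do rewrite /= ger0_norm//.
have [/(integrable_ae measurableT) + _] := integrable_disintegration IH.
by apply: filterS => w /(_ Logic.I); rewrite fin_numElt => /andP[].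
Qed.

Variables (phi : borel X -> R) (b : R).
Hypotheses (mphi : measurable_fun setT phi)
  (phib : forall x, `|phi x| <= b * (1 + h x)).

Lemma integrable_snd : mu.-integrable setT (fun z => (phi z.2)%:E).
Proof.
apply: (@growth_integrable _ _ _ mu (fun z => h z.2) (fun z => phi z.2) b) => //.
- exact: msnd.
- exact: msnd.
Qed.

Lemma fibre_integrable w : (\int[k w]_x (h x)%:E < +oo)%E ->
  (k w).-integrable setT (EFin \o phi).
Proof.
have [P kP] := probability_of_measure (prob_kernel (s := k) w).
by rewrite kP => hP; exact: growth_integrable phib.
Qed.

(** The extended-real fibre integral is [pi]-integrable and dominates: [fine] sends infinite values
    to 0 and keeps the others. *)
Lemma integrable_fibre_int : pi.-integrable setT (EFin \o fibre_int phi k).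
Proof.
have [I1 _] := integrable_disintegration integrable_snd.
apply: le_integrable I1 => //; first by apply/measurable_EFinP; exact: measurable_fibre_int.
move=> w _ /=; rewrite /fibre_int /Rintegral.
by case: (\int[k w]_x (phi x)%:E)%E => //= *; rewrite normr0 leey.
Qed.

(** Exchanges pairings with bounded functions on [Omega] for integrals of products under [mu], to
    which the transport estimates on the product space apply. *)
Lemma Rintegral_fibre_intM (g : borel Omega -> R) (M : R) :
  measurable_fun setT g -> (forall w, `|g w| <= M) ->
  \int[pi]_w (fibre_int phi k w * g w) = \int[mu]_z (phi z.2 * g z.1).
Proof.
move=> mg gM.
have IF : mu.-integrable setT (fun z => (phi z.2 * g z.1)%:E).
  apply: (@growth_integrable _ _ _ mu (fun z => h z.2) (fun z => phi z.2 * g z.1) (b * M)).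
  - exact: msnd.
  - by [].
  - exact: muh.
  - by apply: measurable_funM; [exact: msnd|exact: mfst].
  - by move=> z; rewrite normrM mulrAC ler_pM.
have [I1 E1] := integrable_disintegration IF.
rewrite /Rintegral -E1; congr fine; apply: ae_eq_integral => //.
- apply/measurable_EFinP/measurable_funM => //; exact: measurable_fibre_int.
- exact: measurable_int I1.
(* On a fibre of infinite moment [fibre_int] may be a default value; such fibres form a [pi]-null
   set. *)
apply: filterS fibre_moment_lty => w /fibre_integrable Iw _ /=.
under eq_integral do rewrite EFinM muleC.
rewrite integralZl//.
have [P kP] := probability_of_measure (prob_kernel (s := k) w).
rewrite /fibre_int; move: Iw; rewrite kP => Iw.
by rewrite integral_EFin_Rintegral// -EFinM mulrC.
Qed.

End fibre_integrals.

Lemma dominated_integral_small d (T : measurableType d) (R : realType)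
    (P : probability T R) (f_ : nat -> T -> R) (g : T -> R) :
  (forall m, measurable_fun setT (f_ m)) -> (forall m x, 0 <= f_ m x <= g x) ->
  P.-integrable setT (EFin \o g) -> (forall x, f_ m x @[m --> \oo] --> (0 : R)) ->
  forall e : R, 0 < e ->
    \forall m \near \oo, (\int[P]_x (f_ m x)%:E <= e%:E)%E.
Proof.
move=> mf fg Ig f0; apply/ge0_cvge0P.
  by move=> m; apply: integral_ge0 => x _; rewrite lee_fin; case/andP: (fg m x).
rewrite -[X in _ --> X](@integral0 _ _ _ P setT).
apply: (@dominated_cvg _ _ _ P setT measurableT _ (cst 0%E) (EFin \o g)) => //.
- by move=> n; exact/measurable_EFinP.
- by move=> x _; apply/fine_cvgP; split; [exact: nearW|exact: f0].
- move=> n x _ /=; case/andP: (fg n x) => fn0 fng.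
  by rewrite lee_fin ger0_norm.
Qed.

(** Here [a - b <= u1 - l2 = (u1 - u2) + (u2 - l2)] and [b - a <= u2 - l1 = (l2 - l1) + (u2 - l2)].
    Only the second width occurs, so brackets will have to be narrow under the limit measure
    alone. *)
Lemma normB_le_bracket (R : realDomainType) (a b l1 l2 u1 u2 : R) :
  l1 <= a <= u1 -> l2 <= b <= u2 ->
  `|a - b| <= `|u1 - u2| + (`|l1 - l2| + (u2 - l2)).
Proof.
move=> /andP[la au] /andP[lb bu].
have h1 := ler_norm (u1 - u2); have h2 := ler_norm (- (l1 - l2)).
rewrite normrN in h2; have h3 := normr_ge0 (u1 - u2); have h4 := normr_ge0 (l1 - l2).
by rewrite ler_norml; apply/andP; split; lra.
Qed.

Section moment_setup.
Context (R : realType) (Omega : completePMetricType R)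
  (X : completeNormedModType R) (p : R).
Hypothesis p1 : 1 <= p.

Definition norm_pow (x : borel X) : R := `|(x : X)| `^ p.

Definition normdist_pow (z : borel X * borel X) : R := @normdist R X z.1 z.2 `^ p.

Let p0 : 0 < p. Proof. by rewrite (lt_le_trans ltr01). Qed.

Lemma norm_pow_ge0 x : 0 <= norm_pow x. Proof. exact: powR_ge0. Qed.

Lemma normdist_pow_ge0 z : 0 <= normdist_pow z. Proof. exact: powR_ge0. Qed.

Lemma measurable_norm_pow : measurable_fun setT norm_pow.
Proof. by apply: continuous_borel_measurable; exact: continuous_norm_powR. Qed.

Lemma continuous_normdist (y : X) : continuous (fun x : X => @normdist R X x y).
Proof.
move=> x; apply: (@lipschitz_continuous R X _ 1) => u v; rewrite mul1r.
by rewrite (le_trans (ler_dist_dist _ _))// opprB addrA subrK.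
Qed.

Lemma measurable_normdist_point (y : X) :
  measurable_fun setT (fun x : borel X => @normdist R X x y).
Proof. by apply: continuous_borel_measurable; exact: continuous_normdist. Qed.

Lemma normdist_dense_sequence : separable X ->
  exists s : nat -> X, forall (x : X) (e : R), 0 < e ->
    exists i, @normdist R X x (s i) < e.
Proof.
move=> /separable_dense_sequence[s hs]; exists s => x e /(hs x)[i].
by rewrite -ball_normE /= => xi; exists i.
Qed.

Lemma measurable_normdist : separable X ->
  measurable_fun setT (fun z : borel X * borel X => @normdist R X z.1 z.2).
Proof.
move=> /normdist_dense_sequence[s hs].
apply: (@measurable_dist _ (borel X) R (@normdist R X) s) => //.
- by move=> x y; rewrite /normdist distrC.
- by move=> x y z; rewrite /normdist (le_trans _ (ler_normD _ _))// addrA subrK.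
- by move=> i; exact: measurable_normdist_point.
Qed.

Lemma measurable_normdist_pow : separable X -> measurable_fun setT normdist_pow.
Proof.
move=> sX; apply: (measurableT_comp (measurable_powR p)).
exact: measurable_normdist.
Qed.

Lemma normdist_pow_le x y :
  normdist_pow (x, y) <= 2 `^ p * (norm_pow x + norm_pow y).
Proof. exact: normB_powR_le. Qed.

Variable pi : probability (borel Omega) R.

Lemma fst_marginal_moment_lty (mu : probability (borel Omega * borel X)%type R) :
  fst_marginal_moment pi p mu -> (\int[mu]_z (norm_pow z.2)%:E < +oo)%E.
Proof.
move=> [_ [k hk]]; rewrite (ge0_integral_disintegration hk)//.
- apply/measurable_EFinP; apply: (measurableT_comp measurable_norm_pow).
  exact: measurable_snd.
- by move=> z; rewrite lee_fin norm_pow_ge0.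
Qed.

End moment_setup.

(** * Fibred distance and strong convergence *)

Section strong_convergence.
Context (R : realType) (Omega : completePMetricType R)
  (X : completeNormedModType R) (sepX : separable X)
  (pi : probability (borel Omega) R) (p : R) (p1 : 1 <= p).
Variables (mu_ : nat -> probability (borel Omega * borel X)%type R)
  (mu : probability (borel Omega * borel X)%type R).
Hypotheses (hmu_ : forall n, fst_marginal_moment pi p (mu_ n))
  (hmu : fst_marginal_moment pi p mu).
Variables (k_ : nat -> R.-pker borel Omega ~> borel X)
  (k : R.-pker borel Omega ~> borel X).
Hypotheses (hk_ : forall n, disintegration pi (mu_ n) (k_ n))
  (hk : disintegration pi mu k).

Let h : borel X -> R := norm_pow p.
Let c : borel X * borel X -> R := normdist_pow p.
Let h0 : forall x, 0 <= h x. Proof. exact: norm_pow_ge0. Qed.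
Let mh : measurable_fun setT h. Proof. exact: measurable_norm_pow. Qed.
Let c0 : forall z, 0 <= c z. Proof. exact: normdist_pow_ge0. Qed.
Let mc : measurable_fun setT c. Proof. exact: measurable_normdist_pow. Qed.
Let muh_ n := fst_marginal_moment_lty p1 (hmu_ n).
Let muh := fst_marginal_moment_lty p1 hmu.

Let cost n w := transport_cost c (k_ n w) (k w).

Let cost0 n w : (0 <= cost n w)%E. Proof. exact: transport_cost_ge0. Qed.

(** Valid for every [w], with no exceptional set: an infinite moment or cost makes the right-hand
    side infinite. *)
Lemma fibre_int_diff_le (f : X -> R) (b e C : R) n w :
  continuous f -> (forall x, `|f x| <= b * (1 + h x)) -> 0 < e -> 0 < C ->
  (forall x y, `|f x - f y| <= e * (1 + h y) + C * c (x, y)) ->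
  ((`|fibre_int f (k_ n) w - fibre_int f k w|)%:E <=
    e%:E * (1 + \int[k w]_x (h x)%:E) + C%:E * cost n w)%E.
Proof.
move=> cf fb e0 C0 fec; rewrite /cost /fibre_int.
have [P1 ->] := probability_of_measure (prob_kernel (s := k_ n) w).
have [P2 ->] := probability_of_measure (prob_kernel (s := k) w).
apply: (@Rintegral_diff_le_transport_cost _ _ _ P1 P2 c h f b) => //.
exact: continuous_borel_measurable.
Qed.

Lemma cost_continuous_fibre_cvg (f : X -> R) (b : R) :
  (\int[pi]_w cost n w @[n --> \oo] --> 0)%E ->
  continuous f -> cost_continuous c h f -> (forall x, `|f x| <= b * (1 + h x)) ->
  forall e : R, 0 < e -> \forall n \near \oo,
    (\int[pi]_w (`|fibre_int f (k_ n) w - fibre_int f k w|)%:E <= e%:E)%E.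
Proof.
move=> /ge0_cvge0P cvg0 cf ccf fb e e0.
have {}cvg0 := cvg0 (fun n => integral_ge0 _ (fun w _ => cost0 n w)).
have mf : measurable_fun setT (f : borel X -> R) by exact: continuous_borel_measurable.
have Eh : (\int[pi]_w \int[k w]_x (h x)%:E = \int[mu]_z (h z.2)%:E)%E.
  rewrite (ge0_integral_disintegration hk)//.
  - apply/measurable_EFinP; exact: (measurableT_comp mh measurable_snd).
  - by move=> z; rewrite lee_fin.
pose M := fine (\int[mu]_z (h z.2)%:E).
have M0 : 0 <= M by apply/fine_ge0/integral_ge0 => z _; rewrite lee_fin.
have ME : (\int[mu]_z (h z.2)%:E = M%:E)%E.
  by rewrite fineK// ge0_fin_numE ?muh//; apply: integral_ge0 => z _; rewrite lee_fin.
(* The integral of [1 + \int h] over [pi] is [1 + M], so the first term contributes [e / 2]; the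
   cost receives the other half. *)
have d0 : 0 < e / 2 / (1 + M) by rewrite !divr_gt0// ltr_pwDl.
have [C C0 hC] := ccf _ d0.
have := cvg0 _ (divr_gt0 (divr_gt0 e0 (ltr0n R 2)) C0); apply: filterS => n hn.
have mhk : measurable_fun setT (fun w : borel Omega => (\int[k w]_x (h x)%:E)%E).
  apply: measurable_kernel_integral; first exact/measurable_EFinP.
  by move=> x; rewrite lee_fin.
have hk0 w : (0 <= \int[k w]_x (h x)%:E)%E by apply: integral_ge0 => x _; rewrite lee_fin.
have mD := measurable_funB (measurable_fibre_int (k_ n) mf) (measurable_fibre_int k mf).
(* The cost is the one term not known to be measurable in [w]. *)
apply: (@le_trans _ _ (\int[pi]_w ((e / 2 / (1 + M))%:E * (1 + \int[k w]_x (h x)%:E)) +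
    C%:E * \int[pi]_w cost n w)%E).
  apply: (@integral_le_add_nonmeasurable _ _ _ pi
    (fun w => `|fibre_int f (k_ n) w - fibre_int f k w|)) => //.
  - exact: measurableT_comp mD.
  - by move=> w; rewrite mule_ge0 ?lee_fin ?(ltW d0)// adde_ge0.
  - by apply: measurable_funeM; apply: emeasurable_funD.
  - by move=> w; exact: fibre_int_diff_le fb d0 C0 hC.
rewrite ge0_integralZl//; last 3 first.
- by apply: emeasurable_funD.
- by move=> w _; rewrite adde_ge0.
- by rewrite lee_fin ltW.
rewrite ge0_integralD// integral_cst//= probability_setT mul1e Eh ME -EFinD -EFinM divfK; last first.
  by rewrite gt_eqF// ltr_pwDl.
apply: (@le_trans _ _ ((e / 2)%:E + C%:E * (e / 2 / C)%:E)%E).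
  by rewrite leeD2l// lee_wpmul2l// lee_fin ltW.
by rewrite -EFinM -EFinD lee_fin [C * _]mulrC divfK ?gt_eqF// -splitr.
Qed.

(** Cost-continuity is available for the bracketing functions of [phi] rather than for [phi]. The
    three thirds of [e] go to the upper function, the lower function and the gap, the latter made
    small under [mu] before [n] varies. *)
Lemma fibred_cvg_strong (phi : X -> R) :
  (\int[pi]_w cost n w @[n --> \oo] --> 0)%E -> C0p p phi ->
  strong_cvg_L1 pi (fun n => fibre_int phi (k_ n)) (fibre_int phi k).
Proof.
move=> cvg0 Cphi; have [cphi _] := Cphi.
have [b0 b00 phib] := C0p_growth p1 Cphi.
have mphi : measurable_fun setT (phi : borel X -> R) by exact: continuous_borel_measurable.
have In n := integrable_fibre_int (hk_ n) h0 mh (muh_ n) mphi phib.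
have Ik := integrable_fibre_int hk h0 mh muh mphi phib.
split; [by move=> n; apply/Lfun1_integrable; exact: In|exact/Lfun1_integrable|].
have [b [l [u [hl hu lu lu0]]]] := C0p_bracket p1 Cphi.
apply/ge0_cvge0P; first by move=> n; exact: Lnorm_ge0.
move=> e e0; have e3 : 0 < e / 3 by rewrite divr_gt0.
pose g m (x : borel X) := u m x - l m x.
have ml m : measurable_fun setT (l m : borel X -> R).
  by apply: continuous_borel_measurable; have [] := hl m.
have mu' m : measurable_fun setT (u m : borel X -> R).
  by apply: continuous_borel_measurable; have [] := hu m.
have mg m : measurable_fun setT (g m) by exact: measurable_funB.
have g0 m x : 0 <= g m x.
  by rewrite subr_ge0; have /andP[h1 h2] := lu m x; exact: le_trans h1 h2.
have gb m x : `|g m x| <= (2 * b) * (1 + h x).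
  have [_ _ /(_ x)] := hl m; have [_ _ /(_ x)] := hu m.
  rewrite -!/(h x) => h1 h2; apply: (le_trans (ler_normB _ _)).
  by rewrite -mulrA mulr_natl mulr2n lerD.
have Ib : mu.-integrable setT (EFin \o (fun z => (2 * b) * (1 + h z.2))).
  have mhs : measurable_fun setT (fun z : borel Omega * borel X => h z.2).
    exact: (measurableT_comp mh measurable_snd).
  apply: (growth_integrable (b := 2 * `|b|) mhs) => //.
    by apply: measurable_funM => //; exact: measurable_funD.
  by move=> z; rewrite !normrM (ger0_norm (ler0n R 2)) (@ger0_norm _ (1 + _))// addr_ge0.
have : \forall m \near \oo, (\int[mu]_z (g m z.2)%:E <= (e / 3)%:E)%E.
  apply: (dominated_integral_small _ _ Ib) => //.
  - by move=> m; exact: (measurableT_comp (mg m) measurable_snd).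
  - move=> m z; rewrite g0/=; apply: le_trans (gb m z.2); exact: ler_norm.
  - by move=> z; exact: lu0.
move=> [m _ /(_ m (leqnn m))] gm.
have [cl ccl bl] := hl m; have [cu ccu bu] := hu m.
have := cost_continuous_fibre_cvg cvg0 cl ccl bl e3; apply: filter_app.
have := cost_continuous_fibre_cvg cvg0 cu ccu bu e3; apply: filterS => n hun hln.
rewrite Lnorm1.
pose D (f : X -> R) w := `|fibre_int f (k_ n) w - fibre_int f k w|.
have mD (f : X -> R) : measurable_fun setT (f : borel X -> R) -> measurable_fun setT (D f).
  move=> mf; apply: (measurableT_comp (@normr_measurable R setT)).
  by apply: measurable_funB; exact: measurable_fibre_int.
have mfg := measurable_fibre_int k (mg m).
have fg0 w : 0 <= fibre_int (g m) k w by apply: Rintegral_ge0.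
apply: (@le_trans _ _ (\int[pi]_w ((D (u m) w)%:E + ((D (l m) w)%:E + (fibre_int (g m) k w)%:E)))%E).
  (* Fibre integrals are compared where both fibres have finite moment, that is for almost every
     [w]. *)
  apply: ae_ge0_le_integral => //.
  - by apply/measurable_EFinP; exact: mD.
  - by move=> w _; apply: adde_ge0; [|apply: adde_ge0]; rewrite lee_fin ?normr_ge0 ?fg0.
  - apply: emeasurable_funD; first by apply/measurable_EFinP; exact: mD.
    by apply: emeasurable_funD; apply/measurable_EFinP => //; exact: mD.
  have := fibre_moment_lty hk h0 mh muh; apply: filter_app.
  have := fibre_moment_lty (hk_ n) h0 mh (muh_ n); apply: filterS => w wn wk _.
  rewrite /= -!EFinD lee_fin.
  have Ikn (f : borel X -> R) b' : measurable_fun setT f ->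
    (forall x, `|f x| <= b' * (1 + h x)) -> (k_ n w).-integrable setT (EFin \o f).
    by move=> mf fb; exact: (fibre_integrable h0 mh mf fb wn).
  have Ikk (f : borel X -> R) b' : measurable_fun setT f ->
    (forall x, `|f x| <= b' * (1 + h x)) -> (k w).-integrable setT (EFin \o f).
    by move=> mf fb; exact: (fibre_integrable h0 mh mf fb wk).
  have e1 : fibre_int (g m) k w = fibre_int (u m) k w - fibre_int (l m) k w.
    apply: RintegralB => //; [exact: Ikk bu|exact: Ikk bl].
  have n1 : fibre_int (l m) (k_ n) w <= fibre_int phi (k_ n) w.
    apply: le_Rintegral => //; [exact: Ikn bl|exact: Ikn phib|].
    by move=> x _; case/andP: (lu m x).
  have n2 : fibre_int phi (k_ n) w <= fibre_int (u m) (k_ n) w.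
    apply: le_Rintegral => //; [exact: Ikn phib|exact: Ikn bu|].
    by move=> x _; case/andP: (lu m x).
  have n3 : fibre_int (l m) k w <= fibre_int phi k w.
    apply: le_Rintegral => //; [exact: Ikk bl|exact: Ikk phib|].
    by move=> x _; case/andP: (lu m x).
  have n4 : fibre_int phi k w <= fibre_int (u m) k w.
    apply: le_Rintegral => //; [exact: Ikk phib|exact: Ikk bu|].
    by move=> x _; case/andP: (lu m x).
  by rewrite e1; apply: normB_le_bracket; apply/andP; split.
have mDE f : measurable_fun setT (f : borel X -> R) -> measurable_fun setT (EFin \o D f).
  by move=> mf; apply/measurable_EFinP; exact: mD.
rewrite ge0_integralD//; last 4 first.
- by move=> w _; rewrite lee_fin normr_ge0.
- exact: mDE.
- by move=> w _; apply: adde_ge0; rewrite lee_fin ?normr_ge0 ?fg0.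
- apply: emeasurable_funD; [exact: mDE|exact/measurable_EFinP].
rewrite ge0_integralD//; last 4 first.
- by move=> w _; rewrite lee_fin normr_ge0.
- exact: mDE.
- by move=> w _; rewrite lee_fin.
- exact/measurable_EFinP.
have Igm := integrable_fibre_int hk h0 mh muh (mg m) (gb m).
have Egm : (\int[pi]_w (fibre_int (g m) k w)%:E = \int[mu]_z (g m z.2)%:E)%E.
  rewrite integral_EFin_Rintegral// integral_EFin_Rintegral; last first.
    exact: (integrable_snd h0 mh muh (mg m) (gb m)).
  congr EFin; have := Rintegral_fibre_intM hk h0 mh muh (mg m) (gb m)
    (g := fun=> 1) (M := `|1|) (measurable_cst _) (fun=> lexx _).
  under eq_Rintegral do rewrite mulr1.
  by under [in RHS]eq_Rintegral do rewrite mulr1.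
rewrite Egm.
apply: le_trans (leeD hun (leeD hln gm)) _.
by rewrite -!EFinD lee_fin; lra.
Qed.

(** Once [J] is fixed from the tail of [mu], the upper bound involves finitely many functions of
    growth [p]: the cells and the uncovered tail. Strong convergence for the cells makes the
    discrepancies small, and for the tail it carries the bound over to [mu_ n]. *)
Lemma strong_cvg_fibred :
  (forall phi : X -> R, C0p p phi ->
    strong_cvg_L1 pi (fun n => fibre_int phi (k_ n)) (fibre_int phi k)) ->
  (\int[pi]_w cost n w @[n --> \oo] --> 0)%E.
Proof.
move=> strong; apply/ge0_cvge0P; first by move=> n; exact: integral_ge0.
have [s hs] := normdist_dense_sequence sepX.
move=> e e0; pose K : R := 2 `^ p.
have K0 : 0 < K by exact: powR_gt0.
(* Five contributions: one for the diameter of the cells, one for the discrepancies, and three for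
   the tails weighted by [K], the tail under [mu_ n] counting twice. *)
pose e1 := e / 5; have e10 : 0 < e1 by rewrite divr_gt0.
pose d := e1 / K; have d0 : 0 < d by rewrite divr_gt0.
(* Cells have radius [2 * eta], so two points of one cell are at distance less than [4 * eta], the
   [p]-th root of [e1]. *)
pose eta := e1 `^ p^-1 / 4.
have eta0 : 0 < eta by rewrite divr_gt0// powR_gt0.
pose nd := @normdist R X.
have cnd i : continuous (fun x : X => nd x (s i)) by exact: continuous_normdist.
pose ps i : X -> R := cell nd s eta i.
pose ps_rest J (x : X) : R := (1 - bump_cover nd s eta J x) * h x.
have cps i : continuous (ps i) by exact: continuous_cell.
have mps i : measurable_fun setT (ps i : borel X -> R) by exact: continuous_borel_measurable.
have rest0 J x : 0 <= ps_rest J x by rewrite mulr_ge0// subr_ge0 bump_cover_le1.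
have resth J x : ps_rest J x <= h x.
  by rewrite ler_piMl// gerBl bump_cover_ge0.
have crest J : continuous (ps_rest J).
  move=> x; apply: (@continuousM R X); last exact: continuous_norm_powR.
  by apply: (@continuousB R R^o X); [exact: cst_continuous|exact: continuous_bump_cover].
have mrest J : measurable_fun setT (ps_rest J : borel X -> R).
  exact: continuous_borel_measurable.
have C0rest J : C0p p (ps_rest J).
  split; first exact: crest.
  exists 1, 0; split => // x; rewrite ger0_norm// mul1r subr0.
  by rewrite (le_trans (resth J x))// lerDr.
have C0ps i : C0p p (ps i).
  split; first exact: cps.
  exists 1, 0; split => // x; rewrite mul1r ger0_norm ?cell_ge0//.
  apply: (@le_trans _ _ 1); last by rewrite lerDl powR_ge0.
  by rewrite lerBlDr (le_trans (bump_cover_le1 _ _ _ _ _))// lerDl bump_cover_ge0.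
have Imuh : mu.-integrable setT (EFin \o (fun z => h z.2)).
  have mhs : measurable_fun setT (fun z : borel Omega * borel X => h z.2).
    exact: (measurableT_comp mh measurable_snd).
  apply: (growth_integrable (b := 1) mhs) => // z.
  by rewrite mul1r ger0_norm// lerDr.
(* By density of [s] each point is fully covered from some index on; dominated convergence under
   [mu] then fixes [J]. *)
have : \forall J \near \oo, (\int[mu]_z (ps_rest J z.2)%:E <= d%:E)%E.
  apply: (dominated_integral_small _ _ Imuh) => //.
  - by move=> J; exact: (measurableT_comp (mrest J) measurable_snd).
  - by move=> J z; rewrite rest0 resth.
  - move=> z; have [i hi] := hs z.2 _ eta0.
    apply: cvg_near_cst; exists i.+1 => // J iJ.
    by rewrite /ps_rest (bump_cover_eq1 eta0 iJ (ltW hi)) subrr mul0r.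
move=> [J _ /(_ J (leqnn J)) hJ].
(* A sum stands in for the maximum of the bounds of [h] over the [J] cells. *)
pose H := \sum_(i < J) (`|s i| + 2 * eta) `^ p.
have H0 : 0 <= H by apply: sumr_ge0 => i _; exact: powR_ge0.
have hH (i : 'I_J) x : 0 < ps i x -> h x <= H.
  move=> pix; have xi : nd x (s i) < 2 * eta by exact: cell_gt0 pix.
  rewrite /H (bigD1 i)//=.
  apply: (@le_trans _ _ ((`|s i| + 2 * eta) `^ p)); last first.
    by rewrite lerDl sumr_ge0// => *; exact: powR_ge0.
  have p0 : 0 <= p by rewrite (le_trans ler01).
  rewrite ge0_ler_powR ?nnegrE// ?addr_ge0 ?mulr_ge0 ?(ltW eta0)//.
    by rewrite powR_ge0.
  rewrite -lerBlDl (le_trans _ (ltW xi))//; exact: lerB_dist.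
have ceps (i : 'I_J) x y : 0 < ps i x -> 0 < ps i y -> c (x, y) <= e1.
  move=> pix piy; have xi : nd x (s i) < 2 * eta by exact: cell_gt0 pix.
  have yi : nd y (s i) < 2 * eta by exact: cell_gt0 piy.
  have p0 : 0 < p by rewrite (lt_le_trans ltr01).
  have -> : e1 = (e1 `^ p^-1) `^ p.
    by rewrite -powRrM mulVf ?gt_eqF// powRr1// ltW.
  rewrite ge0_ler_powR ?nnegrE ?(ltW p0)// ?powR_ge0//.
    exact: normr_ge0.
  have -> : e1 `^ p^-1 = 2 * eta + 2 * eta by rewrite /eta; lra.
  rewrite /normdist (le_trans (ler_distD (s i) _ _))// lerD ?(ltW xi)//.
  by rewrite distrC ltW.
have sump x : \sum_(i < J) ps i x <= 1 by rewrite sum_cell bump_cover_le1.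
pose E n w := (\int[k_ n w]_x (ps_rest J x)%:E)%E.
pose Ek w := (\int[k w]_x (ps_rest J x)%:E)%E.
have bound n w : (cost n w <=
    (e1 + K * (H * \sum_(i < J) `|fibre_int (ps i) (k_ n) w - fibre_int (ps i) k w|))%:E
    + K%:E * (E n w + Ek w))%E.
  have psE : ps_rest J = fun x => (1 - \sum_(i < J) ps i x) * h x.
    by apply/funext => x; rewrite /ps_rest sum_cell.
  rewrite /cost /E /Ek psE /fibre_int.
  have [P1 ->] := probability_of_measure (prob_kernel (s := k_ n) w).
  have [P2 ->] := probability_of_measure (prob_kernel (s := k) w).
  apply: (@transport_cost_le_cells _ (borel X) R P1 P2 'I_J (fun i => ps i)) => //.
  - by move=> i x; exact: cell_ge0.
  - exact: ltW.
  - exact: ltW.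
  - by move=> x y; exact: normdist_pow_le.
pose S n := (\sum_(i < J) \int[pi]_w (`|fibre_int (ps i) (k_ n) w - fibre_int (ps i) k w|)%:E)%E.
have mdiff n i : measurable_fun setT
    (fun w => (`|fibre_int (ps i) (k_ n) w - fibre_int (ps i) k w|)%:E).
  apply/measurable_EFinP; apply: (measurableT_comp (@normr_measurable R setT)).
  by apply: measurable_funB; exact: measurable_fibre_int.
have mE n : measurable_fun setT (E n).
  by apply: measurable_kernel_integral; [exact/measurable_EFinP|move=> x; rewrite lee_fin].
have mEk : measurable_fun setT Ek.
  by apply: measurable_kernel_integral; [exact/measurable_EFinP|move=> x; rewrite lee_fin].
have E0 n w : (0 <= E n w)%E by apply: integral_ge0 => x _; rewrite lee_fin.
have Ek0 w : (0 <= Ek w)%E by apply: integral_ge0 => x _; rewrite lee_fin.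
have intbound n : (\int[pi]_w cost n w <= e1%:E + (K * H)%:E * S n +
    K%:E * (\int[mu_ n]_z (ps_rest J z.2)%:E + \int[mu]_z (ps_rest J z.2)%:E))%E.
  pose D w := (\sum_(i < J) (`|fibre_int (ps i) (k_ n) w - fibre_int (ps i) k w|)%:E)%E.
  have D0 w : (0 <= D w)%E by apply: sume_ge0 => i _; rewrite lee_fin.
  have mD : measurable_fun setT D by apply: emeasurable_sum.
  have KH0 : 0 <= K * H by rewrite mulr_ge0// ltW.
  (* Plain monotonicity disposes of the cost; from here on every term is measurable. *)
  apply: (@le_trans _ _ (\int[pi]_w ((e1%:E + (K * H)%:E * D w) + K%:E * (E n w + Ek w)))%E).
    apply: le_ge0_integral_nonmeasurable => [w|w]; first exact: cost0.
    apply: (le_trans (bound n w)); rewrite leeD2r//.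
    by rewrite /D sumEFin -EFinM -EFinD mulrA.
  rewrite ge0_integralD//; last 4 first.
  - by move=> w _; rewrite adde_ge0 ?lee_fin ?(ltW e10)// mule_ge0 ?lee_fin.
  - by apply: emeasurable_funD => //; exact: measurable_funeM.
  - by move=> w _; rewrite mule_ge0 ?lee_fin ?(ltW K0)// adde_ge0.
  - by apply: measurable_funeM; exact: emeasurable_funD.
  rewrite ge0_integralD//; last 3 first.
  - by move=> w _; rewrite lee_fin ltW.
  - by move=> w _; rewrite mule_ge0 ?lee_fin.
  - exact: measurable_funeM.
  rewrite integral_cst//= probability_setT mule1 ge0_integralZl//.
  rewrite (ge0_integral_sum pi measurableT)//.
  rewrite ge0_integralZl//; last 3 first.
  - exact: emeasurable_funD.
  - by move=> w _; rewrite adde_ge0.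
  - by rewrite lee_fin ltW.
  rewrite ge0_integralD// (ge0_integral_disintegration (hk_ n)); last 2 first.
  - by apply/measurable_EFinP; exact: (measurableT_comp (mrest J) measurable_snd).
  - by move=> z; rewrite lee_fin.
  rewrite (ge0_integral_disintegration hk)//.
  - by apply/measurable_EFinP; exact: (measurableT_comp (mrest J) measurable_snd).
  - by move=> z; rewrite lee_fin.
have strongE phi : C0p p phi -> forall r : R, 0 < r -> \forall n \near \oo,
    (\int[pi]_w (`|fibre_int phi (k_ n) w - fibre_int phi k w|)%:E <= r%:E)%E.
  move=> /strong[_ _] /ge0_cvge0P - /(_ (fun n => Lnorm_ge0 _ _ _)) H' r r0.
  by apply: filterS (H' _ r0) => n; rewrite Lnorm1.
(* The tail function is itself of growth [p], so its integral under [mu_ n] eventually exceeds that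
   under [mu] by at most [d]. *)
have hmun : \forall n \near \oo, (\int[mu_ n]_z (ps_rest J z.2)%:E <= (d + d)%:E)%E.
  apply: filterS (strongE _ (C0rest J) _ d0) => n hn.
  have restb x : `|ps_rest J x| <= 1 * (1 + h x).
    by rewrite mul1r ger0_norm// (le_trans (resth J x))// lerDr.
  have I1 := integrable_snd h0 mh (muh_ n) (mrest J) restb.
  have I2 := integrable_snd h0 mh muh (mrest J) restb.
  have J1 := integrable_fibre_int (hk_ n) h0 mh (muh_ n) (mrest J) restb.
  have J2 := integrable_fibre_int hk h0 mh muh (mrest J) restb.
  have R1 := Rintegral_fibre_intM (hk_ n) h0 mh (muh_ n) (mrest J) restb
    (g := fun=> 1) (M := `|1|) (measurable_cst _) (fun=> lexx _).
  have R2 := Rintegral_fibre_intM hk h0 mh muh (mrest J) restb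
    (g := fun=> 1) (M := `|1|) (measurable_cst _) (fun=> lexx _).
  have one (T' : Type) (f : T' -> R) : (fun x => f x * 1) = f.
    by apply/funext => x; rewrite mulr1.
  rewrite !one in R1 R2.
  move: hJ; rewrite !integral_EFin_Rintegral// !lee_fin -R1 -R2 => hJ.
  rewrite -lerBlDr; apply: (@le_trans _ _ (\int[pi]_w fibre_int (ps_rest J) (k_ n) w -
    \int[pi]_w fibre_int (ps_rest J) k w)); first by rewrite lerB.
  rewrite -RintegralB//; apply: (le_trans (ler_norm _)).
  have JB := integrable_RB J1 J2.
  apply: (le_trans (le_normr_Rintegral measurableT JB)).
  by rewrite -lee_fin -integral_EFin_Rintegral//; exact: integrable_norm.
(* The added ones keep the denominators positive when [H] or [J] is 0. *)
pose q := e1 / (K * H + 1) / J.+1%:R.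
have KH1 : 0 < K * H + 1 by rewrite ltr_wpDl// mulr_ge0// ltW.
have q0 : 0 < q by rewrite !divr_gt0.
have hS : \forall n \near \oo, (S n <= (e1 / (K * H + 1))%:E)%E.
  have : \forall n \near \oo, forall i : 'I_J,
      (\int[pi]_w (`|fibre_int (ps i) (k_ n) w - fibre_int (ps i) k w|)%:E <= q%:E)%E.
    by apply: filter_forall => i; exact: strongE.
  apply: filterS => n hn; apply: (@le_trans _ _ (\sum_(i < J) q%:E)%E).
    exact: lee_sum.
  rewrite sumEFin lee_fin sumr_const card_ord -mulr_natr /q.
  rewrite -[leLHS]mulrA ler_piMr ?divr_ge0 ?(ltW e10) ?(ltW KH1) ?(ltW e0)//.
  by rewrite mulrC ler_pdivrMr// mul1r ler_nat.
apply: filter_app hmun; apply: filterS hS => n hSn hmn.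
apply: (le_trans (intbound n)).
apply: (@le_trans _ _ (e1%:E + (K * H)%:E * (e1 / (K * H + 1))%:E + K%:E * ((d + d)%:E + d%:E))%E).
  apply: leeD.
    by rewrite leeD2l// lee_wpmul2l// lee_fin mulr_ge0// ltW.
  by rewrite lee_wpmul2l ?lee_fin ?(ltW K0)// leeD.
rewrite -EFinM -!EFinD lee_fin.
have -> : K * (d + d + d) = 3 * e1 by rewrite /d; field; rewrite gt_eqF.
have : K * H * (e1 / (K * H + 1)) <= e1.
  rewrite mulrA ler_pdivrMr// mulrC ler_wpM2l ?(ltW e10)//; lra.
by rewrite /e1; lra.
Qed.

End strong_convergence.

(** * Weak convergence *)

Section base_space.
Context (R : realType) (Omega : completePMetricType R).

Let bd := @basedist R Omega.

Lemma basedist_ge0 x y : 0 <= bd x y. Proof. exact: mdist_ge0. Qed.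
Lemma basedistxx x : bd x x = 0. Proof. exact: mdistxx. Qed.
Lemma basedistC x y : bd x y = bd y x. Proof. exact: metric_sym. Qed.
Lemma basedist_triangle x y z : bd x z <= bd x y + bd y z.
Proof. exact: metric_triangle. Qed.

Lemma basedist_lipschitz_continuous (f : Omega -> R) (L : R) :
  (forall x y, `|f x - f y| <= L * bd x y) -> continuous f.
Proof.
move=> fL x; apply/cvgrPdist_le => e e0.
have L1 : 0 < `|L| + 1 by rewrite ltr_wpDl.
apply/nbhs_ballP; exists (e / (`|L| + 1)) => /=; first exact: divr_gt0.
move=> y; rewrite ballEmdist /= => xy.
apply: (le_trans (fL x y)); apply: (@le_trans _ _ ((`|L| + 1) * bd x y)).
  by rewrite ler_wpM2r ?basedist_ge0//; have := ler_norm L; lra.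
by rewrite mulrC -ler_pdivlMr// ltW.
Qed.

Lemma basedist_point_lipschitz (t x y : Omega) :
  `|bd x t - bd y t| <= 1 * bd x y.
Proof.
rewrite mul1r ler_distl; have := basedist_triangle x y t.
have := basedist_triangle y x t; rewrite (basedistC y x) => h1 h2.
by apply/andP; split; lra.
Qed.

Lemma measurable_basedist_point (t : Omega) :
  measurable_fun setT (fun x : borel Omega => bd x t).
Proof.
apply: continuous_borel_measurable.
exact: (basedist_lipschitz_continuous (basedist_point_lipschitz t)).
Qed.

Lemma basedist_dense_sequence : separable Omega ->
  exists s : nat -> Omega, forall (x : Omega) (e : R), 0 < e ->
    exists i, bd x (s i) < e.
Proof.
move=> /separable_dense_sequence[s hs]; exists s => x e /(hs x)[i].
by rewrite ballEmdist /= => xi; exists i.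
Qed.

Lemma measurable_basedist : separable Omega ->
  measurable_fun setT (fun z : borel Omega * borel Omega => bd z.1 z.2).
Proof.
move=> /basedist_dense_sequence[s hs].
apply: (@measurable_dist _ (borel Omega) R bd s) => //.
- exact: basedistC.
- exact: basedist_triangle.
- by move=> i; exact: measurable_basedist_point.
Qed.

Variable pi : probability (borel Omega) R.

Import HBSimple.

(** Density of bounded Lipschitz functions in [L^1(pi)] as an induction principle: regularization
    reaches indicators of open sets, Dynkin's theorem all measurable sets, linearity the simple
    functions, and [L^1] limits the rest. *)
Lemma L1_lipschitz_induction (Q : (borel Omega -> R) -> Prop) :
  (forall f g, Q f -> Q g -> Q (fun w => f w + g w)) ->
  (forall a f, Q f -> Q (fun w => a * f w)) ->
  (forall (f : borel Omega -> R) L M, (forall x y, `|f x - f y| <= L * bd x y) ->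
    (forall x, `|f x| <= M) -> Q f) ->
  (forall f : borel Omega -> R, pi.-integrable setT (EFin \o f) ->
    (forall e : R, 0 < e -> exists g, [/\ Q g, pi.-integrable setT (EFin \o g) &
      (\int[pi]_w (`|f w - g w|)%:E <= e%:E)%E]) -> Q f) ->
  forall f : borel Omega -> R, pi.-integrable setT (EFin \o f) -> Q f.
Proof.
move=> QD QZ Qlip Qlim.
have Q0 : Q (fun=> 0).
  by apply: (Qlip _ 0 0) => [x y|x]; rewrite ?subrr normr0 ?mul0r.
have I1 A : measurable A -> pi.-integrable setT (EFin \o (\1_A : borel Omega -> R)).
  exact: integrable_indic.
have Qindic A : measurable A -> Q (\1_A).
  move: A; apply: (@dynkin_induction _ (borel Omega) (@open Omega) (fun A => Q (\1_A))).
  - by [].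
  - by move=> U V; exact: openI.
  - apply: (Qlip _ 0 1) => [x y|x]; rewrite !indicT ?subrr ?normr0 ?mul0r//.
    by rewrite normr1.
  (* The indicator of an open set is lower semicontinuous, hence a pointwise limit of its Lipschitz
     regularizations. *)
  - move=> U oU; apply: Qlim; first by apply: I1; exact: open_borel_measurable.
    move=> e e0; pose F : Omega -> R := \1_U; pose g := lipschitz_reg bd F.
    have F0 x : 0 <= F x by rewrite /F indicE.
    have mU := open_borel_measurable oU.
    have mF : measurable_fun setT (F : borel Omega -> R) by exact: measurable_indic.
    have gL m := lipschitz_reg_lipschitz basedist_ge0 basedistC basedist_triangle F0 m.
    have mg m : measurable_fun setT (g m : borel Omega -> R).
      apply: continuous_borel_measurable; apply: basedist_lipschitz_continuous => x y.
      exact: gL.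
    have g0 m x : 0 <= g m x by exact: (lipschitz_reg_ge0 basedist_ge0 F0 m x).
    have gF m x : g m x <= F x by exact: (lipschitz_reg_le basedist_ge0 basedistxx F0 m x).
    have F1 x : F x <= 1 by rewrite /F indicE; case: (_ \in _); rewrite ?lexx ?ler01.
    have : \forall m \near \oo, (\int[pi]_w (F w - g m w)%:E <= e%:E)%E.
      apply: (dominated_integral_small _ _ (integrable_probability_cst pi 1)) => //.
      - by move=> m; exact: measurable_funB.
      - move=> m w; rewrite subr_ge0 gF/=; have := g0 m w; have := F1 w; lra.
      - move=> w; rewrite -(subrr (F w)); apply: cvgB; first exact: cvg_cst.
        apply: (cvg_lipschitz_reg basedist_ge0 basedistxx F0) => e' e'0.
        have [wU|wU] := pselect (U w).
          have /nbhs_ballP[r /= r0 hr] : nbhs w U by exact: open_nbhs_nbhs.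
          exists r => // y wy; have Uy : U y by apply: hr; rewrite ballEmdist.
          by rewrite /F !indicE !mem_set// gerBl ltW.
        exists 1 => // y _; rewrite /F indicE memNset//= sub0r.
        by rewrite (le_trans _ (F0 y))// oppr_le0 ltW.
    move=> [m _ /(_ m (leqnn m))] hm; exists (g m); split.
    + apply: (Qlip _ m%:R 1) => [x y|x]; first exact: gL.
      by rewrite ger0_norm// (le_trans (gF m x)).
    + apply: (@bounded_integrable _ _ _ _ _ 1) => // x.
      by rewrite ger0_norm// (le_trans (gF m x)).
    + apply: le_trans hm; rewrite le_eqVlt; apply/orP; left; apply/eqP.
      by apply: eq_integral => w _; rewrite ger0_norm// subr_ge0.
  - move=> S mS QS; rewrite (_ : \1_(~` S) = fun w => 1 + -1 * \1_S w).
      apply: QD; last exact: QZ.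
      by apply: (Qlip _ 0 1) => [x y|x]; rewrite ?subrr ?normr0 ?mul0r ?normr1.
    by apply/funext => w; rewrite !indicE in_setC; case: (w \in S) => /=; lra.
  (* By disjointness the partial sums are indicators of finite unions, so they stay below 1 and
     dominated convergence applies. *)
  - move=> F mF tF QF; apply: Qlim; first by apply: I1; exact: bigcup_measurable.
    move=> e e0; pose s n (w : borel Omega) : R := \sum_(i < n) \1_(F i) w.
    pose U := \bigcup_k F k.
    have sE n w : s n w = if w \in \bigcup_(k in [set k | (k < n)%N]) F k then 1 else 0.
      case: ifPn => [|wF].
        rewrite inE => -[i /= ni Fiw].
        rewrite /s (bigD1 (Ordinal ni))//= big1 ?addr0 ?indicE ?mem_set//.
        move=> j ji; rewrite indicE memNset// => Fjw.
        move/negP : ji; apply; apply/eqP/val_inj => /=.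
        by apply: (tF j i) => //; exists w.
      rewrite /s big1// => i _; rewrite indicE memNset// => Fiw.
      by move/negP : wF; apply; rewrite inE; exists i => /=.
    have s0 n w : 0 <= s n w by rewrite sE; case: ifP; rewrite ?ler01.
    have s1 n w : s n w <= \1_U w.
      rewrite sE indicE; case: ifPn => [|_]; last by rewrite ler0n.
      by rewrite inE => -[i /= ni Fiw]; rewrite mem_set//; exists i.
    have ms n : measurable_fun setT (s n).
      by apply: measurable_sum => i; exact: measurable_indic.
    have mU : measurable U by exact: bigcup_measurable.
    have U1 w : \1_U w <= 1 :> R by rewrite indicE; case: (_ \in _); rewrite ?lexx ?ler01.
    have : \forall n \near \oo, (\int[pi]_w (\1_U w - s n w)%:E <= e%:E)%E.
      apply: (dominated_integral_small _ _ (integrable_probability_cst pi 1)) => //.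
      - by move=> m; apply: measurable_funB => //; exact: measurable_indic.
      - move=> m w; rewrite subr_ge0 s1/=; have := s0 m w; have := U1 w; lra.
      - move=> w; apply: cvg_near_cst.
        have [[i _ Fiw]|nU] := pselect (U w).
          exists i.+1 => // n /= ni; rewrite sE indicE mem_set; last by exists i.
          by rewrite mem_set ?subrr//; exists i.
        exists 0 => // n _; rewrite sE indicE memNset//.
        by rewrite memNset ?subrr// => -[j _ Fjw]; apply: nU; exists j.
    move=> [n _ /(_ n (leqnn n))] hn; exists (s n); split.
    + rewrite /s; elim: n {hn} => [|n IH].
        by under eq_fun do rewrite big_ord0.
      by under eq_fun do rewrite big_ord_recr /=; exact: QD.
    + apply: (@bounded_integrable _ _ _ _ _ 1) => // x.
      by rewrite ger0_norm// (le_trans (s1 n x)).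
    + apply: le_trans hn; rewrite le_eqVlt; apply/orP; left; apply/eqP.
      by apply: eq_integral => w _; rewrite ger0_norm// subr_ge0.
move=> f If; apply: Qlim => // e e0.
have [g [Ig _ /ge0_cvge0P gf]] := approximation_sfun_integrable measurableT If.
have [n _ /(_ n (leqnn n)) hn] := gf (fun n => integral_ge0 _ (fun w _ => abse_ge0 _)) _ e0.
exists (g n : borel Omega -> R); split => //.
rewrite (_ : (g n : borel Omega -> R) = fun w => \sum_(r <- enum_fset (fset_set (range (g n))))
    r * \1_(g n @^-1` [set r]) w); last first.
  by apply/funext => w; rewrite fimfunE fsbig_finite.
elim: (enum_fset _) => [|r t IH]; first by under eq_fun do rewrite big_nil.
under eq_fun do rewrite big_cons; apply: QD => //; apply: QZ.
by apply: Qindic; rewrite -[X in measurable X]setTI; exact: measurable_funP.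
Qed.

End base_space.

Lemma maxr_contraction (R : realDomainType) (c a b : R) :
  `|Num.max c a - Num.max c b| <= `|a - b|.
Proof.
have h1 := ler_norm (a - b); have h2 := ler_norm (- (a - b)).
rewrite normrN in h2; have h3 := normr_ge0 (a - b).
by have [ca|ca] := leP c a; have [cb|cb] := leP c b;
  rewrite ler_norml; apply/andP; split; lra.
Qed.

Lemma minr_contraction (R : realDomainType) (c a b : R) :
  `|Num.min a c - Num.min b c| <= `|a - b|.
Proof.
have h1 := ler_norm (a - b); have h2 := ler_norm (- (a - b)).
rewrite normrN in h2; have h3 := normr_ge0 (a - b).
by have [ca|ca] := leP a c; have [cb|cb] := leP b c;
  rewrite ler_norml; apply/andP; split; lra.
Qed.

(** Stating the error through a majorant [b] of [|a|] makes it a function of the growth weight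
    alone, which is cost-continuous. *)
Lemma clip_error (R : realDomainType) (m a b : R) : 0 <= m -> `|a| <= b ->
  `|a - Num.max (- m) (Num.min a m)| <= Num.max 0 (b - m).
Proof.
rewrite ler_norml => m0 /andP[a1 a2].
have q1 : 0 <= Num.max 0 (b - m) by rewrite le_max lexx.
have q2 : b - m <= Num.max 0 (b - m) by rewrite le_max lexx orbT.
have [am|am] := leP a m.
  by have [am'|am'] := leP (- m) a; rewrite ler_norml; apply/andP; split; lra.
by have [am'|am'] := leP (- m) m; rewrite ler_norml; apply/andP; split; lra.
Qed.

(** In [f x * (g x - g y) + g y * (f x - f y)] the increments are multiplied by values of [f] and
    [g]; this is where the sup bounds enter. *)
Lemma cost_continuousM (T : Type) (R : realType) (c : T * T -> R) (h : T -> R)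
    (f g : T -> R) (B M : R) :
  (forall z, 0 <= c z) -> (forall x, 0 <= h x) ->
  (forall x, `|f x| <= B) -> (forall x, `|g x| <= M) ->
  cost_continuous c h f -> cost_continuous c h g ->
  cost_continuous c h (fun x => f x * g x).
Proof.
move=> c0 h0 fB gM cf cg e e0.
(* A point of [T] yields [0 <= B] and [0 <= M]; over an empty type the claim is vacuous. *)
have [[x0]|nT] := pselect (inhabited T); last first.
  by exists 1 => // x; exfalso; apply: nT; exists.
have B0 : 0 <= B by exact: le_trans (fB x0).
have M0 : 0 <= M by exact: le_trans (gM x0).
have S0 : 0 < B + M + 1 by rewrite ltr_wpDl// addr_ge0.
have [C C0 fC] := cf _ (divr_gt0 e0 S0).
have [D D0 gD] := cg _ (divr_gt0 e0 S0).
exists ((B + 1) * D + (M + 1) * C) => [|x y].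
  by rewrite addr_gt0// mulr_gt0// ltr_wpDl.
have -> : f x * g x - f y * g y = f x * (g x - g y) + g y * (f x - f y) by ring.
apply: (le_trans (ler_normD _ _)); rewrite !normrM.
apply: (@le_trans _ _ (B * (e / (B + M + 1) * (1 + h y) + D * c (x, y)) +
    M * (e / (B + M + 1) * (1 + h y) + C * c (x, y)))).
  by rewrite lerD// ler_pM.
have -> : B * (e / (B + M + 1) * (1 + h y) + D * c (x, y)) +
    M * (e / (B + M + 1) * (1 + h y) + C * c (x, y)) =
    (B + M) / (B + M + 1) * (e * (1 + h y)) + (B * D + M * C) * c (x, y) by ring.
apply: lerD.
  rewrite ler_piMl ?mulr_ge0 ?(ltW e0)// ?addr_ge0//.
  by rewrite ler_pdivrMr// mul1r lerDl.
rewrite ler_wpM2r//; apply: lerD.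
  by rewrite ler_wpM2r ?(ltW D0)// lerDl.
by rewrite ler_wpM2r ?(ltW C0)// lerDl.
Qed.

Section integral_convergence.
Context d (T : measurableType d) (R : realType)
  (mu_ : nat -> probability T R) (mu : probability T R).

Definition integral_cvg (F : T -> R) : Prop :=
  [/\ forall n, (mu_ n).-integrable setT (EFin \o F),
      mu.-integrable setT (EFin \o F) &
      \int[mu_ n]_z F z @[n --> \oo] --> \int[mu]_z F z].

Lemma integral_cvgD F G : integral_cvg F -> integral_cvg G ->
  integral_cvg (fun z => F z + G z).
Proof.
move=> [IF_ IF cF] [IG_ IG cG]; split.
- by move=> n; exact: integrable_RD.
- exact: integrable_RD.
- rewrite RintegralD// (_ : (fun n => _) = fun n => \int[mu_ n]_z F z + \int[mu_ n]_z G z).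
    exact: cvgD.
  by apply/funext => n; rewrite RintegralD//; [exact: IF_|exact: IG_].
Qed.

Lemma integral_cvgZ a F : integral_cvg F -> integral_cvg (fun z => a * F z).
Proof.
move=> [IF_ IF cF]; split.
- by move=> n; exact: integrable_Rscale.
- exact: integrable_Rscale.
- rewrite RintegralZl// (_ : (fun n => _) = fun n => a * \int[mu_ n]_z F z).
    by apply: cvgM => //; exact: cvg_cst.
  by apply/funext => n; rewrite RintegralZl//; exact: IF_.
Qed.

Lemma integral_cvgB F G : integral_cvg F -> integral_cvg G ->
  integral_cvg (fun z => F z - G z).
Proof.
move=> cF /(integral_cvgZ (-1)) cG; have := integral_cvgD cF cG.
by congr integral_cvg; apply/funext => z; rewrite mulN1r.
Qed.

(** The majorant [r] has convergent integrals as well, so smallness of its integral under [mu]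
    passes to [mu_ n] for large [n]. *)
Lemma integral_cvg_approx (F : T -> R) :
  (forall n, (mu_ n).-integrable setT (EFin \o F)) ->
  mu.-integrable setT (EFin \o F) ->
  (forall e : R, 0 < e -> exists G r, [/\ integral_cvg G, integral_cvg r,
    forall z, `|F z - G z| <= r z & \int[mu]_z r z <= e]) ->
  integral_cvg F.
Proof.
move=> IF_ IF H; split=> //; apply/cvgrPdist_le => e e0.
(* The integral of [r] is at most [e / 4] under [mu], hence [e / 2] under [mu_ n]; the last quarter
   is for the integrals of [G]. *)
have e4 : 0 < e / 4 by rewrite divr_gt0.
have [G [r [[IG_ IG cG] [Ir_ Ir cr] FGr re]]] := H _ e4.
have close (P : probability T R) : P.-integrable setT (EFin \o F) ->
    P.-integrable setT (EFin \o G) -> P.-integrable setT (EFin \o r) ->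
    `|\int[P]_z F z - \int[P]_z G z| <= \int[P]_z r z.
  move=> iF iG ir; rewrite -RintegralB//.
  have iD := integrable_RB iF iG.
  apply: (le_trans (le_normr_Rintegral measurableT iD)).
  by apply: le_Rintegral => //; exact: integrable_norm.
move/cvgrPdist_le : cG => /(_ _ e4); apply: filter_app.
move/cvgrPdist_le : cr => /(_ _ e4); apply: filterS => n.
have := close _ (IF_ n) (IG_ n) (Ir_ n); have := close _ IF IG Ir.
rewrite !ler_norml => /andP[h1 h2] /andP[h3 h4] /andP[h5 h6] /andP[h7 h8].
by apply/andP; split; lra.
Qed.

End integral_convergence.

Section marginal.
Context (R : realType) (Omega : completePMetricType R)
  (X : completeNormedModType R) (pi : probability (borel Omega) R)
  (mu : probability (borel Omega * borel X)%type R).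
Hypothesis hmu : fst_marginal pi mu.

Lemma ge0_integral_fst (f : borel Omega -> \bar R) : measurable_fun setT f ->
  (forall w, 0 <= f w)%E -> (\int[mu]_z f z.1 = \int[pi]_w f w)%E.
Proof.
move=> mf f0; rewrite [RHS](eq_measure_integral (pushforward mu fst)).
  by rewrite ge0_integral_pushforward.
by move=> A mA _; apply/esym; exact: hmu.
Qed.

Lemma integrable_fst (g : borel Omega -> R) : pi.-integrable setT (EFin \o g) ->
  mu.-integrable setT (EFin \o (fun z => g z.1)).
Proof.
move=> /integrableP[/measurable_EFinP mg ig]; apply/integrableP; split.
  by apply/measurable_EFinP; exact: (measurableT_comp mg measurable_fst).
have mg' : measurable_fun setT (fun x => `|(g x)%:E|%E).
  by apply: measurableT_comp => //; exact/measurable_EFinP.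
by rewrite (ge0_integral_fst mg').
Qed.

Lemma ge0_Rintegral_fst (g : borel Omega -> R) : measurable_fun setT g ->
  (forall w, 0 <= g w) -> \int[mu]_z g z.1 = \int[pi]_w g w.
Proof.
move=> mg g0; congr fine.
have mg' : measurable_fun setT (fun x => (g x)%:E) by exact/measurable_EFinP.
by rewrite -(ge0_integral_fst mg')// => w; rewrite lee_fin.
Qed.

End marginal.

(** * The cost on the product space *)

Section product_cost.
Context (R : realType) (Omega : completePMetricType R) (sepOmega : separable Omega)
  (X : completeNormedModType R) (sepX : separable X) (p : R) (p1 : 1 <= p).

Let p0 : 0 < p. Proof. by rewrite (lt_le_trans ltr01). Qed.

Definition proddist_pow (q : (borel Omega * borel X) * (borel Omega * borel X)) : R :=
  @proddist R Omega X p q.1 q.2 `^ p.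

Lemma proddist_powE q : proddist_pow q =
  @basedist R Omega q.1.1 q.2.1 `^ p + normdist_pow p (q.1.2, q.2.2).
Proof.
rewrite /proddist_pow /proddist -powRrM mulVf ?gt_eqF// powRr1//.
by rewrite addr_ge0// powR_ge0.
Qed.

Lemma proddist_pow_ge0 q : 0 <= proddist_pow q. Proof. exact: powR_ge0. Qed.

Lemma measurable_proddist_pow : measurable_fun setT proddist_pow.
Proof.
rewrite (_ : proddist_pow = fun q => @basedist R Omega q.1.1 q.2.1 `^ p +
    normdist_pow p (q.1.2, q.2.2)); last by apply/funext => q; exact: proddist_powE.
apply: measurable_funD.
  apply: (measurableT_comp (measurable_powR p)).
  apply: (measurableT_comp (measurable_basedist sepOmega)
    (g := fun q : (borel Omega * borel X) * (borel Omega * borel X) => (q.1.1, q.2.1))).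
  apply/measurable_fun_pairP; split.
    exact: (measurableT_comp measurable_fst measurable_fst).
  exact: (measurableT_comp measurable_fst measurable_snd).
apply: (measurableT_comp (measurable_normdist_pow p sepX)
  (g := fun q : (borel Omega * borel X) * (borel Omega * borel X) => (q.1.2, q.2.2))).
apply/measurable_fun_pairP; split.
  exact: (measurableT_comp measurable_snd measurable_fst).
exact: (measurableT_comp measurable_snd measurable_snd).
Qed.

Let h2 (z : borel Omega * borel X) : R := norm_pow p z.2.

Lemma cost_continuous_snd (f : borel X -> R) :
  cost_continuous (normdist_pow p) (norm_pow p) f ->
  cost_continuous proddist_pow h2 (fun z => f z.2).
Proof.
move=> hf e /hf[C C0 fC]; exists C => // x y.
apply: (le_trans (fC x.2 y.2)); rewrite lerD2l ler_wpM2l ?(ltW C0)//.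
by rewrite proddist_powE lerDr powR_ge0.
Qed.

Lemma cost_continuous_fst (g : borel Omega -> R) (L : R) :
  (forall x y, `|g x - g y| <= L * @basedist R Omega x y) ->
  cost_continuous proddist_pow h2 (fun z => g z.1).
Proof.
move=> gL; apply: (lipschitz_cost_continuous (h := h2) (fun z => norm_pow_ge0 p z.2)
  (p := p) (L := L) (dist := fun z w => @basedist R Omega z.1 w.1)) => //.
- by move=> x y; exact: basedist_ge0.
- by move=> x y; rewrite proddist_powE lerDl powR_ge0.
Qed.

End product_cost.

(** * From transport to convergence of product integrals *)

Section weak_convergence.
Context (R : realType) (Omega : completePMetricType R) (sepOmega : separable Omega)
  (X : completeNormedModType R) (sepX : separable X)
  (pi : probability (borel Omega) R) (p : R) (p1 : 1 <= p).
Variables (mu_ : nat -> probability (borel Omega * borel X)%type R)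
  (mu : probability (borel Omega * borel X)%type R).
Hypotheses (hmu_ : forall n, fst_marginal_moment pi p (mu_ n))
  (hmu : fst_marginal_moment pi p mu).

Let T : Type := (borel Omega * borel X)%type.
Let h : borel X -> R := norm_pow p.
Let h2 (z : borel Omega * borel X) : R := h z.2.
Let c2 := @proddist_pow R Omega X p.
Let h0 : forall x, 0 <= h x. Proof. exact: norm_pow_ge0. Qed.
Let mh : measurable_fun setT h. Proof. exact: measurable_norm_pow. Qed.
Let mh2 : measurable_fun setT h2.
Proof. exact: (measurableT_comp mh measurable_snd). Qed.
Let muh_ n := fst_marginal_moment_lty p1 (hmu_ n).
Let muh := fst_marginal_moment_lty p1 hmu.

Let msnd (f : borel X -> R) : measurable_fun setT f ->
  measurable_fun setT (fun z : borel Omega * borel X => f z.2).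
Proof. by move=> mf; exact: (measurableT_comp mf measurable_snd). Qed.

Let mfst (f : borel Omega -> R) : measurable_fun setT f ->
  measurable_fun setT (fun z : borel Omega * borel X => f z.1).
Proof. by move=> mf; exact: (measurableT_comp mf measurable_fst). Qed.

Let growth_int (F : borel Omega * borel X -> R) (b : R) : measurable_fun setT F -> (forall z, `|F z| <= b * (1 + h2 z)) ->
  (forall n, (mu_ n).-integrable setT (EFin \o F)) /\ mu.-integrable setT (EFin \o F).
Proof.
move=> mF Fb; split => [n|].
  exact: (growth_integrable mh2 (fun z => h0 z.2) (muh_ n) mF Fb).
exact: (growth_integrable mh2 (fun z => h0 z.2) muh mF Fb).
Qed.

Section from_transport.
Hypothesis cost0 : (transport_cost c2 (mu_ n) mu @[n --> \oo] --> 0)%E.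

Let costE e : 0 < e -> \forall n \near \oo, (transport_cost c2 (mu_ n) mu <= e%:E)%E.
Proof.
move: e; apply/ge0_cvge0P => // n; apply: transport_cost_ge0.
exact: proddist_pow_ge0.
Qed.

Lemma cost_continuous_integral_cvg (F : borel Omega * borel X -> R) (b : R) : measurable_fun setT F ->
  cost_continuous c2 h2 F -> (forall z, `|F z| <= b * (1 + h2 z)) ->
  integral_cvg mu_ mu F.
Proof.
move=> mF cF Fb; have [I_ I] := growth_int mF Fb; split => //.
apply/cvgrPdist_le => e e0.
pose M := fine (\int[mu]_z (h2 z)%:E).
have ME : (\int[mu]_z (h2 z)%:E = M%:E)%E.
  by rewrite fineK// ge0_fin_numE ?muh//; apply: integral_ge0 => z _; rewrite lee_fin h0.
have M0 : 0 <= M by apply/fine_ge0/integral_ge0 => z _; rewrite lee_fin h0.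
have d0 : 0 < e / 2 / (1 + M) by rewrite !divr_gt0// ltr_pwDl.
have [C C0 hC] := cF _ d0.
have := costE (divr_gt0 (divr_gt0 e0 (ltr0n R 2)) C0); apply: filterS => n hn.
have := Rintegral_diff_le_transport_cost (mu_ n) mu
  (@proddist_pow_ge0 R Omega X p)
  (measurable_proddist_pow sepOmega sepX p1) (fun z => h0 z.2) mh2 mF Fb d0 C0 hC.
rewrite ME distrC -lee_fin => /le_trans; apply.
rewrite -EFinD -EFinM divfK; last by rewrite gt_eqF// ltr_pwDl.
apply: (@le_trans _ _ ((e / 2)%:E + C%:E * (e / 2 / C)%:E)%E).
  by rewrite leeD2l// lee_wpmul2l// lee_fin ltW.
by rewrite -EFinM -EFinD lee_fin [C * _]mulrC divfK ?gt_eqF// -splitr.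
Qed.

(** [L^1] induction on [g], starting from bounded Lipschitz functions, for which the product is
    cost-continuous. As [f] is bounded, the error is at most [B] times the [L^1(pi)] distance of the
    factors, the same for all [n] because every first marginal is [pi]. *)
Lemma bounded_product_integral_cvg (f : X -> R) B (g : borel Omega -> R) :
  continuous f -> cost_continuous (normdist_pow p) h f ->
  (forall x, `|f x| <= B) -> pi.-integrable setT (EFin \o g) ->
  integral_cvg mu_ mu (fun z => f z.2 * g z.1).
Proof.
move=> cf ccf fB.
have B0 : 0 <= B by exact: le_trans (fB 0).
have mf : measurable_fun setT (f : borel X -> R) by exact: continuous_borel_measurable.
have Ifg (P : probability (borel Omega * borel X)%type R) (g' : borel Omega -> R) :
    fst_marginal pi P -> pi.-integrable setT (EFin \o g') ->
    P.-integrable setT (EFin \o (fun z => f z.2 * g' z.1)).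
  move=> hP Ig; have IP := integrable_fst hP Ig.
  have mg : measurable_fun setT g' by apply/measurable_EFinP; exact: measurable_int Ig.
  apply: (@le_integrable _ _ _ P _ measurableT _ _ _ _ (integrable_Rscale B IP)).
    by apply/measurable_EFinP/measurable_funM; [exact: msnd|exact: mfst].
  by move=> z _ /=; rewrite lee_fin !normrM ler_pM// (le_trans (fB _))// ler_norm.
have [hm_ hm] : (forall n, fst_marginal pi (mu_ n)) /\ fst_marginal pi mu.
  by split => [n|]; [case: (hmu_ n)|case: hmu].
pose Q (g : borel Omega -> R) := pi.-integrable setT (EFin \o g) /\
  integral_cvg mu_ mu (fun z => f z.2 * g z.1).
suff: forall g : borel Omega -> R, pi.-integrable setT (EFin \o g) -> Q g.
  by move=> H /H[].
apply: L1_lipschitz_induction.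
- move=> g1 g2 [I1 c1] [I2 c2']; split; first exact: integrable_RD.
  have := integral_cvgD c1 c2'; congr integral_cvg.
  by apply/funext => z; rewrite mulrDr.
- move=> a g1 [I1 c1]; split; first exact: integrable_Rscale.
  have := integral_cvgZ a c1; congr integral_cvg.
  by apply/funext => z; rewrite mulrCA.
- move=> g1 L M g1L g1M.
  have mg1 : measurable_fun setT g1.
    apply: continuous_borel_measurable; exact: basedist_lipschitz_continuous g1L.
  split; first exact: bounded_integrable g1M.
  apply: (@cost_continuous_integral_cvg _ (B * M)).
  + by apply: measurable_funM; [exact: msnd|exact: mfst].
  + apply: (@cost_continuousM _ _ _ _ (fun z : T => f z.2) (fun z : T => g1 z.1) B M) => //.
    * exact: proddist_pow_ge0.
    * by move=> z; exact: h0.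
    * exact: cost_continuous_snd.
    * exact: cost_continuous_fst g1L.
  + have M0 : 0 <= M by exact: le_trans (g1M point).
    move=> z; rewrite normrM (@le_trans _ _ (B * M))//; first by rewrite ler_pM.
    by rewrite ler_peMr ?mulr_ge0// lerDl h0.
- move=> g1 Ig1 H; split => //; apply: integral_cvg_approx.
  + by move=> n; exact: Ifg.
  + exact: Ifg.
  move=> e e0; have B1 : 0 < B + 1 by rewrite ltr_wpDl.
  have [g2 [[_ cg2] Ig2 ge]] := H _ (divr_gt0 e0 B1).
  have ID := integrable_RB Ig1 Ig2.
  have IN := integrable_norm ID.
  have mN : measurable_fun setT (fun w => `|g1 w - g2 w|).
    by apply/measurable_EFinP; exact: measurable_int IN.
  have EN P : fst_marginal pi P -> \int[P]_z `|g1 z.1 - g2 z.1| = \int[pi]_w `|g1 w - g2 w|.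
    by move=> hP; apply: (ge0_Rintegral_fst hP mN).
  exists (fun z => f z.2 * g2 z.1), (fun z => B * `|g1 z.1 - g2 z.1|); split => //.
  + apply: integral_cvgZ; split.
    * by move=> n; exact: (integrable_fst (hm_ n) IN).
    * exact: (integrable_fst hm IN).
    * rewrite EN// (_ : (fun n => _) = fun=> \int[pi]_w `|g1 w - g2 w|).
        exact: cvg_cst.
      by apply/funext => n; rewrite EN//.
  + by move=> z; rewrite -mulrBr normrM ler_wpM2r.
  + rewrite RintegralZl//; last exact: (integrable_fst hm IN).
    rewrite EN//; move: ge; rewrite integral_EFin_Rintegral// lee_fin => ge.
    apply: (@le_trans _ _ (B * (e / (B + 1)))); first by rewrite ler_wpM2l.
    by rewrite mulrA ler_pdivrMr// mulrC ler_wpM2l ?(ltW e0)// lerDl.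
Qed.

(** Clipping [f] at height [m] reduces to the bounded case. The error is at most [M] times the
    excess over [m] of the weight [b * (1 + h)]; this excess is cost-continuous, so its integrals
    converge, and small under [mu] for large [m]. *)
Lemma product_integral_cvg (f : X -> R) b (g : borel Omega -> R) M :
  continuous f -> cost_continuous (normdist_pow p) h f ->
  (forall x, `|f x| <= b * (1 + h x)) -> measurable_fun setT g ->
  (forall w, `|g w| <= M) -> integral_cvg mu_ mu (fun z => f z.2 * g z.1).
Proof.
move=> cf ccf fb mg gM.
have M0 : 0 <= M by exact: le_trans (gM point).
have mf : measurable_fun setT (f : borel X -> R) by exact: continuous_borel_measurable.
have Ig := bounded_integrable pi mg gM.
have [I_ I] : (forall n, (mu_ n).-integrable setT (EFin \o (fun z => f z.2 * g z.1))) /\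
    mu.-integrable setT (EFin \o (fun z => f z.2 * g z.1)).
  apply: (@growth_int _ (b * M)).
    by apply: measurable_funM; [exact: msnd|exact: mfst].
  by move=> z; rewrite normrM mulrAC ler_pM.
apply: integral_cvg_approx => // e e0.
pose clip (m : nat) (a : R) : R := Num.max (- m%:R) (Num.min a m%:R).
pose exc (m : nat) (a : R) : R := Num.max 0 (a - m%:R).
have clip_contr m a a' : `|clip m a - clip m a'| <= `|a - a'|.
  exact: le_trans (maxr_contraction _ _ _) (minr_contraction _ _ _).
have exc_contr m a a' : `|exc m a - exc m a'| <= `|a - a'|.
  apply: le_trans (maxr_contraction _ _ _) _.
  by rewrite opprB addrA subrK.
have clip_bd m a : `|clip m a| <= m%:R.
  rewrite ler_norml /clip ge_max le_max lexx/= ge_min lexx orbT andbT.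
  by rewrite (le_trans _ (ler0n _ m))// oppr_le0 ler0n.
have clipB m a a' : `|a| <= a' -> `|a - clip m a| <= exc m a'.
  exact: clip_error.
pose w (x : borel X) : R := b * (1 + h x).
have w0 x : 0 <= w x by exact: le_trans (fb x).
have mw : measurable_fun setT w.
  by apply: measurable_funM => //; exact: measurable_funD.
have ccw : cost_continuous (normdist_pow p) h w.
  apply: cost_continuousZ; apply: cost_continuousD.
    by apply: cost_continuous_cst => //; exact: normdist_pow_ge0.
  move=> e' e'0; have [C C0 hC] := norm_powR_diff_le X p1 e'0; exists C => // x y.
  by apply: (le_trans (hC x y)); rewrite lerD2r ler_wpM2l ?(ltW e'0)// lerDr.
have mexc m : measurable_fun setT (fun x : borel X => exc m (w x)).
  by apply: measurable_maxr => //; exact: measurable_funB.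
have exc0 m x : 0 <= exc m (w x) by rewrite le_max lexx.
have excw m x : exc m (w x) <= w x.
  by rewrite /exc ge_max w0 gerBl ler0n.
have excc m : integral_cvg mu_ mu (fun z => exc m (w z.2)).
  apply: (@cost_continuous_integral_cvg _ b).
  - exact: (msnd (mexc m)).
  - apply: (@cost_continuous_snd R Omega X p p1 (fun x => exc m (w x))).
    exact: cost_continuous_contraction (exc_contr m) ccw.
  - by move=> z; rewrite ger0_norm//; exact: excw.
have M1 : 0 < M + 1 by rewrite ltr_wpDl.
have [_ Iw] := growth_int (msnd mw) (b := b) ltac:(by move=> z; rewrite ger0_norm//; exact: w0).
have : \forall m \near \oo, (\int[mu]_z (exc m (w z.2))%:E <= (e / (M + 1))%:E)%E.
  apply: (dominated_integral_small _ _ Iw).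
  - by move=> m; exact: (msnd (mexc m)).
  - by move=> m z; rewrite exc0 excw.
  - move=> z; apply: cvg_near_cst.
    have : \forall m \near \oo, w z.2 <= m%:R by exact: nbhs_infty_ger.
    by apply: filterS => m wm; rewrite /exc; apply/max_idPl; rewrite subr_le0.
  - exact: divr_gt0.
move=> [m _ /(_ m (leqnn m))] hm.
exists (fun z => clip m (f z.2) * g z.1), (fun z => M * exc m (w z.2)); split.
- apply: (bounded_product_integral_cvg (f := fun x => clip m (f x)) (B := m%:R)) => //.
    move=> x; apply: (@continuous_max R X); first exact: cst_continuous.
    by apply: (@continuous_min R X); [exact: cf|exact: cst_continuous].
  exact: cost_continuous_contraction (clip_contr m) ccf.
- exact: integral_cvgZ.
- by move=> z; rewrite -mulrBl normrM mulrC ler_pM// clipB.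
- have [_ Iexc _] := excc m.
  rewrite RintegralZl//; move: hm; rewrite integral_EFin_Rintegral// lee_fin => hm.
  apply: (@le_trans _ _ (M * (e / (M + 1)))); first by rewrite ler_wpM2l.
  by rewrite mulrA ler_pdivrMr// mulrC ler_wpM2l ?(ltW e0)// lerDl.
Qed.

(** The lower bracketing function replaces [phi] at the price of [M] times the gap, which is a
    difference of functions already treated. *)
Lemma C0p_product_integral_cvg (phi : X -> R) (g : borel Omega -> R) M :
  C0p p phi -> measurable_fun setT g -> (forall w, `|g w| <= M) ->
  integral_cvg mu_ mu (fun z => phi z.2 * g z.1).
Proof.
move=> Cphi mg gM; have [cphi _] := Cphi.
have M0 : 0 <= M by exact: le_trans (gM point).
have [b0 b00 phib] := C0p_growth p1 Cphi.
have mphi : measurable_fun setT (phi : borel X -> R) by exact: continuous_borel_measurable.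
have [I_ I] : (forall n, (mu_ n).-integrable setT (EFin \o (fun z => phi z.2 * g z.1))) /\
    mu.-integrable setT (EFin \o (fun z => phi z.2 * g z.1)).
  apply: (@growth_int _ (b0 * M)).
    by apply: measurable_funM; [exact: msnd|exact: mfst].
  by move=> z; rewrite normrM mulrAC ler_pM//; exact: phib.
apply: integral_cvg_approx => // e e0.
have [b [l [u [hl hu lu lu0]]]] := C0p_bracket p1 Cphi.
have cvg1 (f : X -> R) : continuous f -> cost_continuous (normdist_pow p) h f ->
    (forall x, `|f x| <= b * (1 + h x)) -> integral_cvg mu_ mu (fun z => f z.2).
  move=> cf ccf fb; have := product_integral_cvg cf ccf fb (g := fun=> 1) (M := `|1|)
    (measurable_cst _) (fun=> lexx _).
  by congr integral_cvg; apply/funext => z; rewrite mulr1.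
have cgap m : integral_cvg mu_ mu (fun z => u m z.2 - l m z.2).
  have [cl ccl bl] := hl m; have [cu ccu bu] := hu m.
  by apply: integral_cvgB; exact: cvg1.
have M1 : 0 < M + 1 by rewrite ltr_wpDl.
have Iw : mu.-integrable setT (EFin \o (fun z => 2 * `|b| * (1 + h2 z))).
  have [] // := @growth_int (fun z => 2 * `|b| * (1 + h2 z)) (2 * `|b|).
    by apply: measurable_funM => //; exact: measurable_funD.
  by move=> z; rewrite ger0_norm// mulr_ge0// ?mulr_ge0// addr_ge0// h0.
have : \forall m \near \oo, (\int[mu]_z (u m z.2 - l m z.2)%:E <= (e / (M + 1))%:E)%E.
  apply: (dominated_integral_small _ _ Iw).
  - move=> m; have [cl _ _] := hl m; have [cu _ _] := hu m.
    by apply: measurable_funB; apply: msnd; exact: continuous_borel_measurable.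
  - move=> m z; have [_ _ /(_ z.2) bl] := hl m; have [_ _ /(_ z.2) bu] := hu m.
    have /andP[h1 h3] := lu m z.2; rewrite subr_ge0 (le_trans h1 h3)/=.
    apply: (le_trans (ler_norm _)); apply: (le_trans (ler_normB _ _)).
    apply: (@le_trans _ _ (`|b| * (1 + h2 z) + `|b| * (1 + h2 z))); last by lra.
    have hb : b * (1 + h2 z) <= `|b| * (1 + h2 z).
      by rewrite ler_wpM2r ?ler_norm// addr_ge0// h0.
    by apply: lerD; [apply: le_trans bu hb|apply: le_trans bl hb].
  - by move=> z; exact: lu0.
  - exact: divr_gt0.
move=> [m _ /(_ m (leqnn m))] hm.
exists (fun z => l m z.2 * g z.1), (fun z => M * (u m z.2 - l m z.2)); split.
- have [cl ccl bl] := hl m; exact: (product_integral_cvg cl ccl bl mg gM).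
- exact: integral_cvgZ.
- move=> z; have /andP[h1 h3] := lu m z.2.
  rewrite -mulrBl normrM mulrC ler_pM// ger0_norm ?subr_ge0//.
  by rewrite lerB.
- have [_ Igap _] := cgap m.
  rewrite RintegralZl//; move: hm; rewrite integral_EFin_Rintegral// lee_fin => hm.
  apply: (@le_trans _ _ (M * (e / (M + 1)))); first by rewrite ler_wpM2l.
  by rewrite mulrA ler_pdivrMr// mulrC ler_wpM2l ?(ltW e0)// lerDl.
Qed.

End from_transport.

End weak_convergence.

Section Linfty.
Context d (T : measurableType d) (R : realType) (P : probability T R).

Lemma bounded_Lfun_infty (g : T -> R) (M : R) : measurable_fun setT g ->
  (forall x, `|g x| <= M) -> g \in Lfun P +oo%E.
Proof.
move=> mg gM; rewrite inE; apply/andP; split; rewrite inE//=.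
rewrite /finite_norm unlock /= probability_setT lte01.
apply: (@le_lt_trans _ _ M%:E); last exact: ltry.
by apply/ess_supP; apply: aeW => x; rewrite /= lee_fin.
Qed.

Lemma Lfun_infty_measurable (g : T -> R) : g \in Lfun P +oo%E ->
  measurable_fun setT g.
Proof. by rewrite inE => /andP[]; rewrite inE. Qed.

Lemma Lfun_infty_ae_bounded (g : T -> R) : g \in Lfun P +oo%E ->
  exists M, {ae P, forall x, `|g x| <= M}.
Proof.
rewrite inE => /andP[_]; rewrite inE /= /finite_norm unlock /= probability_setT lte01.
by move=> gy; exact: (@ess_supr_bounded _ _ _ P (fun x => `|g x|) gy).
Qed.

End Linfty.

Section weak_fibre_convergence.
Context (R : realType) (Omega : completePMetricType R)
  (X : completeNormedModType R) (pi : probability (borel Omega) R)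
  (p : R) (p1 : 1 <= p).
Variables (mu_ : nat -> probability (borel Omega * borel X)%type R)
  (mu : probability (borel Omega * borel X)%type R).
Hypotheses (hmu_ : forall n, fst_marginal_moment pi p (mu_ n))
  (hmu : fst_marginal_moment pi p mu).
Variables (k_ : nat -> R.-pker borel Omega ~> borel X)
  (k : R.-pker borel Omega ~> borel X).
Hypotheses (hk_ : forall n, disintegration pi (mu_ n) (k_ n))
  (hk : disintegration pi mu k).

(** An essentially bounded multiplier equals a bounded one almost everywhere, and pairings with
    bounded ones are integrals of products under [mu_ n] and [mu]. *)
Lemma weak_cvg_fibre_intP (phi : X -> R) : C0p p phi ->
  weak_cvg_L1 pi (fun n => fibre_int phi (k_ n)) (fibre_int phi k) <->
  forall (g : borel Omega -> R) M, measurable_fun setT g ->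
    (forall w, `|g w| <= M) ->
    \int[mu_ n]_z (phi z.2 * g z.1) @[n --> \oo] --> \int[mu]_z (phi z.2 * g z.1).
Proof.
move=> Cphi; have [cphi _] := Cphi.
have [b b0 phib] := C0p_growth p1 Cphi.
have mphi : measurable_fun setT (phi : borel X -> R) by exact: continuous_borel_measurable.
have h0 := @norm_pow_ge0 R X p.
have mh := @measurable_norm_pow R X p p1.
have muh_ n := fst_marginal_moment_lty p1 (hmu_ n).
have muh := fst_marginal_moment_lty p1 hmu.
have In n := integrable_fibre_int (hk_ n) h0 mh (muh_ n) mphi phib.
have Ik := integrable_fibre_int hk h0 mh muh mphi phib.
have E_ n (g : borel Omega -> R) M : measurable_fun setT g -> (forall w, `|g w| <= M) ->
    \int[pi]_w (fibre_int phi (k_ n) w * g w) = \int[mu_ n]_z (phi z.2 * g z.1).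
  exact: (Rintegral_fibre_intM (hk_ n) h0 mh (muh_ n) mphi phib).
have E (g : borel Omega -> R) M : measurable_fun setT g -> (forall w, `|g w| <= M) ->
    \int[pi]_w (fibre_int phi k w * g w) = \int[mu]_z (phi z.2 * g z.1).
  exact: (Rintegral_fibre_intM hk h0 mh muh mphi phib).
split => [[_ _ H] g M mg gM|H].
  have := H _ (bounded_Lfun_infty pi mg gM); rewrite (E _ _ mg gM).
  rewrite (_ : (fun n => \int[pi]_w (fibre_int phi (k_ n) w * g w)) =
    fun n => \int[mu_ n]_z (phi z.2 * g z.1))//.
  by apply/funext => n; exact: E_ gM.
split; [by move=> n; apply/Lfun1_integrable; exact: In|exact/Lfun1_integrable|].
move=> g gL; have mg := Lfun_infty_measurable gL.
have [M gM] := Lfun_infty_ae_bounded gL.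
(* Clipping at [|M|] keeps the interval nonempty whatever the sign of [M]. *)
pose g' w := Num.max (- `|M|) (Num.min (g w) `|M|).
have mg' : measurable_fun setT g'.
  by apply: measurable_maxr => //; exact: measurable_minr.
have g'M w : `|g' w| <= `|M|.
  rewrite ler_norml /g' ge_max le_max lexx/= ge_min lexx orbT andbT.
  by rewrite (le_trans _ (normr_ge0 M))// oppr_le0.
have gg' : {ae pi, forall w, g w = g' w}.
  apply: filterS gM => w gw; have := le_trans gw (ler_norm M).
  rewrite ler_norml => /andP[h1 h2].
  by rewrite /g'; apply/esym; rewrite (min_idPl h2); apply/max_idPr.
have swap (f : borel Omega -> R) : measurable_fun setT f ->
    \int[pi]_w (f w * g w) = \int[pi]_w (f w * g' w).
  move=> mf; congr fine; apply: ae_eq_integral => //.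
  - by apply/measurable_EFinP; exact: measurable_funM.
  - by apply/measurable_EFinP; exact: measurable_funM.
  - by apply: filterS gg' => w /= -> _.
rewrite (swap _ (measurable_fibre_int k mphi)) (E _ _ mg' g'M).
rewrite (_ : (fun n => _) = fun n => \int[mu_ n]_z (phi z.2 * g' z.1)).
  exact: H g'M.
apply/funext => n; rewrite (swap _ (measurable_fibre_int (k_ n) mphi)).
exact: E_ g'M.
Qed.

End weak_fibre_convergence.

(** * From weak convergence to transport *)

Section weak_implies_transport.
Context (R : realType) (Omega : completePMetricType R) (sepOmega : separable Omega)
  (X : completeNormedModType R) (sepX : separable X)
  (pi : probability (borel Omega) R) (p : R) (p1 : 1 <= p).
Hypothesis hpi : finite_moment (@basedist R Omega) p pi.
Variables (mu_ : nat -> probability (borel Omega * borel X)%type R)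
  (mu : probability (borel Omega * borel X)%type R).
Hypotheses (hmu_ : forall n, fst_marginal_moment pi p (mu_ n))
  (hmu : fst_marginal_moment pi p mu).

Let h : borel X -> R := norm_pow p.
Let c2 := @proddist_pow R Omega X p.
Let h0 : forall x, 0 <= h x. Proof. exact: norm_pow_ge0. Qed.
Let mh : measurable_fun setT h. Proof. exact: measurable_norm_pow. Qed.
Let muh_ n := fst_marginal_moment_lty p1 (hmu_ n).
Let muh := fst_marginal_moment_lty p1 hmu.
Let p0 : 0 < p. Proof. by rewrite (lt_le_trans ltr01). Qed.

Let msnd (f : borel X -> R) : measurable_fun setT f ->
  measurable_fun setT (fun z : borel Omega * borel X => f z.2).
Proof. by move=> mf; exact: (measurableT_comp mf measurable_snd). Qed.

Let mfst (f : borel Omega -> R) : measurable_fun setT f ->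
  measurable_fun setT (fun z : borel Omega * borel X => f z.1).
Proof. by move=> mf; exact: (measurableT_comp mf measurable_fst). Qed.

(** The scheme is that of the fibred distance, with product cells. The tail is what changes: it
    mixes both variables and contains the unbounded [h1] on [Omega], so it is not a single
    admissible product and has to be decomposed. *)
Lemma weak_cvg_transport :
  (forall phi : X -> R, C0p p phi -> forall (g : borel Omega -> R) M,
    measurable_fun setT g -> (forall w, `|g w| <= M) ->
    \int[mu_ n]_z (phi z.2 * g z.1) @[n --> \oo] --> \int[mu]_z (phi z.2 * g z.1)) ->
  (transport_cost c2 (mu_ n) mu @[n --> \oo] --> 0)%E.
Proof.
move=> weak; apply/ge0_cvge0P.
  by move=> n; apply: transport_cost_ge0; exact: proddist_pow_ge0.
have [w0 hw0] := hpi.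
have [s hs] := normdist_dense_sequence sepX.
have [t ht] := basedist_dense_sequence sepOmega.
move=> e e0; pose K : R := 2 `^ p.
have K0 : 0 < K by exact: powR_gt0.
pose e1 := e / 5; have e10 : 0 < e1 by rewrite divr_gt0.
pose dd := e1 / K; have dd0 : 0 < dd by rewrite divr_gt0.
(* Half of [e1] for each factor, as the product cost is the sum of the two component costs. *)
pose eta := (e1 / 2) `^ p^-1 / 4.
have eta0 : 0 < eta by rewrite divr_gt0// powR_gt0// divr_gt0.
have eta4 : (2 * eta + 2 * eta) `^ p = e1 / 2.
  have -> : 2 * eta + 2 * eta = (e1 / 2) `^ p^-1 by rewrite /eta; lra.
  by rewrite -powRrM mulVf ?gt_eqF// powRr1// divr_ge0// ltW.
have mono x y : 0 <= x -> x <= y -> x `^ p <= y `^ p.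
  by move=> x0 xy; rewrite ge0_ler_powR ?nnegrE ?(ltW p0)//; exact: le_trans xy.
pose nd := @normdist R X; pose bd := @basedist R Omega.
pose h1 (w : borel Omega) : R := bd w w0 `^ p.
have h10 w : 0 <= h1 w by exact: powR_ge0.
have mh1 : measurable_fun setT h1.
  apply: (measurableT_comp (measurable_powR p)); exact: measurable_basedist_point.
pose hh (z : borel Omega * borel X) : R := h1 z.1 + h z.2.
have hh0 z : 0 <= hh z by rewrite addr_ge0.
have mhh : measurable_fun setT hh by apply: measurable_funD; [exact: mfst|exact: msnd].
have cnd i : continuous (fun x : X => nd x (s i)) by exact: continuous_normdist.
have mbd i : measurable_fun setT (fun w : borel Omega => bd w (t i)).
  exact: measurable_basedist_point.
pose ps i : borel X -> R := cell nd s eta i.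
pose qs i : borel Omega -> R := cell bd t eta i.
pose cv J : borel X -> R := bump_cover nd s eta J.
pose dv J : borel Omega -> R := bump_cover bd t eta J.
have mps i : measurable_fun setT (ps i).
  by apply: continuous_borel_measurable; exact: continuous_cell.
have ccv J : continuous (cv J : X -> R) by exact: continuous_bump_cover.
have mcv J : measurable_fun setT (cv J) by apply: continuous_borel_measurable.
have mqs i : measurable_fun setT (qs i) by exact: measurable_cell.
have mdv J : measurable_fun setT (dv J) by exact: measurable_bump_cover.
have ps0 i x : 0 <= ps i x by exact: cell_ge0.
have qs0 i x : 0 <= qs i x by exact: cell_ge0.
have cv0 J x : 0 <= cv J x by exact: bump_cover_ge0.
have cv1 J x : cv J x <= 1 by exact: bump_cover_le1.
have dv0 J x : 0 <= dv J x by exact: bump_cover_ge0.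
have dv1 J x : dv J x <= 1 by exact: bump_cover_le1.
have cell1 (T : Type) (ds : T -> T -> R) (u : nat -> T) i x : cell ds u eta i x <= 1.
  by rewrite lerBlDr (le_trans (bump_cover_le1 _ _ _ _ _))// lerDl bump_cover_ge0.
have C0ps i : C0p p (ps i : X -> R).
  split; first exact: continuous_cell.
  exists 1, 0; split => // x; rewrite mul1r ger0_norm//.
  by apply: (@le_trans _ _ 1); [exact: cell1|rewrite lerDl powR_ge0].
have C0cv J : C0p p (cv J : X -> R).
  split; first exact: ccv.
  exists 1, 0; split => // x; rewrite mul1r ger0_norm//.
  by apply: (@le_trans _ _ 1) => //; rewrite lerDl powR_ge0.
have C0h : C0p p (h : X -> R).
  split; first exact: continuous_norm_powR.
  exists 1, 0; split => // x; rewrite mul1r subr0 ger0_norm ?powR_ge0//.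
  by rewrite lerDr.
have C0cvh J : C0p p (fun x : X => cv J x * h x).
  split.
    by move=> x; apply: (@continuousM R X); [exact: ccv|exact: continuous_norm_powR].
  exists 1, 0; split => // x; rewrite mul1r subr0 ger0_norm ?mulr_ge0//.
  by apply: (@le_trans _ _ (h x)); [rewrite ler_piMl|rewrite lerDr].
pose rest J z : R := (1 - dv J z.1 * cv J z.2) * hh z.
have dc0 J z : 0 <= dv J z.1 * cv J z.2 by rewrite mulr_ge0.
have dc1 J z : dv J z.1 * cv J z.2 <= 1.
  by apply: le_trans (cv1 J z.2); rewrite ler_piMl.
have rest0 J z : 0 <= rest J z by rewrite mulr_ge0// subr_ge0.
have resth J z : rest J z <= hh z by rewrite ler_piMl// gerBl.
have mrest J : measurable_fun setT (rest J).
  apply: measurable_funM => //; apply: measurable_funB => //.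
  by apply: measurable_funM; [exact: mfst|exact: msnd].
have Ih1 : pi.-integrable setT (EFin \o h1).
  apply/integrableP; split; first exact/measurable_EFinP.
  by under eq_integral do rewrite /= ger0_norm//.
have Ih (P : probability (borel Omega * borel X)%type R) :
    fst_marginal_moment pi p P -> P.-integrable setT (EFin \o (fun z => h z.2)).
  move=> hP; apply: (growth_integrable (b := 1) (msnd mh) (fun z => h0 z.2)
    (fst_marginal_moment_lty p1 hP) (msnd mh)) => z.
  by rewrite mul1r ger0_norm// lerDr.
have If (P : probability (borel Omega * borel X)%type R) :
    fst_marginal_moment pi p P -> P.-integrable setT (EFin \o (fun z => h1 z.1)).
  by move=> [hP _]; exact: (integrable_fst hP Ih1).
have Ihh (P : probability (borel Omega * borel X)%type R) :
    fst_marginal_moment pi p P -> P.-integrable setT (EFin \o hh).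
  by move=> hP; apply: integrable_RD; [exact: If|exact: Ih].
have dom (P : probability (borel Omega * borel X)%type R) (F : borel Omega * borel X -> R) :
    fst_marginal_moment pi p P -> measurable_fun setT F ->
    (forall z, 0 <= F z) -> (forall z, F z <= hh z) ->
    P.-integrable setT (EFin \o F).
  move=> hP mF F0 Fh; apply: le_integrable (Ihh _ hP) => //; first exact/measurable_EFinP.
  by move=> z _ /=; rewrite lee_fin !ger0_norm.
have : \forall J \near \oo, (\int[mu]_z (rest J z)%:E <= dd%:E)%E.
  apply: (dominated_integral_small _ _ (Ihh _ hmu)) => //.
  - by move=> J z; rewrite rest0 resth.
  - move=> z; have [i hi] := hs z.2 _ eta0; have [j hj] := ht z.1 _ eta0.
    apply: cvg_near_cst; exists (maxn i j).+1 => // J iJ.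
    have iJ' : (i < J)%N by rewrite (leq_trans _ iJ)// ltnS leq_maxl.
    have jJ' : (j < J)%N by rewrite (leq_trans _ iJ)// ltnS leq_maxr.
    rewrite /rest /cv /dv (bump_cover_eq1 eta0 iJ' (ltW hi)).
    by rewrite (bump_cover_eq1 eta0 jJ' (ltW hj)) mulr1 subrr mul0r.
move=> [J _ /(_ J (leqnn J))].
rewrite integral_EFin_Rintegral; last exact: dom.
rewrite lee_fin => hJ.
pose H := \sum_(i < J) (bd (t i) w0 + 2 * eta) `^ p + \sum_(i < J) (`|s i| + 2 * eta) `^ p.
have H0 : 0 <= H by rewrite addr_ge0// sumr_ge0// => i _; exact: powR_ge0.
(* These cells sum to the product of the two covers, and each is a product of a continuous function
   on [X] and a bounded one on [Omega], so weak convergence applies to it. *)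
pose psi (ij : 'I_J * 'I_J) (z : borel Omega * borel X) : R := ps ij.2 z.2 * qs ij.1 z.1.
have psi0 ij z : 0 <= psi ij z by rewrite mulr_ge0.
have psiP ij z : 0 < psi ij z ->
    nd z.2 (s ij.2) < 2 * eta /\ bd z.1 (t ij.1) < 2 * eta.
  move=> hp; have pp : 0 < ps ij.2 z.2.
    by rewrite lt_neqAle ps0 andbT eq_sym; apply: contraTneq hp => h'; rewrite /psi h' mul0r ltxx.
  have qq : 0 < qs ij.1 z.1.
    by rewrite lt_neqAle qs0 andbT eq_sym; apply: contraTneq hp => h'; rewrite /psi h' mulr0 ltxx.
  by split; [exact: (cell_gt0 eta0 pp)|exact: (cell_gt0 eta0 qq)].
have sumpsi z : \sum_ij psi ij z = dv J z.1 * cv J z.2.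
  rewrite /dv /cv -!sum_cell big_distrlr/= pair_big/=.
  by apply: eq_bigr => -[i j] _ /=; rewrite /psi/= mulrC.
have nd0 x y : 0 <= nd x y by exact: normr_ge0.
have bd0 x y : 0 <= bd x y by exact: basedist_ge0.
have hH ij z : 0 < psi ij z -> hh z <= H.
  move=> /psiP[h2 h3]; rewrite /hh /H; apply: lerD.
    rewrite (bigD1 ij.1)//=; apply: (@le_trans _ _ ((bd (t ij.1) w0 + 2 * eta) `^ p)).
      apply: mono => //; rewrite addrC.
      by apply: (le_trans (basedist_triangle _ (t ij.1) _)); rewrite lerD2r ltW.
    by rewrite lerDl sumr_ge0// => *; exact: powR_ge0.
  rewrite (bigD1 ij.2)//=; apply: (@le_trans _ _ ((`|s ij.2| + 2 * eta) `^ p)).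
    apply: mono => //; rewrite -lerBlDl (le_trans _ (ltW h2))//; exact: lerB_dist.
  by rewrite lerDl sumr_ge0// => *; exact: powR_ge0.
have ceps ij z z' : 0 < psi ij z -> 0 < psi ij z' -> c2 (z, z') <= e1.
  move=> /psiP[h2 h3] /psiP[h4 h5].
  rewrite /c2 proddist_powE// [leRHS]splitr; apply: lerD; rewrite -eta4.
    apply: mono => //; apply: (le_trans (basedist_triangle _ (t ij.1) _)).
    by rewrite lerD ?(ltW h3)// basedistC ltW.
  apply: mono => //; rewrite /normdist (le_trans (ler_distD (s ij.2) _ _))//.
  by rewrite lerD ?(ltW h2)// distrC ltW.
have cK z z' : c2 (z, z') <= K * (hh z + hh z').
  rewrite /c2 proddist_powE// /hh addrACA mulrDr; apply: lerD; last exact: normdist_pow_le.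
  apply: le_trans (powR_add_le p1 (bd0 z.1 w0) (bd0 z'.1 w0)).
  apply: mono; first exact: bd0.
  have -> : bd z'.1 w0 = bd w0 z'.1 by exact: basedistC.
  exact: basedist_triangle.
have bound n : (transport_cost c2 (mu_ n) mu <=
    (e1 + K * (H * \sum_ij `|\int[mu_ n]_z psi ij z - \int[mu]_z psi ij z|))%:E
    + K%:E * (\int[mu_ n]_z (rest J z)%:E + \int[mu]_z (rest J z)%:E))%E.
  have -> : rest J = fun z => (1 - \sum_ij psi ij z) * hh z.
    by apply/funext => z; rewrite /rest sumpsi.
  apply: (@transport_cost_le_cells _ _ R (mu_ n) mu ('I_J * 'I_J)%type psi) => //.
  - by move=> ij; apply: measurable_funM; [exact: msnd|exact: mfst].
  - by move=> z; rewrite sumpsi.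
  - exact: proddist_pow_ge0.
  - exact: measurable_proddist_pow.
  - exact: ltW.
  - exact: ltW.
have cvgr : \int[mu_ n]_z rest J z @[n --> \oo] --> \int[mu]_z rest J z.
  (* Of the four terms of the expanded tail, [r1] has the same integral under all measures by the
     fixed marginal; the others are products of a function of growth [p] on [X] and a bounded one on
     [Omega]. *)
  pose r1 (z : borel Omega * borel X) := h1 z.1.
  pose r2 (z : borel Omega * borel X) := h z.2.
  pose r3 (z : borel Omega * borel X) := cv J z.2 * (dv J z.1 * h1 z.1).
  pose r4 (z : borel Omega * borel X) := (cv J z.2 * h z.2) * dv J z.1.
  have restE : rest J = fun z => (r1 z + r2 z) - (r3 z + r4 z).
    by apply/funext => z; rewrite /rest /r1 /r2 /r3 /r4 /hh; ring.
  have r30 z : 0 <= r3 z by rewrite /r3 !mulr_ge0.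
  have r40 z : 0 <= r4 z by rewrite /r4 !mulr_ge0.
  have r3h z : r3 z <= hh z.
    apply: (@le_trans _ _ (h1 z.1)); last by rewrite lerDl.
    by rewrite /r3 mulrA [cv _ _ * _]mulrC ler_piMl.
  have r4h z : r4 z <= hh z.
    apply: (@le_trans _ _ (h z.2)); last by rewrite lerDr.
    by rewrite /r4 mulrC mulrA ler_piMl.
  have m3 : measurable_fun setT r3.
    apply: measurable_funM; first exact: msnd.
    by apply: (mfst (f := fun w => dv J w * h1 w)); exact: measurable_funM.
  have m4 : measurable_fun setT r4.
    apply: measurable_funM; last exact: mfst.
    by apply: (msnd (f := fun x => cv J x * h x)); exact: measurable_funM.
  have RE (P : probability (borel Omega * borel X)%type R) : fst_marginal_moment pi p P ->
      \int[P]_z rest J z = (\int[pi]_w h1 w + \int[P]_z r2 z) -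
        (\int[P]_z r3 z + \int[P]_z r4 z).
    move=> hP; have I1 := If _ hP; have I2 := Ih _ hP.
    have I3 := dom P _ hP m3 r30 r3h; have I4 := dom P _ hP m4 r40 r4h.
    rewrite restE RintegralB//; last 2 first.
    - exact: integrable_RD.
    - exact: integrable_RD.
    rewrite !RintegralD//; congr (_ + _ - _).
    by case: hP => hP _; exact: (ge0_Rintegral_fst hP mh1 h10).
  rewrite (RE _ hmu) (_ : (fun n => _) = fun n => (\int[pi]_w h1 w + \int[mu_ n]_z r2 z) -
      (\int[mu_ n]_z r3 z + \int[mu_ n]_z r4 z)); last first.
    by apply/funext => n; rewrite RE.
  apply: cvgB; apply: cvgD.
  - exact: cvg_cst.
  - have := weak _ C0h (fun=> 1) `|1| (measurable_cst _) (fun=> lexx _).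
    have one (P : probability (borel Omega * borel X)%type R) :
        \int[P]_z (h z.2 * 1) = \int[P]_z r2 z.
      by apply: eq_Rintegral => z _; rewrite mulr1.
    by rewrite one (_ : (fun n => _) = fun n => \int[mu_ n]_z r2 z)//; apply/funext => n.
  (* Although [h1] is unbounded, where [dv J] is nonzero one of the first [J] cells is positive,
     which keeps [w] at bounded distance from [w0]. *)
  - apply: (weak _ (C0cv J) (fun w => dv J w * h1 w)
      (\sum_(i < J) (bd (t i) w0 + 2 * eta) `^ p)); first exact: measurable_funM.
    move=> w; rewrite ger0_norm ?mulr_ge0//.
    have S0 : 0 <= \sum_(i < J) (bd (t i) w0 + 2 * eta) `^ p.
      by apply: sumr_ge0 => i _; exact: powR_ge0.
    have [->|dvn] := eqVneq (dv J w) 0; first by rewrite mul0r.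
    have : \sum_(i < J) qs i w != 0 by rewrite sum_cell.
    rewrite psumr_neq0// => /hasP[i _ /andP[_ qi]].
    have := cell_gt0 eta0 qi => wi.
    apply: (@le_trans _ _ (h1 w)); first by rewrite ler_piMl.
    rewrite (bigD1 i)//=; apply: (@le_trans _ _ ((bd (t i) w0 + 2 * eta) `^ p)).
      apply: mono => //; rewrite addrC.
      by apply: (le_trans (basedist_triangle _ (t i) _)); rewrite lerD2r ltW.
    by rewrite lerDl sumr_ge0// => *; exact: powR_ge0.
  - apply: (weak _ (C0cvh J) (dv J) 1 (mdv J)) => w.
    by rewrite ger0_norm.
pose q := e1 / (K * H + 1) / (#|{: 'I_J * 'I_J}|.+1)%:R.
have KH0 : 0 <= K * H by rewrite mulr_ge0// ltW.
have KH1 : 0 < K * H + 1 by rewrite ltr_wpDl.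
have q0 : 0 < q by rewrite !divr_gt0.
have hS : \forall n \near \oo,
    \sum_ij `|\int[mu_ n]_z psi ij z - \int[mu]_z psi ij z| <= e1 / (K * H + 1).
  have : \forall n \near \oo, forall ij : 'I_J * 'I_J,
      `|\int[mu_ n]_z psi ij z - \int[mu]_z psi ij z| <= q.
    apply: filter_forall => ij.
    have := weak _ (C0ps ij.2) (qs ij.1) 1 (mqs ij.1).
    have qb w : `|qs ij.1 w| <= 1 by rewrite ger0_norm//; exact: cell1.
    move=> /(_ qb)/cvgrPdist_le /(_ _ q0); apply: filterS => n.
    by rewrite distrC.
  apply: filterS => n hn; apply: (@le_trans _ _ (\sum_(ij : 'I_J * 'I_J) q)).
    exact: ler_sum.
  rewrite sumr_const -mulr_natr /q -[leLHS]mulrA.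
  rewrite ler_piMr ?divr_ge0 ?(ltW e10) ?(ltW KH1) ?(ltW e0)//.
  by rewrite mulrC ler_pdivrMr// mul1r ler_nat leqW.
move/cvgrPdist_le : cvgr => /(_ _ dd0); apply: filter_app.
apply: filterS hS => n hSn; rewrite ler_norml => /andP[hr1 hr2].
apply: (le_trans (bound n)).
rewrite integral_EFin_Rintegral; last by apply: dom.
rewrite integral_EFin_Rintegral; last by apply: dom.
rewrite -!EFinD lee_fin.
have k1 : K * (H * \sum_ij `|\int[mu_ n]_z psi ij z - \int[mu]_z psi ij z|) <= e1.
  rewrite mulrA; apply: (@le_trans _ _ (K * H * (e1 / (K * H + 1)))).
    by rewrite ler_wpM2l.
  by rewrite mulrA ler_pdivrMr// mulrC ler_wpM2l ?(ltW e10)// lerDl.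
(* One [dd] for the tail under [mu], and two for the tail under [mu_ n], which exceeds it by at most
   [dd]. *)
have k2 : K * (\int[mu_ n]_z rest J z + \int[mu]_z rest J z) <= 3 * e1.
  have -> : 3 * e1 = K * (3 * dd) by rewrite /dd; field; rewrite gt_eqF.
  have -> : 3 * dd = (dd + dd) + dd by ring.
  rewrite ler_wpM2l ?(ltW K0)//; apply: lerD => //.
  apply: (@le_trans _ _ (\int[mu]_z rest J z + dd)); last by rewrite lerD2r.
  by rewrite -lerBlDl -lerN2 opprB.
apply: le_trans (lerD (lerD (lexx e1) k1) k2) _.
by rewrite le_eqVlt; apply/orP; left; apply/eqP; rewrite /e1; field.
Qed.

End weak_implies_transport.

Theorem theorem3p4 (R : realType)
    (Omega : completePMetricType R) (sepOmega : separable Omega)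
    (X : completeNormedModType R) (sepX : separable X)
    (pi : probability (borel Omega) R)
    (p : R) (p1 : 1 <= p)
    (mu_ : nat -> probability (borel Omega * borel X)%type R)
    (mu : probability (borel Omega * borel X)%type R)
    (hmu_ : forall n, fst_marginal_moment pi p (mu_ n))
    (hmu : fst_marginal_moment pi p mu)
    (k_ : nat -> R.-pker borel Omega ~> borel X)
    (k : R.-pker borel Omega ~> borel X)
    (hk_ : forall n, disintegration pi (mu_ n) (k_ n))
    (hk : disintegration pi mu k) :
  (fibred_wasserstein pi p (k_ n) k @[n --> \oo] --> 0%E
   <->
   forall phi : X -> R, C0p p phi ->
     strong_cvg_L1 pi (fun n => fibre_int phi (k_ n)) (fibre_int phi k))
  /\
  (finite_moment (@basedist R Omega) p pi ->
   (wasserstein (@proddist R Omega X p) p (mu_ n) mu @[n --> \oo] --> 0%E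
    <->
    forall phi : X -> R, C0p p phi ->
      weak_cvg_L1 pi (fun n => fibre_int phi (k_ n)) (fibre_int phi k))).
Proof.
have p0 : 0 < p by rewrite (lt_le_trans ltr01).
split.
  rewrite (fibred_wasserstein_cvge0P pi k_ k p0); split => [H phi Cphi|H].
    exact: (fibred_cvg_strong sepX p1 hmu_ hmu hk_ hk H Cphi).
  exact: (strong_cvg_fibred sepX p1 hmu_ hmu hk_ hk H).
move=> hpi; rewrite (wasserstein_cvge0P _ mu_ mu p0); split => [H phi Cphi|H].
  apply/(weak_cvg_fibre_intP p1 hmu_ hmu hk_ hk Cphi) => g M mg gM.
  by have [] := C0p_product_integral_cvg sepOmega sepX p1 hmu_ hmu H Cphi mg gM.
apply: (weak_cvg_transport sepOmega sepX p1 hpi hmu_ hmu) => phi Cphi g M mg gM.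
have /(weak_cvg_fibre_intP p1 hmu_ hmu hk_ hk Cphi) := H _ Cphi; exact.
Qed.
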